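(* Let $A$ and $D$ be closed operators on Banach spaces $X$ and $Y$, respectively. Let $V,W$ be Banach spaces such that $[D(A)]\hookrightarrow V\hookrightarrow X$ and $[D(D)]\hookrightarrow W\hookrightarrow Y$. Assume that - the linear operator $H$ is bounded from $[D(D)]$ to $V$, or from $W$ to $X$, and - the linear operator $K$ is bounded from $[D(A)]$ to $W$, or from $V$ to $Y$. Then the operator matrix $$\mathcal{A}:=\begin{pmatrix} A & H\\ K & D\end{pmatrix},\qquad D(\mathcal{A}):=D(A)\times D(D),$$ generates a cosine operator function with associated phase space $(V\times W)\times (X\times Y)$ if and only if $A$ and $D$ generate cosine operator functions with associated phase spaces $V\times X$ and $W\times Y$, respectively. In this case, the sine operator function $(S(t,\mathcal{A}))_{t\in\mathbb{R}}$ is compact if and only if the embeddings $[D(A)]\hookrightarrow X$ and $[D(D)]\hookrightarrow Y$ are both compact.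
   Context: For a closed operator $T$ on a Banach space, $[D(T)]$ denotes the domain of $T$ with the graph norm. The symbol $\hookrightarrow$ denotes a continuous embedding. A cosine operator function (COF) on a Banach space $E$ is a strongly continuous family $(C(t))_{t\in\mathbb{R}}$ of bounded linear operators on $E$ with $C(0)=I$ and $C(t+s)+C(t-s)=2C(t)C(s)$ for all $s,t\in\mathbb{R}$. Its generator is $Tx=\frac{d^2}{dt^2}C(t)x|_{t=0}$ on the set of $x$ for which $t\mapsto C(t)x$ is $C^2$. If $T$ generates a COF it is denoted $(C(t,T))_{t\in\mathbb{R}}$. The associated sine operator function (SOF) is $S(t,T)x:=\int_0^t C(s,T)x\,ds$. It is called compact if $S(t,T)$ is a compact operator for every $t\in\mathbb{R}$. A closed operator $T$ on $E$ generates a COF on $E$ if and only if there is a Banach space $F$ with $[D(T)]\hookrightarrow F\hookrightarrow E$ such that $\begin{pmatrix}0&I_F\\ T&0\end{pmatrix}$ with domain $D(T)\times F$ generates a $C_0$-semigroup on $F\times E$. Such an $F$ is unique; it is called the Kisyński space, and $F\times E$ is called the associated phase space. ''$T$ generates a COF with associated phase space $F\times E$'' means that $T$ generates a COF on $E$ and its Kisyński space is $F$. *)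

(* Defs.v *)
From Stdlib Require Import Reals Lra.
From Coquelicot Require Import Coquelicot.

Local Open Scope R_scope.

(* All spaces are over one fixed scalar field, which is either R or C. *)
Inductive scalar_field : Type := real_scalars | complex_scalars.

Definition scalar_ring (k : scalar_field) : AbsRing :=
  match k with
  | real_scalars => R_AbsRing
  | complex_scalars => C_AbsRing
  end.

Coercion scalar_ring : scalar_field >-> AbsRing.type.

Definition of_real (k : scalar_field) : R -> scalar_ring k :=
  match k with
  | real_scalars => fun r => r
  | complex_scalars => RtoC
  end.

Lemma of_real_plus (k : scalar_field) (a b : R) :
  of_real k (a + b) = plus (of_real k a) (of_real k b).
Proof. destruct k; [reflexivity | apply RtoC_plus]. Qed.

Lemma of_real_mult (k : scalar_field) (a b : R) :
  of_real k (a * b) = mult (of_real k a) (of_real k b).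
Proof. destruct k; [reflexivity | apply RtoC_mult]. Qed.

Lemma of_real_one (k : scalar_field) : of_real k 1 = one.
Proof. destruct k; reflexivity. Qed.

Lemma abs_of_real (k : scalar_field) (a : R) : abs (of_real k a) = Rabs a.
Proof. destruct k; [reflexivity | apply Cmod_R]. Qed.

Notation banach k := (CompleteNormedModule (scalar_ring k)).

(* Restriction of scalars to R: the same group, norm and uniform structure.
   Derivatives and integrals of functions of a real variable are taken here,
   since Coquelicot states them for normed modules over R. *)
Section Realify.

Variables (k : scalar_field) (E : banach k).

Definition realify_ModuleSpace_mixin :
  ModuleSpace.mixin_of R_AbsRing (CompleteNormedModule.AbelianGroup _ E).
Proof.
  refine (ModuleSpace.Mixin R_AbsRing (CompleteNormedModule.AbelianGroup _ E)
            (fun (r : R) (x : E) => scal (of_real k r) x) _ _ _ _).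
  - intros a b u. rewrite scal_assoc. f_equal. symmetry. apply of_real_mult.
  - intros u. change (@one R_AbsRing) with 1. rewrite of_real_one.
    apply scal_one.
  - intros a u v. apply (scal_distr_l (of_real k a) u v).
  - intros a b u. change (plus a b) with (a + b). rewrite of_real_plus.
    apply (scal_distr_r (of_real k a) (of_real k b) u).
Defined.

Definition realify_NormedModuleAux : NormedModuleAux R_AbsRing :=
  NormedModuleAux.Pack R_AbsRing E
    (NormedModuleAux.Class R_AbsRing E
       (ModuleSpace.Class R_AbsRing E
          (AbelianGroup.class (CompleteNormedModule.AbelianGroup _ E))
          realify_ModuleSpace_mixin)
       (UniformSpace.class (CompleteNormedModule.UniformSpace _ E))) E.

Definition realify_NormedModule_mixin :
  NormedModule.mixin_of R_AbsRing realify_NormedModuleAux.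
Proof.
  refine (NormedModule.Mixin R_AbsRing realify_NormedModuleAux
            (fun x : E => norm x) (@norm_factor (scalar_ring k) E) _ _ _ _ _).
  - intros x y. exact (norm_triangle (x : E) (y : E)).
  - intros l x. change (abs l) with (Rabs l). rewrite <- (abs_of_real k).
    exact (norm_scal (of_real k l) (x : E)).
  - intros x y eps. exact (norm_compat1 (x : E) (y : E) eps).
  - intros x y eps. exact (norm_compat2 (x : E) (y : E) eps).
  - intros x. exact (norm_eq_zero (x : E)).
Defined.

Definition realify : CompleteNormedModule R_AbsRing :=
  CompleteNormedModule.Pack R_AbsRing E
    (CompleteNormedModule.Class R_AbsRing E
       (NormedModule.Class R_AbsRing E
          (NormedModuleAux.class R_AbsRing realify_NormedModuleAux)
          realify_NormedModule_mixin)
       (CompleteSpace.class (CompleteNormedModule.CompleteSpace _ E))) E.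

End Realify.

Arguments realify {k} E.

(* Coquelicot has products of normed modules, but not of complete ones. *)
Section BanachProduct.

Variables (K : AbsRing) (U V : CompleteNormedModule K).

Definition prod_lim (F : (U * V -> Prop) -> Prop) : U * V :=
  (lim (filtermap fst F), lim (filtermap snd F)).

Lemma prod_complete (F : (U * V -> Prop) -> Prop) :
  ProperFilter F -> cauchy F -> forall eps : posreal, F (ball (prod_lim F) eps).
Proof.
  intros FF HF eps.
  assert (HU : F (fun y => ball (lim (filtermap fst F)) eps (fst y))).
  { apply (complete_cauchy (filtermap fst F)).
    - apply filtermap_proper_filter; exact FF.
    - intros e. destruct (HF e) as [x Hx]. exists (fst x). unfold filtermap.
      revert Hx. apply filter_imp. intros y Hy. exact (proj1 Hy). }
  assert (HV : F (fun y => ball (lim (filtermap snd F)) eps (snd y))).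
  { apply (complete_cauchy (filtermap snd F)).
    - apply filtermap_proper_filter; exact FF.
    - intros e. destruct (HF e) as [x Hx]. exists (snd x). unfold filtermap.
      revert Hx. apply filter_imp. intros y Hy. exact (proj2 Hy). }
  generalize (filter_and _ _ HU HV). apply filter_imp.
  intros y Hy. exact Hy.
Qed.

Lemma prod_close_lim (F1 F2 : (U * V -> Prop) -> Prop) :
  filter_le F1 F2 -> filter_le F2 F1 -> close (prod_lim F1) (prod_lim F2).
Proof.
  intros H12 H21 eps. split; simpl.
  - apply (close_lim (filtermap fst F1) (filtermap fst F2)).
    + intros P; apply H12.
    + intros P; apply H21.
  - apply (close_lim (filtermap snd F1) (filtermap snd F2)).
    + intros P; apply H12.
    + intros P; apply H21.
Qed.

Definition prod_CompleteSpace_mixin :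
  CompleteSpace.mixin_of (prod_UniformSpace U V) :=
  CompleteSpace.Mixin (prod_UniformSpace U V) prod_lim
    prod_complete prod_close_lim.

Canonical prod_CompleteNormedModule : CompleteNormedModule K :=
  CompleteNormedModule.Pack K (U * V)
    (CompleteNormedModule.Class K (U * V)
       (NormedModule.class K (prod_NormedModule K U V))
       prod_CompleteSpace_mixin) (U * V).

End BanachProduct.

Arguments prod_CompleteNormedModule {K} U V.

Notation "E '\x' F" := (prod_CompleteNormedModule E F)
  (at level 40, left associativity).

(* A partially defined map E -> F. The values of [app] outside [dom] are
   irrelevant: every notion below only looks at [app x] for [x] in [dom]. *)
Record operator (E F : Type) : Type := Operator {
  dom : E -> Prop;
  app :> E -> F
}.

Arguments Operator {E F} dom app.
Arguments dom {E F} o _.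
Arguments app {E F} o _.

Section Operators.

Context {k : scalar_field}.

Record linear_operator {E F : banach k} (T : operator E F) : Prop := {
  dom_zero : dom T zero;
  dom_plus : forall x y, dom T x -> dom T y -> dom T (plus x y);
  dom_scal : forall (a : k) x, dom T x -> dom T (scal a x);
  app_plus : forall x y, dom T x -> dom T y -> T (plus x y) = plus (T x) (T y);
  app_scal : forall (a : k) x, dom T x -> T (scal a x) = scal a (T x)
}.

Definition closed_operator {E : banach k} (T : operator E E) : Prop :=
  linear_operator T /\
  closed (fun p : E * E => dom T (fst p) /\ T (fst p) = snd p).

Definition graph_norm {E : banach k} (T : operator E E) (x : E) : R :=
  norm x + norm (T x).

(* A continuous embedding F \hookrightarrow E is an injective bounded linear
   map j, which identifies F with the subspace j(F) of E. *)
Definition continuous_embedding {F E : banach k} (j : F -> E) : Prop :=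
  is_linear j /\ forall u v, j u = j v -> u = v.

(* [D(T)] \hookrightarrow F inside E, where F sits in E through j. *)
Definition domain_embeds {F E : banach k} (T : operator E E) (j : F -> E) :
  Prop :=
  exists M : R, forall x, dom T x ->
    exists v, j v = x /\ norm v <= M * graph_norm T x.

(* H is bounded from [D(T)] to V, where V sits in G through j. *)
Definition bounded_from_domain {E G V : banach k} (T : operator E E)
  (H : operator E G) (j : V -> G) : Prop :=
  exists M : R, forall y, dom T y ->
    dom H y /\ exists v, j v = H y /\ norm v <= M * graph_norm T y.

(* H is bounded from W to G, where W sits in E through i. *)
Definition bounded_from_subspace {W E G : banach k} (i : W -> E)
  (H : operator E G) : Prop :=
  exists M : R, forall w, dom H (i w) /\ norm (H (i w)) <= M * norm w.

Definition operator_matrix {X Y : banach k} (A : operator X X)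
  (H : operator Y X) (K : operator X Y) (D : operator Y Y) :
  operator (X \x Y) (X \x Y) :=
  Operator (fun p => dom A (fst p) /\ dom D (snd p))
           (fun p => (plus (A (fst p)) (H (snd p)),
                      plus (K (fst p)) (D (snd p)))).

Definition prod_map {V W X Y : banach k} (i : V -> X) (j : W -> Y) :
  V \x W -> X \x Y :=
  fun p => (i (fst p), j (snd p)).

Section Families.

Context {E : banach k}.

Record is_c0_semigroup (S : R -> E -> E) : Prop := {
  c0_bounded : forall t, 0 <= t -> is_linear (S t);
  c0_zero : forall x, S 0 x = x;
  c0_plus : forall t s, 0 <= t -> 0 <= s ->
    forall x, S (t + s) x = S t (S s x);
  c0_continuous : forall x t, 0 <= t ->
    filterlim (fun s => S s x) (within (fun s => 0 <= s) (locally t))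
      (locally (S t x))
}.

Definition is_c0_generator (S : R -> E -> E) (T : operator E E) : Prop :=
  forall x y, (dom T x /\ T x = y) <->
    filterlim (fun h : R => scal (of_real k (/ h)) (minus (S h x) x))
      (at_right 0) (locally y).

Definition generates_c0_semigroup (T : operator E E) : Prop :=
  exists S, is_c0_semigroup S /\ is_c0_generator S T.

Record is_cof (C : R -> E -> E) : Prop := {
  cof_bounded : forall t, is_linear (C t);
  cof_zero : forall x, C 0 x = x;
  cof_dalembert : forall t s x,
    plus (C (t + s) x) (C (t - s) x) = scal (of_real k 2) (C t (C s x));
  cof_continuous : forall x t, continuous (fun s => C s x) t
}.

(* f is C^2 on R with derivatives f1 and f2. *)
Definition is_C2 (f f1 f2 : R -> E) : Prop :=
  (forall t, is_derive (V := realify E) f t (f1 t)) /\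
  (forall t, is_derive (V := realify E) f1 t (f2 t)) /\
  (forall t, continuous f2 t).

Definition is_cof_generator (C : R -> E -> E) (T : operator E E) : Prop :=
  forall x y, (dom T x /\ T x = y) <->
    exists f1 f2, is_C2 (fun t => C t x) f1 f2 /\ f2 0 = y.

(* C is (C(t,T))_t. *)
Definition cof_generated_by (T : operator E E) (C : R -> E -> E) : Prop :=
  is_cof C /\ is_cof_generator C T.

Definition sine (C : R -> E -> E) (t : R) (x : E) : E :=
  RInt (V := realify E) (fun s => C s x) 0 t.

Definition has_convergent_subsequence (u : nat -> E) : Prop :=
  exists phi : nat -> nat, (forall n, (phi n < phi (S n))%nat) /\
    exists l : E, filterlim (fun n => u (phi n)) eventually (locally l).

Definition compact_operator (L : E -> E) : Prop :=
  is_linear L /\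
  forall u : nat -> E, (exists M : R, forall n, norm (u n) <= M) ->
    has_convergent_subsequence (fun n => L (u n)).

(* Compactness of the embedding [D(T)] \hookrightarrow E. *)
Definition compact_domain_embedding (T : operator E E) : Prop :=
  forall u : nat -> E, (forall n, dom T (u n)) ->
    (exists M : R, forall n, graph_norm T (u n) <= M) ->
    has_convergent_subsequence u.

End Families.

(* The operator matrix with rows (0, I_F) and (T, 0), with domain D(T) x F,
   on F x E: the second component of p has to lie in j(F), and its preimage
   in F is the first component of the value. *)
Definition phase_matrix {F E : banach k} (T : operator E E) (j : F -> E) :
  operator (F \x E) (F \x E) :=
  Operator (fun p => dom T (j (fst p)) /\ exists v, j v = snd p)
           (fun p => (iota (fun v => j v = snd p), T (j (fst p)))).

Record generates_cof_with_phase_space {F E : banach k} (T : operator E E)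
  (j : F -> E) : Prop := {
  phase_cof : exists C, cof_generated_by T C;
  phase_embedding : continuous_embedding j;
  phase_domain : domain_embeds T j;
  phase_semigroup : generates_c0_semigroup (phase_matrix T j)
}.

End Operators.

(* Main.v *)
(* Write the second order problem for the operator matrix as a first order one on
   the phase space (V x W) x (X x Y). Its generator, reordered, is the direct sum
   of the phase space generators of A and D plus the off-diagonal part
   (v, w, x, y) |-> (0, 0, H w, K v). Such a generator G anticommutes with
   (v, x) |-> (v, -x), so it generates a group U. Where H (or K) is bounded on
   the W (or V) norm, the perturbation is bounded and the perturbed group is
   U t V t with V' = U (-t) Q U t V. Where it is bounded from the domain into
   V (or W), the perturbation P is bounded on [D(G)] and G + P is similar, through
   1 - P (l - G)^-1, to a bounded perturbation of G. Both steps can be undone; for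
   the second one the graph norms before and after perturbation must be equivalent,
   which follows from the closed graph theorem. The cosine function is recovered as
   C t y = snd (U t (0, y)). Finally J t = int_0^t S satisfies J t x in D(T),
   T (J t x) = C t x - x, and x = C t x - J t (T x) on D(T); hence S t is a norm limit
   of the operators (J (t + h) - J t) / h, and the embedding of [D(T)] is a norm limit
   of the operators S t / t, so one is compact if and only if the other is. *)
Require Import Defs.
From Stdlib Require Import Reals Lra Lia List Classical ClassicalEpsilon.
From Coquelicot Require Import Coquelicot.

Local Open Scope R_scope.
Set Bullet Behavior "Strict Subproofs".

(** * Limits and Zabreiko's lemma *)

(** Working with groups rather than semigroups keeps the perturbation steps elementary: once U (- t)
    is available, a bounded perturbation amounts to a linear differential equation with strongly
    continuous bounded coefficients, which Picard iteration solves; neither Hille-Yosida estimates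
    nor Dyson series occur. What remains to be paid is Baire category, and one lemma of Zabreiko
    yields both uniform boundedness and the closed graph theorem.

    The four combinations of hypotheses on H and K are treated at once: each operator is a sum of a
    part bounded from the domain and a part bounded from the intermediate space, one of them being
    zero.

    The delicate direction is from the matrix to its entries. The hypotheses measure H and K in the
    graph norms of A and D, whereas the given group controls only that of the matrix; closedness of
    A and D bridges the gap.

    All analysis is done over the reals. Linearity over the given scalars is recovered afterwards,
    because multiplication by a scalar commutes with the generator and hence with the group. *)

Notation rbanach := (CompleteNormedModule R_AbsRing) (only parsing).
(* Vectors of a complete space are typed in its underlying normed module: the two
   families of canonical instances are convertible, but mixing them blocks
   rewriting and [lra]. *)
Notation nm := (CompleteNormedModule.NormedModule _) (only parsing).

(** * Linear identities by reflection *)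

Module Vec.

Inductive expr : Type :=
| EZero | EVar (n : nat) | EPlus (a b : expr) | EMinus (a b : expr)
| EOpp (a : expr) | EScal (r : R) (a : expr).

Fixpoint coeff (e : expr) (n : nat) : R :=
  match e with
  | EZero => 0
  | EVar m => if Nat.eqb m n then 1 else 0
  | EPlus a b => coeff a n + coeff b n
  | EMinus a b => coeff a n - coeff b n
  | EOpp a => - coeff a n
  | EScal r a => r * coeff a n
  end.

Section Denote.

Context {E : NormedModule R_AbsRing}.

Fixpoint denote (l : list E) (e : expr) : E :=
  match e with
  | EZero => zero
  | EVar n => nth n l zero
  | EPlus a b => plus (denote l a) (denote l b)
  | EMinus a b => minus (denote l a) (denote l b)
  | EOpp a => opp (denote l a)
  | EScal r a => scal r (denote l a)
  end.

Fixpoint combination (c : nat -> R) (l : list E) : E :=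
  match l with
  | nil => zero
  | x :: l' => plus (scal (c 0%nat) x) (combination (fun n => c (S n)) l')
  end.

(** The recursion follows the list of atoms, so that [simpl] unfolds it into finitely many equations
    between real numbers, ready for [ring] and [field]. *)
Fixpoint same_coeffs (c d : nat -> R) (l : list E) : Prop :=
  match l with
  | nil => True
  | _ :: l' => c 0%nat = d 0%nat /\
      same_coeffs (fun n => c (S n)) (fun n => d (S n)) l'
  end.

Lemma combination_ext (l : list E) :
  forall c d, same_coeffs c d l -> combination c l = combination d l.
Proof.
  induction l as [|x l IH]; intros c d H; simpl; [easy|].
  destruct H as [H0 H]. now rewrite H0, (IH _ _ H).
Qed.

Lemma combination_zero (l : list E) :
  combination (fun _ => 0) l = zero.
Proof.
  induction l as [|x l IH]; simpl; [easy|].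
  rewrite IH, plus_zero_r. apply (scal_zero_l x).
Qed.

Lemma combination_plus (l : list E) :
  forall c d, combination (fun n => c n + d n) l
              = plus (combination c l) (combination d l).
Proof.
  induction l as [|x l IH]; intros c d; simpl; [now rewrite plus_zero_r|].
  rewrite IH.
  replace (scal (c 0%nat + d 0%nat) x)
    with (plus (scal (c 0%nat) x) (scal (d 0%nat) x))
    by (symmetry; exact (scal_distr_r (c 0%nat) (d 0%nat) x)).
  rewrite <- !plus_assoc. f_equal.
  rewrite !plus_assoc. f_equal. apply plus_comm.
Qed.

Lemma combination_scal (l : list E) (r : R) :
  forall c, combination (fun n => r * c n) l = scal r (combination c l).
Proof.
  induction l as [|x l IH]; intros c; simpl.
  - symmetry. apply (scal_zero_r (V := E) r).
  - rewrite IH, scal_distr_l, scal_assoc. reflexivity.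
Qed.

Lemma combination_opp (l : list E) :
  forall c, combination (fun n => - c n) l = opp (combination c l).
Proof.
  intros c. transitivity (scal (-1) (combination c l));
    [|exact (scal_opp_one (V := E) (combination c l))].
  rewrite <- (combination_scal l (-1)). apply combination_ext.
  revert c. induction l as [|x l IH]; intros c; simpl; [easy|].
  split; [ring | apply (IH (fun n => c (S n)))].
Qed.

(** Normal form of an expression. An index beyond the list denotes [zero], in agreement with
    [combination], which ignores coefficients past the end. *)
Lemma denote_combination (l : list E) (e : expr) :
  denote l e = combination (coeff e) l.
Proof.
  induction e as [|n|e1 IHe1 e2 IHe2|e1 IHe1 e2 IHe2|e IHe|r e IHe]; simpl.
  - symmetry; apply combination_zero.
  - revert n. induction l as [|x l IH]; intros n; simpl; [now destruct n|].
    destruct n as [|n]; simpl.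
    + rewrite combination_zero, plus_zero_r. symmetry; apply (scal_one x).
    + rewrite (IH n). symmetry.
      etransitivity; [|apply plus_zero_l]. f_equal. apply (scal_zero_l x).
  - rewrite IHe1, IHe2. symmetry. apply (combination_plus l (coeff e1) (coeff e2)).
  - rewrite IHe1, IHe2. unfold minus. rewrite <- combination_opp. symmetry.
    apply (combination_plus l (coeff e1) (fun n => - coeff e2 n)).
  - rewrite IHe. symmetry. apply (combination_opp l (coeff e)).
  - rewrite IHe. symmetry. apply (combination_scal l r (coeff e)).
Qed.

Lemma denote_eq (l : list E) (a b : expr) :
  same_coeffs (coeff a) (coeff b) l -> denote l a = denote l b.
Proof.
  intros H. rewrite !denote_combination. now apply combination_ext.
Qed.

End Denote.

Ltac index x l :=
  lazymatch l with
  | x :: _ => constr:(0%nat)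
  | _ :: ?l' => let n := index x l' in constr:(S n)
  end.

Ltac member x l :=
  lazymatch l with
  | nil => constr:(false)
  | x :: _ => constr:(true)
  | _ :: ?l' => member x l'
  end.

Ltac atoms l e :=
  lazymatch e with
  | plus ?a ?b => let l := atoms l a in atoms l b
  | minus ?a ?b => let l := atoms l a in atoms l b
  | opp ?a => atoms l a
  | scal _ ?a => atoms l a
  | zero => l
  | _ => let b := member e l in
         lazymatch b with true => l | false => constr:(e :: l) end
  end.

Ltac reify l e :=
  lazymatch e with
  | plus ?a ?b => let a := reify l a in let b := reify l b in
                  constr:(EPlus a b)
  | minus ?a ?b => let a := reify l a in let b := reify l b in
                   constr:(EMinus a b)
  | opp ?a => let a := reify l a in constr:(EOpp a)
  | scal ?r ?a => let a := reify l a in constr:(EScal r a)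
  | zero => constr:(EZero)
  | _ => let n := index e l in constr:(EVar n)
  end.

End Vec.

(* Proves linear identities in a real vector space, leaving at most
   identities between real coefficients. *)
Ltac vec E :=
  lazymatch goal with
  | |- @eq _ ?a ?b =>
    let T := constr:(NormedModule.sort R_AbsRing E) in
    let l := Vec.atoms (@nil T) a in
    let l := Vec.atoms l b in
    let a' := Vec.reify l a in
    let b' := Vec.reify l b in
    change (@Vec.denote E l a' = @Vec.denote E l b');
    apply Vec.denote_eq; simpl;
    repeat split; try ring; try (field; lra)
  end.

Lemma norm_minus_diag {K : AbsRing} {E : NormedModule K} (x : E) : norm (minus x x) = 0.
Proof.
  transitivity (norm (zero : E)); [|apply norm_zero].
  exact (f_equal norm (minus_eq_zero x)).
Qed.

Ltac norm_diag :=
  match goal with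
  | |- context [@norm ?K ?E (@minus ?G ?x ?x)] =>
    replace (@norm K E (@minus G x x)) with 0
      by (symmetry; exact (norm_minus_diag (E := E) x))
  end.

(** * Convergent sequences and norm estimates *)

Section Limits.

Context {K : AbsRing}.

Lemma filterlim_norm_iff {T : Type} {E : NormedModule K} (F : (T -> Prop) -> Prop)
  {FF : Filter F} (f : T -> E) (l : E) :
  filterlim f F (locally l) <->
  forall eps, 0 < eps -> F (fun x => norm (minus (f x) l) < eps).
Proof.
  rewrite (@filterlim_locally_ball_norm K T E F FF). split.
  - intros H eps He. exact (H (mkposreal eps He)).
  - intros H eps. exact (H eps (cond_pos eps)).
Qed.

Definition tends {E : NormedModule K} (u : nat -> E) (l : E) : Prop :=
  filterlim u eventually (locally l).

Lemma tends_iff {E : NormedModule K} (u : nat -> E) (l : E) :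
  tends u l <->
  forall eps, 0 < eps -> exists N, forall n, (N <= n)%nat ->
    norm (minus (u n) l) < eps.
Proof. apply (filterlim_norm_iff eventually). Qed.

Lemma tends_unique {E : NormedModule K} (u : nat -> E) (l l' : E) :
  tends u l -> tends u l' -> l = l'.
Proof. apply (filterlim_locally_unique (F := eventually)). Qed.

Lemma tends_linear {E F : NormedModule K} (L : E -> F) (u : nat -> E) (l : E) :
  is_linear L -> tends u l -> tends (fun n => L (u n)) (L l).
Proof.
  intros HL Hu. apply (filterlim_comp _ _ _ u L _ _ _ Hu).
  apply (linear_cont L l HL).
Qed.

Lemma tends_plus {E : NormedModule K} (u v : nat -> E) (l m : E) :
  tends u l -> tends v m -> tends (fun n => plus (u n) (v n)) (plus l m).
Proof.
  intros Hu Hv. eapply filterlim_comp_2; [exact Hu|exact Hv|apply filterlim_plus].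
Qed.

Lemma tends_minus {E : NormedModule K} (u v : nat -> E) (l m : E) :
  tends u l -> tends v m -> tends (fun n => minus (u n) (v n)) (minus l m).
Proof.
  intros Hu Hv. apply (tends_plus u (fun n => opp (v n))); [exact Hu|].
  apply (tends_linear opp v m); [apply is_linear_opp|exact Hv].
Qed.

Lemma tends_const {E : NormedModule K} (l : E) : tends (fun _ => l) l.
Proof. apply filterlim_const. Qed.

Lemma norm_le_eq {E : NormedModule K} (x y : E) (M : R) :
  x = y -> norm y <= M -> norm x <= M.
Proof. now intros ->. Qed.

Lemma norm_lt_eq {E : NormedModule K} (x y : E) (M : R) :
  x = y -> norm y < M -> norm x < M.
Proof. now intros ->. Qed.

Lemma norm_minus_sym {E : NormedModule K} (x y : E) :
  norm (minus x y) = norm (minus y x).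
Proof. rewrite <- (opp_minus y x). apply norm_opp. Qed.

Lemma norm_minus_le {E : NormedModule K} (x y : E) :
  norm (minus x y) <= norm x + norm y.
Proof.
  unfold minus. eapply Rle_trans; [apply norm_triangle|].
  rewrite (norm_opp y). lra.
Qed.

Lemma norm_plus_le {E : NormedModule K} (x y : E) (a b : R) :
  norm x <= a -> norm y <= b -> norm (plus x y) <= a + b.
Proof. intros. eapply Rle_trans; [apply norm_triangle|]. lra. Qed.

Lemma norm_dist_le {E : NormedModule K} (x y z : E) :
  norm (minus x z) <= norm (minus x y) + norm (minus y z).
Proof. rewrite (minus_trans y x z). apply norm_triangle. Qed.

Lemma norm_le_dist {E : NormedModule K} (x y : E) :
  norm x <= norm (minus x y) + norm y.
Proof.
  eapply Rle_trans; [|apply norm_triangle].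
  apply Req_le. f_equal. unfold minus.
  rewrite <- plus_assoc. etransitivity; [symmetry; apply plus_zero_r|].
  f_equal. symmetry. apply (plus_opp_l y).
Qed.

Lemma tends_norm_le {E : NormedModule K} (u : nat -> E) (l : E) (M : R) :
  tends u l -> (forall n, norm (u n) <= M) -> norm l <= M.
Proof.
  intros Hu HM. apply Rnot_lt_le. intros Hlt.
  destruct (proj1 (tends_iff u l) Hu (norm l - M)) as [N HN]; [lra|].
  specialize (HN N (le_n N)). specialize (HM N).
  generalize (norm_le_dist l (u N)). rewrite norm_minus_sym. lra.
Qed.

Lemma cauchy_tends {E : CompleteNormedModule K} (u : nat -> nm E) :
  (forall eps, 0 < eps -> exists N, forall n m, (N <= n)%nat -> (N <= m)%nat ->
    norm (minus (u n) (u m)) < eps) ->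
  exists l, tends u l.
Proof.
  intros H. apply (proj1 (filterlim_locally_cauchy (F := eventually) u)). intros eps.
  destruct (H eps (cond_pos eps)) as [N HN].
  exists (fun n => (N <= n)%nat). split; [now exists N|].
  intros n m Hn Hm. apply (norm_compat1 (u n) (u m) eps). now apply HN.
Qed.

(** The increments are dominated by those of [r], so the distance from [u n] to [u m] is at most r n
    - r m. This gives the Cauchy property together with an error bound; every geometric series below
    (category argument, closed graph, Neumann, Picard) is summed this way. *)
Lemma telescoping_tends {E : CompleteNormedModule K} (u : nat -> nm E) (r : nat -> R) :
  (forall n, norm (minus (u (S n)) (u n)) <= r n - r (S n)) ->
  (forall n, 0 <= r n) ->
  (forall eps, 0 < eps -> exists N, r N < eps) ->
  exists l, tends u l /\ forall n, norm (minus l (u n)) <= r n.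
Proof.
  intros Hu Hr Hr0.
  assert (Hmn : forall m n, (n <= m)%nat -> norm (minus (u m) (u n)) <= r n - r m).
  { intros m n Hnm. induction Hnm as [|m Hnm IH].
    - norm_diag. lra.
    - eapply Rle_trans; [apply (norm_dist_le _ (u m))|].
      specialize (Hu m). lra. }
  destruct (cauchy_tends u) as [l Hl].
  { intros eps He. destruct (Hr0 (eps / 2)) as [N HN]; [lra|]. exists N.
    intros n m Hn Hm. eapply Rle_lt_trans; [apply (norm_dist_le _ (u N))|].
    rewrite (norm_minus_sym (u N)).
    generalize (Hmn n N Hn) (Hmn m N Hm) (Hr n) (Hr m). lra. }
  exists l. split; [exact Hl|]. intros n.
  apply Rnot_lt_le. intros Hlt.
  destruct (proj1 (tends_iff u l) Hl (norm (minus l (u n)) - r n)) as [N HN]; [lra|].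
  specialize (HN (max N n) (Nat.le_max_l _ _)).
  generalize (Hmn _ n (Nat.le_max_r N n)) (Hr (max N n))
    (norm_dist_le l (u (max N n)) (u n)).
  rewrite (norm_minus_sym l (u (max N n))). lra.
Qed.

End Limits.

Lemma pow_half_lt (C eps : R) : 0 < eps -> exists n, C * (1 / 2) ^ n < eps.
Proof.
  intros He. destruct (Rle_lt_dec C 0) as [HC|HC].
  - exists 0%nat. simpl. lra.
  - destruct (pow_lt_1_zero (1/2)) with (y := eps / C) as [N HN].
    + rewrite Rabs_pos_eq; lra.
    + apply Rdiv_lt_0_compat; lra.
    + exists N. specialize (HN N (le_n N)).
      rewrite Rabs_pos_eq in HN by (apply pow_le; lra).
      apply (Rmult_lt_compat_l C) in HN; [|lra].
      now replace (C * (eps / C)) with eps in HN by (field; lra).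
Qed.

Lemma pow_half_pos n : 0 < (1 / 2) ^ n.
Proof. apply pow_lt; lra. Qed.

Lemma pow_half_le_1 n : (1 / 2) ^ n <= 1.
Proof. induction n as [|n IH]; simpl; [lra|]. generalize (pow_half_pos n). lra. Qed.

(** The bound of a normed module, applied also to the inverse scalar, is an equality. *)
Lemma norm_scal_R {E : NormedModule R_AbsRing} (a : R) (x : E) :
  norm (scal a x) = Rabs a * norm x.
Proof.
  apply Rle_antisym; [apply (norm_scal a x)|].
  destruct (Req_dec a 0) as [->|Ha].
  - rewrite Rabs_R0, Rmult_0_l. apply norm_ge_0.
  - assert (Hx : x = scal (/ a) (scal a x)).
    { vec E; field; auto. }
    rewrite Hx at 1.
    apply Rle_trans with (Rabs a * (Rabs (/ a) * norm (scal a x))).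
    + apply Rmult_le_compat_l; [apply Rabs_pos|]. apply (norm_scal (/ a) (scal a x)).
    + rewrite <- Rmult_assoc, <- Rabs_mult, Rinv_r, Rabs_R1 by auto. lra.
Qed.

Section Zabreiko.

Context {E : rbanach} (p : nm E -> R).

Hypothesis p_plus : forall x y, p (plus x y) <= p x + p y.
Hypothesis p_scal : forall a x, p (scal a x) = Rabs a * p x.
(** A weak form of countable subadditivity: it concerns only series whose terms decrease
    geometrically, and only the resulting bound 2 C. *)
Hypothesis p_geometric : forall (s : nat -> nm E) x C, s 0%nat = zero ->
  (forall n, p (minus (s (S n)) (s n)) <= C * (1 / 2) ^ n) ->
  tends s x -> p x <= 2 * C.

(* Baire category: some sublevel set of [p] is dense in a ball. *)
Lemma sublevel_dense_in_ball :
  exists (n : nat) (a : nm E) (r : R), 0 < r /\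
    forall z : nm E, norm (minus z a) < r -> forall eps, 0 < eps ->
      exists z' : nm E, norm (minus z z') < eps /\ p z' <= INR n.
Proof.
  apply NNPP. intros Hno.
  (* If no sublevel set is dense in a ball, every ball contains a smaller closed ball on which p >
     n. A common point of nested balls of this kind would have p larger than every n. *)
  assert (step : forall (n : nat) (ar : nm E * R), 0 < snd ar -> exists br : nm E * R,
    0 < snd br /\ snd br <= snd ar / 2 /\
    norm (minus (fst br) (fst ar)) <= snd ar - snd br /\
    forall z : nm E, norm (minus z (fst br)) <= snd br -> INR n < p z).
  { intros n [a r] Hr. simpl in *. apply NNPP. intros Hno2. apply Hno.
    exists n, a, r. split; [exact Hr|]. intros z Hz eps He.
    apply NNPP. intros Hno3. apply Hno2.
    set (q := r - norm (minus z a : nm E)).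
    assert (Hq : 0 < q) by (apply Rlt_0_minus; exact Hz).
    set (r' := Rmin (eps / 2) (Rmin q (r / 2))).
    assert (Hr' : r' <= eps / 2 /\ r' <= q /\ r' <= r / 2).
    { unfold r'. repeat split.
      - apply Rmin_l.
      - eapply Rle_trans; [apply Rmin_r|apply Rmin_l].
      - eapply Rle_trans; [apply Rmin_r|apply Rmin_r]. }
    exists (z, r'). split; [|split; [|split]].
    - unfold r'. repeat apply Rmin_glb_lt; lra.
    - simpl. lra.
    - assert (H : norm (minus z a : nm E) <= r - r') by (unfold q in *; lra). exact H.
    - intros z' Hz'. simpl in Hz'. apply Rnot_le_lt. intros Hp. apply Hno3.
      exists z'. split; [|exact Hp]. rewrite norm_minus_sym. lra. }
  (* At a nonpositive radius [next] is the identity; the sequence [w] never reaches this case. *)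
  set (next := fun n (ar : nm E * R) =>
    match excluded_middle_informative (0 < snd ar) with
    | left H => proj1_sig (constructive_indefinite_description _ (step n ar H))
    | right _ => ar
    end).
  assert (Hnext : forall n ar, 0 < snd ar ->
    0 < snd (next n ar) /\ snd (next n ar) <= snd ar / 2 /\
    norm (minus (fst (next n ar)) (fst ar)) <= snd ar - snd (next n ar) /\
    forall z, norm (minus z (fst (next n ar))) <= snd (next n ar) -> INR n < p z).
  { intros n ar Har. unfold next.
    destruct (excluded_middle_informative (0 < snd ar)) as [H|H]; [|easy].
    exact (proj2_sig (constructive_indefinite_description _ (step n ar H))). }
  set (w := nat_rect (fun _ => (nm E * R)%type) (zero, 1) next).
  assert (Hw : forall n, 0 < snd (w n)).
  { induction n as [|n IH]; simpl; [lra|]. now apply Hnext. }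
  destruct (telescoping_tends (fun n => fst (w n)) (fun n => snd (w n))) as [l [_ Hl]].
  - intros n. simpl. now apply Hnext.
  - intros n. left. apply Hw.
  - intros eps He. destruct (pow_half_lt 1 eps He) as [N HN]. exists N.
    eapply Rle_lt_trans; [|exact HN]. clear HN.
    induction N as [|N IH]; [simpl; lra|].
    change (w (S N)) with (next N (w N)). rewrite <- tech_pow_Rmult.
    destruct (Hnext N (w N) (Hw N)) as [_ [H _]]. lra.
  - assert (Hp : forall n, INR n < p l).
    { intros n. destruct (Hnext n (w n) (Hw n)) as [_ [_ [_ H]]].
      apply H. apply (Hl (S n)). }
    destruct (INR_unbounded (p l)) as [n Hn]. specialize (Hp n). lra.
Qed.

(** The ball is centred at a, not at 0: the difference of approximations of a + x / c and of a
    approximates x / c, and homogeneity scales it back to x. *)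
Lemma sublevel_approximates :
  exists C, 0 <= C /\ forall (x : nm E) eps, 0 < eps ->
    exists x' : nm E, norm (minus x x') < eps /\ p x' <= C * norm x.
Proof.
  destruct sublevel_dense_in_ball as (n & a & r & Hr & Hd).
  exists (4 * INR n / r). split.
  { apply Rmult_le_pos; [|left; now apply Rinv_0_lt_compat].
    generalize (pos_INR n); lra. }
  intros x eps He. destruct (Req_dec (norm x) 0) as [H0|H0].
  { exists (zero : nm E). split.
    - replace (minus x (zero : nm E)) with x by vec (nm E). lra.
    - replace (p zero) with (p (scal 0 (zero : nm E))) by (f_equal; vec (nm E)).
      rewrite p_scal, Rabs_R0. rewrite H0; lra. }
  assert (Hx : 0 < norm x) by (generalize (norm_ge_0 x); lra).
  (* With this c the vector x / c has norm r / 2, so a + x / c stays inside the ball. *)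
  set (c := 2 * norm x / r).
  assert (Hc : 0 < c) by (apply Rdiv_lt_0_compat; lra).
  destruct (Hd a) with (eps := eps / (2 * c)) as (z2 & Hz2 & Hp2).
  { norm_diag. exact Hr. }
  { apply Rdiv_lt_0_compat; lra. }
  destruct (Hd (plus a (scal (/ c) x))) with (eps := eps / (2 * c)) as (z1 & Hz1 & Hp1).
  { replace (minus (plus a (scal (/ c) x)) a) with (scal (/ c) x) by vec (nm E).
    rewrite norm_scal_R, Rabs_pos_eq by (left; now apply Rinv_0_lt_compat).
    unfold c. replace (/ (2 * norm x / r) * norm x) with (r / 2) by (field; lra).
    lra. }
  { apply Rdiv_lt_0_compat; lra. }
  exists (scal c (minus z1 z2)). split.
  - replace (minus x (scal c (minus z1 z2)))
      with (scal c (minus (minus (plus a (scal (/ c) x)) z1) (minus a z2)))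
      by (vec (nm E); field; lra).
    rewrite norm_scal_R, Rabs_pos_eq by lra.
    apply Rle_lt_trans with (c * (norm (minus (plus a (scal (/ c) x)) z1) + norm (minus a z2))).
    { apply Rmult_le_compat_l; [lra|]. apply norm_minus_le. }
    replace eps with (c * (eps / (2 * c) + eps / (2 * c))) by (field; lra).
    apply Rmult_lt_compat_l; lra.
  - rewrite p_scal, Rabs_pos_eq by lra.
    replace (4 * INR n / r * norm x) with (c * (INR n + INR n)) by (unfold c; field; lra).
    apply Rmult_le_compat_l; [lra|].
    replace (minus z1 z2) with (plus z1 (scal (-1) z2)) by vec (nm E).
    eapply Rle_trans; [apply p_plus|]. rewrite p_scal, (Rabs_left (-1)) by lra. lra.
Qed.

(** Approximating the successive remainders writes x as a series: the remainder after n terms has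
    norm at most (1/2)^n times that of x, and p of the next term is at most C times this.
    [p_geometric] sums it to 2 C. *)
Lemma zabreiko : exists M, 0 <= M /\ forall x, p x <= M * norm x.
Proof.
  destruct sublevel_approximates as (C & HC & Ha).
  exists (2 * C). split; [lra|]. intros x.
  destruct (Req_dec (norm x) 0) as [H0|H0].
  { replace x with (scal 0 x).
    - rewrite p_scal, norm_scal_R, Rabs_R0. lra.
    - rewrite (norm_eq_zero x H0) at 1 2. vec (nm E). }
  assert (Hx : 0 < norm x) by (generalize (norm_ge_0 x); lra).
  set (e := fun n => norm x * (1 / 2) ^ S n).
  assert (Hepos : forall n, 0 < e n).
  { intros n. apply Rmult_lt_0_compat; [lra|apply pow_half_pos]. }
  set (f := fun n (s : nm E) => proj1_sig
    (constructive_indefinite_description _ (Ha (minus x s) (e n) (Hepos n)))).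
  assert (Hf : forall n (s : nm E), norm (minus (minus x s) (f n s)) < e n /\
    p (f n s) <= C * norm (minus x s)).
  { intros n s. exact (proj2_sig
      (constructive_indefinite_description _ (Ha (minus x s) (e n) (Hepos n)))). }
  set (s := nat_rect (fun _ => nm E : Type) zero (fun n a => plus a (f n a))).
  assert (Hs : forall n, norm (minus x (s n)) <= norm x * (1 / 2) ^ n).
  { intros [|n]; simpl.
    - replace (minus x (zero : nm E)) with x by vec (nm E). lra.
    - destruct (Hf n (s n)) as [H _].
      replace (minus x (plus (s n) (f n (s n))))
        with (minus (minus x (s n)) (f n (s n))) by vec (nm E).
      left. exact H. }
  rewrite Rmult_assoc. apply (p_geometric s).
  - reflexivity.
  - intros n. simpl.
    replace (minus (plus (s n) (f n (s n))) (s n)) with (f n (s n)) by vec (nm E).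
    eapply Rle_trans; [apply Hf|]. rewrite Rmult_assoc.
    apply Rmult_le_compat_l; auto.
  - apply tends_iff. intros eps He. destruct (pow_half_lt (norm x) eps He) as [N HN].
    exists N. intros n Hn. rewrite norm_minus_sym.
    eapply Rle_lt_trans; [apply Hs|]. eapply Rle_lt_trans; [|exact HN].
    apply Rmult_le_compat_l; [lra|].
    replace n with (N + (n - N))%nat by lia. rewrite pow_add.
    rewrite <- (Rmult_1_r ((1/2)^N)) at 2. apply Rmult_le_compat_l.
    + left; apply pow_half_pos.
    + apply pow_half_le_1.
Qed.

End Zabreiko.

Lemma geometric_norm_le {F : NormedModule R_AbsRing} (s : nat -> F) (C : R) :
  s 0%nat = zero ->
  (forall n, norm (minus (s (S n)) (s n)) <= C * (1 / 2) ^ n) ->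
  forall n, norm (s n) <= 2 * C - 2 * C * (1 / 2) ^ n.
Proof.
  intros H0 Hs n. induction n as [|n IH].
  - rewrite H0, norm_zero. simpl. lra.
  - eapply Rle_trans; [apply (norm_le_dist _ (s n))|].
    specialize (Hs n). simpl. lra.
Qed.

Lemma geometric_bound_pos {F : NormedModule R_AbsRing} (s : nat -> F) (C : R) :
  (forall n, norm (minus (s (S n)) (s n)) <= C * (1 / 2) ^ n) -> 0 <= C.
Proof.
  intros Hs. specialize (Hs 0%nat). simpl in Hs.
  generalize (norm_ge_0 (minus (s 1%nat) (s 0%nat))). lra.
Qed.

(** Zabreiko's lemma for p x = norm (L x): along a geometric series the images form a Cauchy
    sequence, and closedness identifies their limit with L x. *)
Lemma closed_graph {E F : rbanach} (L : nm E -> nm F) :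
  (forall x y, L (plus x y) = plus (L x) (L y)) ->
  (forall a x, L (scal a x) = scal a (L x)) ->
  (forall u x y, tends u x -> tends (fun n => L (u n)) y -> L x = y) ->
  is_linear L.
Proof.
  intros Hp Hsc Hcl.
  destruct (zabreiko (fun x => norm (L x))) as (M & HM & HL).
  - intros x y. rewrite Hp. apply norm_triangle.
  - intros a x. rewrite Hsc. apply norm_scal_R.
  - intros s x C H0 Hs Hx.
    assert (Hm : forall a b, L (minus a b) = minus (L a) (L b)).
    { intros a b. replace (minus a b) with (plus a (scal (-1) b)) by vec (nm E).
      rewrite Hp, Hsc. vec (nm F). }
    assert (Hs' : forall n, norm (minus (L (s (S n))) (L (s n))) <= C * (1 / 2) ^ n).
    { intros n. rewrite <- Hm. apply Hs. }
    assert (HC := geometric_bound_pos (fun n => L (s n)) C Hs').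
    destruct (telescoping_tends (fun n => L (s n)) (fun n => 2 * C * (1 / 2) ^ n))
      as [y [Hy _]].
    + intros n. specialize (Hs' n). simpl in *. lra.
    + intros n. generalize (pow_half_pos n). intros. apply Rmult_le_pos; lra.
    + intros eps. apply pow_half_lt.
    + rewrite (Hcl s x y Hx Hy). apply (tends_norm_le _ _ _ Hy).
      intros n. eapply Rle_trans; [apply (geometric_norm_le (fun n => L (s n)) C)|].
      * replace (zero : nm F) with (scal 0 (L zero)) by vec (nm F).
        rewrite H0, <- Hsc. f_equal. vec (nm E).
      * exact Hs'.
      * assert (0 <= 2 * C * (1 / 2) ^ n); [|lra].
        generalize (pow_half_pos n). intros. apply Rmult_le_pos; lra.
  (* [is_linear] demands a strictly positive constant, hence the added 1 here and in later
     bounds. *)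
  - apply Build_is_linear; auto. exists (M + 1). split; [lra|].
    intros x. specialize (HL x). generalize (norm_ge_0 x).
    intros. simpl in HL. lra.
Qed.

(** Zabreiko's lemma for p x = sup_i norm (L i x). The value 0 is adjoined to the set whose supremum
    is taken, so that it is nonempty even for an empty index type. *)
Lemma uniform_boundedness {E F : rbanach} {I : Type} (L : I -> nm E -> nm F) :
  (forall i, is_linear (L i)) ->
  (forall x, exists M, forall i, norm (L i x) <= M) ->
  exists M, 0 < M /\ forall i x, norm (L i x) <= M * norm x.
Proof.
  intros HL Hb.
  assert (Hsup : forall x : nm E, exists m, 0 <= m /\ (forall i, norm (L i x) <= m) /\
    forall b, 0 <= b -> (forall i, norm (L i x) <= b) -> m <= b).
  { intros x.
    destruct (completeness (fun r => r = 0 \/ exists i, r = norm (L i x))) as [m [Hm1 Hm2]].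
    - destruct (Hb x) as [M HM]. exists (Rmax 0 M). intros r [->|[i ->]].
      + apply Rmax_l.
      + eapply Rle_trans; [apply HM|apply Rmax_r].
    - exists 0. now left.
    - exists m. repeat split.
      + apply Hm1. now left.
      + intros i. apply Hm1. right. now exists i.
      + intros b Hb0 Hbi. apply Hm2. intros r [->|[i ->]]; auto. }
  set (p := fun x : nm E => proj1_sig (constructive_indefinite_description _ (Hsup x))).
  assert (Hp : forall x, 0 <= p x /\ (forall i, norm (L i x) <= p x) /\
    forall b, 0 <= b -> (forall i, norm (L i x) <= b) -> p x <= b).
  { intros x. exact (proj2_sig (constructive_indefinite_description _ (Hsup x))). }
  assert (Hle : forall a x, p (scal a x) <= Rabs a * p x).
  { intros a x. apply Hp.
    - apply Rmult_le_pos; [apply Rabs_pos|apply Hp].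
    - intros i. rewrite (linear_scal _ (HL i)), norm_scal_R.
      apply Rmult_le_compat_l; [apply Rabs_pos|apply Hp]. }
  destruct (zabreiko p) as (M & HM & HpM).
  - intros x y. apply Hp.
    + apply Rplus_le_le_0_compat; apply Hp.
    + intros i. rewrite (linear_plus _ (HL i)). apply norm_plus_le; apply Hp.
  - intros a x. apply Rle_antisym; [apply Hle|].
    destruct (Req_dec a 0) as [->|Ha].
    + rewrite Rabs_R0, Rmult_0_l. apply Hp.
    + assert (Hx : x = scal (/ a) (scal a x)) by (vec (nm E); field; auto).
      rewrite Hx at 1.
      apply Rle_trans with (Rabs a * (Rabs (/ a) * p (scal a x))).
      * apply Rmult_le_compat_l; [apply Rabs_pos|]. apply Hle.
      * rewrite <- Rmult_assoc, <- Rabs_mult, Rinv_r, Rabs_R1 by auto. lra.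
  - intros s x C H0 Hs Hx.
    assert (HC : 0 <= C).
    { specialize (Hs 0%nat). simpl in Hs.
      generalize (proj1 (Hp (minus (s 1%nat) (s 0%nat)))). lra. }
    apply Hp; [lra|]. intros i.
    apply (tends_norm_le _ _ _ (tends_linear (L i) s x (HL i) Hx)). intros n.
    eapply Rle_trans; [apply (geometric_norm_le (fun n => L i (s n)) C)|].
    + rewrite H0. apply (linear_zero _ (HL i)).
    + intros m. rewrite <- (linear_minus _ _ _ (HL i)).
      eapply Rle_trans; [apply Hp|apply Hs].
    + assert (0 <= 2 * C * (1 / 2) ^ n); [|lra].
      generalize (pow_half_pos n). intros. apply Rmult_le_pos; lra.
  - exists (M + 1). split; [lra|]. intros i x.
    eapply Rle_trans; [apply Hp|]. eapply Rle_trans; [apply HpM|].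
    generalize (norm_ge_0 x). intros. lra.
Qed.

(** * Vector-valued calculus *)

Lemma locally_R_iff (P : R -> Prop) (t : R) :
  locally t P <-> exists d, 0 < d /\ forall s, Rabs (s - t) < d -> P s.
Proof.
  split.
  - intros [d Hd]. exists d. split; [apply cond_pos|]. intros s Hs. now apply Hd.
  - intros (d & Hd & H). exists (mkposreal d Hd). intros s Hs. now apply H.
Qed.

Lemma continuous_R_iff {K : AbsRing} {E : NormedModule K} (f : R -> E) (t : R) :
  continuous f t <-> forall eps, 0 < eps -> exists d, 0 < d /\
    forall s, Rabs (s - t) < d -> norm (minus (f s) (f t)) < eps.
Proof.
  etransitivity; [apply (filterlim_norm_iff (locally t) f (f t))|].
  split; intros H eps He.
  - now apply locally_R_iff, H.
  - now apply locally_R_iff, H.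
Qed.

Lemma at_right_0_iff (P : R -> Prop) :
  at_right 0 P <-> exists d, 0 < d /\ forall h, 0 < h < d -> P h.
Proof.
  unfold at_right, within. rewrite locally_R_iff. split.
  - intros (d & Hd & H). exists d. split; [exact Hd|]. intros h Hh.
    apply H; [rewrite Rabs_pos_eq|]; lra.
  - intros (d & Hd & H). exists d. split; [exact Hd|]. intros h Hh Hh0.
    apply H. rewrite Rabs_pos_eq in Hh; lra.
Qed.

Section Derivatives.

Context {E : NormedModule R_AbsRing}.

Lemma is_derive_iff (f : R -> E) (t : R) (l : E) :
  is_derive f t l <-> forall eps, 0 < eps -> exists d, 0 < d /\
    forall s, Rabs (s - t) < d ->
      norm (minus (minus (f s) (f t)) (scal (s - t) l)) <= eps * Rabs (s - t).
Proof.
  split.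
  - intros [_ H] eps He.
    specialize (H t (fun P HP => HP) (mkposreal eps He)).
    apply locally_R_iff in H. destruct H as (d & Hd & H).
    exists d. split; [exact Hd|]. exact H.
  - intros H. split; [apply is_linear_scal_l|].
    intros x Hx. rewrite <- (is_filter_lim_locally_unique t x Hx). intros eps.
    apply locally_R_iff. apply H. apply cond_pos.
Qed.

Lemma is_derive_continuous (f : R -> E) (t : R) (l : E) :
  is_derive f t l -> continuous f t.
Proof. intros H. apply ex_derive_continuous. now exists l. Qed.

Lemma is_derive_eq (f : R -> E) (t : R) (l l' : E) :
  is_derive f t l -> l = l' -> is_derive f t l'.
Proof. now intros H <-. Qed.

Lemma is_derive_shift (f : R -> E) (c t : R) (l : E) :
  is_derive f (t + c) l -> is_derive (fun s => f (s + c)) t l.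
Proof.
  rewrite !is_derive_iff. intros H eps He. destruct (H eps He) as (d & Hd & H').
  exists d. split; [exact Hd|]. intros s Hs.
  specialize (H' (s + c)). replace (s + c - (t + c)) with (s - t) in H' by ring. auto.
Qed.

Lemma is_derive_reflect (f : R -> E) (c t : R) (l : E) :
  is_derive f (c - t) l -> is_derive (fun s => f (c - s)) t (opp l).
Proof.
  rewrite !is_derive_iff. intros H eps He. destruct (H eps He) as (d & Hd & H').
  exists d. split; [exact Hd|]. intros s Hs.
  specialize (H' (c - s)). replace (c - s - (c - t)) with (- (s - t)) in H' by ring.
  rewrite Rabs_Ropp in H'. specialize (H' Hs).
  replace (scal (s - t) (opp l)) with (scal (- (s - t)) l) by vec E. exact H'.
Qed.

(** The tool behind most identities below: equal derivatives and equal values at 0. *)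
Lemma eq_derive_eq (f g : R -> E) (df : R -> E) :
  (forall t, is_derive f t (df t)) -> (forall t, is_derive g t (df t)) ->
  f 0 = g 0 -> forall t, f t = g t.
Proof.
  intros Hf Hg H0 t.
  assert (Hd : forall s, is_derive (fun t => minus (f t) (g t)) s zero).
  { intros s. apply (is_derive_eq _ _ (minus (df s) (df s))).
    - apply (is_derive_minus (V := E)); auto.
    - vec E. }
  assert (Heq : minus (f t) (g t) = minus (f 0) (g 0)).
  { destruct (Rtotal_order t 0) as [H|[->|H]].
    - apply (eq_is_derive (fun t => minus (f t) (g t)) t 0); auto.
    - reflexivity.
    - symmetry. apply (eq_is_derive (fun t => minus (f t) (g t)) 0 t); auto. }
  rewrite H0 in Heq.
  replace (f t) with (plus (minus (f t) (g t)) (g t)) by vec E.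
  rewrite Heq. vec E.
Qed.

(* A supremum argument: for every slope [eps > 0] the bound
   [norm (f t - f a) <= eps (t - a)] propagates to the right. *)
Lemma right_derivative_zero_constant (f : R -> E) (a b : R) :
  a <= b ->
  (forall t, a <= t <= b -> forall eps, 0 < eps -> exists d, 0 < d /\
     forall s, a <= s <= b -> Rabs (s - t) < d -> norm (minus (f s) (f t)) < eps) ->
  (forall t, a <= t < b -> forall eps, 0 < eps -> exists d, 0 < d /\
     forall h, 0 < h < d -> norm (minus (f (t + h)) (f t)) <= eps * h) ->
  f b = f a.
Proof.
  intros Hab Hc Hd.
  assert (Hz : forall eps, 0 < eps -> norm (minus (f b) (f a)) <= eps * (b - a)).
  { intros eps He.
    set (S := fun t => a <= t <= b /\ norm (minus (f t) (f a)) <= eps * (t - a)).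
    destruct (completeness S) as [m [Hm1 Hm2]].
    { exists b. intros t [Ht _]. lra. }
    { exists a. split; [lra|]. norm_diag. lra. }
    assert (Sa : S a). { split; [lra|]. norm_diag. lra. }
    assert (Ham : a <= m) by now apply Hm1.
    assert (Hmb : m <= b). { apply Hm2. intros t [Ht _]. lra. }
    assert (Hadm : forall d, 0 < d -> exists t, S t /\ m - d < t <= m).
    { intros d Hd0. apply NNPP. intros Hno.
      assert (m <= m - d); [|lra]. apply Hm2. intros t Ht.
      apply Rnot_lt_le. intros Hlt. apply Hno. exists t. split; [exact Ht|].
      split; [exact Hlt|]. now apply Hm1. }
    (* By continuity the supremum m itself satisfies the bound; if m < b, the right derivative at m
       carries the bound beyond m. *)
    assert (Sm : S m).
    { split; [lra|]. apply Rnot_lt_le. intros Hlt.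
      destruct (Hc m (conj Ham Hmb) (norm (minus (f m) (f a)) - eps * (m - a))) as (d & Hd0 & Hd1);
        [lra|].
      destruct (Hadm d Hd0) as (t & [Ht Hnt] & Htm).
      specialize (Hd1 t Ht). rewrite Rabs_left1 in Hd1 by lra.
      assert (Hd2 : norm (minus (f t) (f m)) < norm (minus (f m) (f a)) - eps * (m - a)) by (apply Hd1; lra).
      generalize (norm_dist_le (f m) (f t) (f a)).
      assert (eps * (t - a) <= eps * (m - a)) by (apply Rmult_le_compat_l; lra).
      rewrite (norm_minus_sym (f m) (f t)). lra. }
    destruct (Req_dec m b) as [<-|Hneq]; [apply Sm|].
    destruct (Hd m) with (eps := eps) as (d & Hd0 & Hd1); [lra|exact He|].
    set (h := Rmin (d / 2) (b - m)).
    assert (Hh : 0 < h < d /\ m + h <= b).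
    { unfold h. generalize (Rmin_l (d / 2) (b - m)) (Rmin_r (d / 2) (b - m)).
      assert (0 < Rmin (d / 2) (b - m)) by (apply Rmin_glb_lt; lra). lra. }
    assert (Smh : S (m + h)).
    { split; [lra|]. generalize (norm_dist_le (f (m + h)) (f m) (f a)).
      specialize (Hd1 h (proj1 Hh)). destruct Sm as [_ Sm].
      replace (eps * (m + h - a)) with (eps * h + eps * (m - a)) by ring. lra. }
    generalize (Hm1 _ Smh). lra. }
  assert (H0 : norm (minus (f b) (f a)) <= 0).
  { apply Rnot_lt_le. intros Hlt.
    set (n := norm (minus (f b) (f a))) in *.
    (* The added 1 keeps the slope meaningful when a = b. *)
    specialize (Hz (n / 2 / (b - a + 1))).
    assert (Hq : 0 < n / 2 / (b - a + 1)) by (apply Rdiv_lt_0_compat; lra).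
    specialize (Hz Hq).
    assert (n / 2 / (b - a + 1) * (b - a) < n / 2 / (b - a + 1) * (b - a + 1))
      by (apply Rmult_lt_compat_l; lra).
    replace (n / 2 / (b - a + 1) * (b - a + 1)) with (n / 2) in H by (field; lra).
    lra. }
  assert (Hm : minus (f b) (f a) = zero).
  { apply norm_eq_zero. generalize (norm_ge_0 (minus (f b) (f a))). lra. }
  replace (f b) with (plus (minus (f b) (f a)) (f a)) by vec E.
  rewrite Hm. vec E.
Qed.

End Derivatives.

Lemma is_derive_linear {E F : NormedModule R_AbsRing} (L : E -> F) (f : R -> E) (t : R) (l : E) :
  is_linear L -> is_derive f t l -> is_derive (fun s => L (f s)) t (L l).
Proof.
  intros HL H0. apply is_derive_iff. intros eps He.
  assert (H := proj1 (is_derive_iff f t l) H0).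
  destruct (linear_norm _ HL) as (M & HM & HLM).
  destruct (H (eps / M)) as (d & Hd & H').
  { now apply Rdiv_lt_0_compat. }
  exists d. split; [exact Hd|]. intros s Hs.
  rewrite <- (linear_scal _ HL), <- !(linear_minus _ _ _ HL).
  eapply Rle_trans; [apply HLM|].
  replace (eps * Rabs (s - t)) with (M * (eps / M * Rabs (s - t))) by (field; lra).
  apply Rmult_le_compat_l; [lra|auto].
Qed.

Lemma is_linear_scal_R {E : NormedModule R_AbsRing} (a : R) :
  is_linear (fun x : E => scal a x).
Proof. apply (is_linear_scal_r (K := R_AbsRing) a), Rmult_comm. Qed.

Lemma continuous_shift (c t : R) : continuous (fun s : R => s + c) t.
Proof.
  apply (continuous_plus (V := R_NormedModule) (fun s => s) (fun _ => c));
    [apply continuous_id|apply continuous_const].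
Qed.

Lemma continuous_neg (t : R) : continuous (fun s : R => - s) t.
Proof.
  apply (continuous_opp (V := R_NormedModule) (fun s => s)), continuous_id.
Qed.

Lemma continuous_minus_l (c t : R) : continuous (fun s : R => c - s) t.
Proof.
  apply (continuous_minus (V := R_NormedModule) (fun _ => c) (fun s => s));
    [apply continuous_const|apply continuous_id].
Qed.

Section Integrals.

Context {E : rbanach}.

Lemma is_derive_primitive (f : R -> nm E) :
  (forall t, continuous f t) ->
  forall t, is_derive (fun t => RInt (V := E) f 0 t : nm E) t (f t).
Proof.
  intros Hf t. apply (is_derive_RInt (V := nm E) f _ 0); [|apply Hf].
  apply filter_forall. intros b. apply (RInt_correct (V := E)).
  apply ex_RInt_continuous. auto.
Qed.

Lemma RInt_0_0 (f : R -> nm E) : RInt (V := E) f 0 0 = (zero : nm E).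
Proof. apply (RInt_point (V := E)). Qed.

Lemma RInt_derive_eq (f df : R -> nm E) :
  (forall t, is_derive f t (df t)) -> (forall t, continuous df t) ->
  forall t, RInt (V := E) df 0 t = minus (f t) (f 0).
Proof.
  intros Hf Hc t. apply (is_RInt_unique (V := E)).
  apply (is_RInt_derive (V := E)); intros; auto.
Qed.

End Integrals.

Lemma linear_RInt {E F : rbanach} (L : nm E -> nm F) (f : R -> nm E) :
  is_linear L -> (forall t, continuous f t) ->
  forall t, L (RInt (V := E) f 0 t) = RInt (V := F) (fun s => L (f s)) 0 t.
Proof.
  intros HL Hf.
  assert (Hc : forall t, continuous (fun s => L (f s)) t).
  { intros t. apply (continuous_comp f L); [apply Hf|]. now apply linear_cont. }
  apply (eq_derive_eq (E := nm F) (fun t => L (RInt (V := E) f 0 t)) _ (fun s => L (f s))).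
  - intros t. apply (is_derive_linear L (fun t => RInt (V := E) f 0 t)); [exact HL|].
    now apply is_derive_primitive.
  - intros t. now apply (is_derive_primitive (fun s => L (f s))).
  - rewrite (RInt_0_0 (fun s => L (f s))).
    eapply eq_trans; [apply f_equal, RInt_0_0|]. now apply linear_zero.
Qed.

Section IntegralBounds.

Context {E : rbanach}.

(** Integration gains a factor 1 / c in the supremum norm weighted by exp (c t). With c twice the
    bound of the coefficient this makes Picard's map a contraction on intervals of any length. *)
Lemma derive_exp_le_pos (f df : R -> nm E) (c K b : R) :
  0 < c -> (forall t, is_derive f t (df t)) -> (forall t, continuous df t) ->
  f 0 = zero ->
  (forall t, 0 <= t <= b -> norm (df t) <= K * exp (c * t)) ->
  forall t, 0 <= t <= b -> norm (f t) <= K / c * exp (c * t).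
Proof.
  intros Hc Hf Hdf H0 Hb t Ht.
  assert (HK : 0 <= K).
  { specialize (Hb 0). rewrite Rmult_0_r, exp_0, Rmult_1_r in Hb.
    eapply Rle_trans; [apply (norm_ge_0 (df 0))|]. apply Hb. lra. }
  assert (Hi : norm (f t) <= K / c * exp (c * t) - K / c * exp (c * 0)).
  { apply (norm_RInt_le (V := nm E) df (fun t => K * exp (c * t)) 0 t).
    - lra.
    - intros x Hx. apply Hb. lra.
    - replace (f t) with (minus (f t) (f 0)) by (rewrite H0; vec (nm E)).
      apply (is_RInt_derive (V := E)); auto.
    - apply (is_RInt_derive (V := R_CompleteNormedModule)
        (fun t => K / c * exp (c * t)) (fun t => K * exp (c * t))).
      + intros x _. auto_derive; [easy|]. field. lra.
      + intros x _. apply (ex_derive_continuous (V := R_NormedModule)). auto_derive. easy. }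
  rewrite Rmult_0_r, exp_0, Rmult_1_r in Hi.
  assert (0 <= K / c); [|lra].
  apply Rmult_le_pos; [lra|]. left. now apply Rinv_0_lt_compat.
Qed.

Lemma derive_exp_le (f df : R -> nm E) (c K b : R) :
  0 < c -> (forall t, is_derive f t (df t)) -> (forall t, continuous df t) ->
  f 0 = zero ->
  (forall t, Rabs t <= b -> norm (df t) <= K * exp (c * Rabs t)) ->
  forall t, Rabs t <= b -> norm (f t) <= K / c * exp (c * Rabs t).
Proof.
  intros Hc Hf Hdf H0 Hb t Ht. destruct (Rle_lt_dec 0 t) as [H|H].
  - rewrite Rabs_pos_eq in * by lra.
    apply (derive_exp_le_pos f df c K b); auto.
    intros s Hs. specialize (Hb s). rewrite Rabs_pos_eq in Hb by lra. apply Hb. lra.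
  - rewrite Rabs_left in * by lra.
    replace (f t) with (f (0 - (- t))) by (f_equal; lra).
    apply (derive_exp_le_pos (fun s => f (0 - s)) (fun s => opp (df (0 - s))) c K b); auto.
    + intros s. apply is_derive_reflect. apply Hf.
    + intros s. apply (continuous_opp (V := nm E)).
      apply (continuous_comp (fun s => 0 - s) df); [|apply Hdf].
      apply continuous_minus_l.
    + now replace (0 - 0) with 0 by ring.
    + intros s Hs. rewrite (norm_opp (V := nm E) (df (0 - s))).
      specialize (Hb (0 - s)). replace (0 - s) with (- s) in * by ring.
      rewrite Rabs_Ropp, Rabs_pos_eq in Hb by lra. apply Hb. lra.
    + lra.
Qed.

Lemma norm_RInt_bound (f : R -> nm E) (M t : R) :
  (forall s, continuous f s) -> (forall s, Rabs s <= Rabs t -> norm (f s) <= M) ->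
  norm (RInt (V := E) f 0 t : nm E) <= M * Rabs t.
Proof.
  assert (Hpos : forall (f : R -> nm E) t, 0 <= t -> (forall s, continuous f s) ->
    (forall s, 0 <= s <= t -> norm (f s) <= M) ->
    norm (RInt (V := E) f 0 t : nm E) <= M * t).
  { intros g u Hu Hg HM.
    replace (M * u) with (scal (u - 0) M) by (change ((u - 0) * M = M * u); ring).
    apply (norm_RInt_le (V := nm E) g (fun _ => M) 0 u); auto.
    - apply (RInt_correct (V := E)). apply ex_RInt_continuous. auto.
    - apply (is_RInt_const (V := R_NormedModule)). }
  intros Hf HM. destruct (Rle_lt_dec 0 t) as [H|H].
  - rewrite (Rabs_pos_eq t) in * by lra. apply Hpos; auto.
    intros s Hs. apply HM. rewrite Rabs_pos_eq; lra.
  - rewrite (Rabs_left t) in * by lra.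
    assert (Hr : (RInt (V := E) f 0 t : nm E) =
      opp (RInt (V := E) (fun s => f (0 - s)) 0 (- t) : nm E)).
    { assert (Hrc : forall s, continuous (fun s => f (0 - s)) s).
      { intros s. apply (continuous_comp (fun s => 0 - s) f); [|apply Hf].
        apply continuous_minus_l. }
      rewrite (RInt_derive_eq (fun s => opp (RInt (V := E) f 0 (0 - s)))
        (fun s => f (0 - s))); auto.
      - replace (0 - - t) with t by ring. replace (0 - 0) with 0 by ring.
        rewrite (RInt_0_0 f). vec (nm E).
      - intros s. apply (is_derive_eq _ _ (opp (opp (f (0 - s))))); [|vec (nm E)].
        apply (is_derive_opp (V := nm E)).
        apply (is_derive_reflect (E := nm E) (fun s => RInt (V := E) f 0 s)).
        now apply is_derive_primitive. }
    rewrite Hr, (norm_opp (V := nm E)). apply Hpos; [lra| |].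
    + intros s. apply (continuous_comp (fun s => 0 - s) f); [|apply Hf].
      apply continuous_minus_l.
    + intros s Hs. apply HM. replace (0 - s) with (- s) by ring.
      rewrite Rabs_Ropp, Rabs_pos_eq; lra.
Qed.

End IntegralBounds.

(** * Strongly continuous families and linear differential equations *)

Record strongly_continuous {E F : rbanach} (B : R -> nm E -> nm F) : Prop := {
  sc_linear : forall t, is_linear (B t);
  sc_continuous : forall x t, continuous (fun s => B s x) t
}.

Section StronglyContinuous.

Context {E F : rbanach} (B : R -> nm E -> nm F).

Hypothesis HB : strongly_continuous B.

(** Uniform boundedness with the times in [- b, b] as index type; orbits are bounded there by
    continuity. *)
Lemma sc_bounded (b : R) :
  exists M, 0 < M /\ forall t x, Rabs t <= b -> norm (B t x) <= M * norm x.
Proof.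
  destruct (uniform_boundedness (fun (t : {t : R | Rabs t <= b}) => B (proj1_sig t)))
    as (M & HM & H).
  - intros t. apply (sc_linear B HB).
  - intros x. destruct (bounded_continuity (fun t => B t x) (- b) b) as [M HM].
    + intros t _. apply (sc_continuous B HB).
    + exists M. intros [t Ht]. simpl. left. apply HM. now apply Rabs_le_between.
  - exists M. split; [exact HM|]. intros t x Ht. apply (H (exist _ t Ht)).
Qed.

Lemma sc_locally_bounded (t : R) : exists M, 0 < M /\
  forall s x, Rabs (s - t) < 1 -> norm (B s x) <= M * norm x.
Proof.
  destruct (sc_bounded (Rabs t + 1)) as (M & HM & H). exists M.
  split; [exact HM|]. intros s x Hs. apply H.
  generalize (Rabs_triang (s - t) t). replace (s - t + t) with s by ring. lra.
Qed.

Lemma sc_continuous_apply (v : R -> nm E) (t : R) :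
  continuous v t -> continuous (fun s => B s (v s)) t.
Proof.
  intros Hv. apply continuous_R_iff. intros eps He.
  destruct (sc_locally_bounded t) as (M & HM & HB').
  destruct (proj1 (continuous_R_iff v t) Hv (eps / 2 / M)) as (d1 & Hd1 & H1).
  { apply Rdiv_lt_0_compat; lra. }
  destruct (proj1 (continuous_R_iff (fun s => B s (v t)) t) (sc_continuous B HB (v t) t) (eps / 2))
    as (d2 & Hd2 & H2); [lra|].
  exists (Rmin 1 (Rmin d1 d2)). split.
  { repeat apply Rmin_glb_lt; lra. }
  intros s Hs.
  assert (Hs1 : Rabs (s - t) < 1) by (eapply Rlt_le_trans; [exact Hs|apply Rmin_l]).
  assert (Hs2 : Rabs (s - t) < d1).
  { eapply Rlt_le_trans; [exact Hs|]. eapply Rle_trans; [apply Rmin_r|apply Rmin_l]. }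
  assert (Hs3 : Rabs (s - t) < d2).
  { eapply Rlt_le_trans; [exact Hs|]. eapply Rle_trans; [apply Rmin_r|apply Rmin_r]. }
  replace (minus (B s (v s)) (B t (v t)))
    with (plus (B s (minus (v s) (v t))) (minus (B s (v t)) (B t (v t))))
    by (rewrite (linear_minus _ _ _ (sc_linear B HB s)); vec (nm F)).
  eapply Rle_lt_trans; [apply (norm_triangle (V := nm F))|].
  specialize (HB' s (minus (v s) (v t)) Hs1). specialize (H1 s Hs2). specialize (H2 s Hs3).
  assert (M * norm (minus (v s) (v t)) < M * (eps / 2 / M)) by (apply Rmult_lt_compat_l; lra).
  replace (M * (eps / 2 / M)) with (eps / 2) in H by (field; lra).
  lra.
Qed.

(** A product rule for coefficients which may be differentiable on few vectors: [B] is
    differentiated only on the fixed vector [v t]. The remainder of [v] is absorbed by the local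
    bound on [B], its linear part by strong continuity at v'. *)
Lemma sc_derive_apply (v : R -> nm E) (t : R) (v' : nm E) (w : nm F) :
  is_derive v t v' -> is_derive (fun s => B s (v t)) t w ->
  is_derive (fun s => B s (v s)) t (plus w (B t v')).
Proof.
  intros Hv Hw. apply is_derive_iff. intros eps He.
  destruct (sc_locally_bounded t) as (M & HM & HB').
  destruct (proj1 (is_derive_iff v t v') Hv (eps / 3 / M)) as (d1 & Hd1 & H1).
  { apply Rdiv_lt_0_compat; lra. }
  destruct (proj1 (is_derive_iff _ t w) Hw (eps / 3)) as (d2 & Hd2 & H2); [lra|].
  destruct (proj1 (continuous_R_iff (fun s => B s v') t) (sc_continuous B HB v' t) (eps / 3))
    as (d3 & Hd3 & H3); [lra|].
  exists (Rmin 1 (Rmin d1 (Rmin d2 d3))). split.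
  { repeat apply Rmin_glb_lt; lra. }
  intros s Hs. set (h := Rabs (s - t)) in *.
  assert (Hs1 : h < 1 /\ h < d1 /\ h < d2 /\ h < d3).
  { generalize (Rmin_l 1 (Rmin d1 (Rmin d2 d3))) (Rmin_r 1 (Rmin d1 (Rmin d2 d3)))
      (Rmin_l d1 (Rmin d2 d3)) (Rmin_r d1 (Rmin d2 d3)) (Rmin_l d2 d3) (Rmin_r d2 d3). lra. }
  destruct Hs1 as (Hs1 & Hs2 & Hs3 & Hs4).
  replace (minus (minus (B s (v s)) (B t (v t))) (scal (s - t) (plus w (B t v'))))
    with (plus (plus (B s (minus (minus (v s) (v t)) (scal (s - t) v')))
                (minus (minus (B s (v t)) (B t (v t))) (scal (s - t) w)))
               (scal (s - t) (minus (B s v') (B t v')))).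
  2:{ rewrite !(linear_minus _ _ _ (sc_linear B HB s)), (linear_scal _ (sc_linear B HB s)).
      vec (nm F). }
  specialize (HB' s (minus (minus (v s) (v t)) (scal (s - t) v')) Hs1).
  specialize (H1 s Hs2). specialize (H2 s Hs3). specialize (H3 s Hs4).
  eapply Rle_trans; [apply (norm_triangle (V := nm F))|].
  eapply Rle_trans; [apply Rplus_le_compat_r, (norm_triangle (V := nm F))|].
  rewrite (norm_scal_R (s - t)).
  assert (Hh : 0 <= h) by apply Rabs_pos. fold h in H1, H2. fold h.
  assert (Ha : M * norm (minus (minus (v s) (v t)) (scal (s - t) v')) <= M * (eps / 3 / M * h))
    by (apply Rmult_le_compat_l; lra).
  replace (M * (eps / 3 / M * h)) with (eps / 3 * h) in Ha by (field; lra).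
  assert (Hb : h * norm (minus (B s v') (B t v')) <= h * (eps / 3))
    by (apply Rmult_le_compat_l; lra).
  lra.
Qed.

End StronglyContinuous.

Lemma sc_const {E F : rbanach} (L : nm E -> nm F) :
  is_linear L -> strongly_continuous (fun _ => L).
Proof.
  intros HL. split; [easy|]. intros x t. apply continuous_const.
Qed.

Lemma sc_comp {E F G : rbanach} (A : R -> nm F -> nm G) (B : R -> nm E -> nm F) :
  strongly_continuous A -> strongly_continuous B ->
  strongly_continuous (fun t x => A t (B t x)).
Proof.
  intros HA HB. split.
  - intros t. apply (is_linear_comp (B t) (A t)); [apply HB|apply HA].
  - intros x t. apply (sc_continuous_apply A HA (fun s => B s x)). apply HB.
Qed.

Lemma sc_reparam {E F : rbanach} (A : R -> nm E -> nm F) (g : R -> R) :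
  (forall t, continuous g t) -> strongly_continuous A ->
  strongly_continuous (fun t => A (g t)).
Proof.
  intros Hg HA. split.
  - intros t. apply HA.
  - intros x t. apply (continuous_comp g (fun s => A s x)); [apply Hg|apply HA].
Qed.

Lemma exp_monotone (a b : R) : a <= b -> exp a <= exp b.
Proof.
  intros [H| ->]; [left; now apply exp_increasing|apply Rle_refl].
Qed.

(** * The equation u' = B u: uniqueness, Picard iteration, solution operators *)

Section LinearODE.

Context {E : rbanach} (B : R -> nm E -> nm E).

Hypothesis HB : strongly_continuous B.

(** Each use of the weighted estimate with exponent 2 M multiplies the bound of u by M / (2 M) = 1 /
    2; after n rounds the factor is (1/2)^n. *)
Lemma ode_unique_zero (u : R -> nm E) :
  (forall t, is_derive u t (B t (u t))) -> u 0 = zero -> forall t, u t = zero.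
Proof.
  intros Hu H0 t. set (b := Rabs t).
  destruct (sc_bounded B HB b) as (M & HM & HBM).
  assert (Hc : forall s, continuous u s).
  { intros s. apply (is_derive_continuous u s _ (Hu s)). }
  destruct (bounded_continuity u (- b) b) as [C HC].
  { intros s _. apply Hc. }
  assert (HC0 : 0 <= C).
  { specialize (HC 0). left. eapply Rle_lt_trans; [apply (norm_ge_0 (u 0))|].
    apply HC. unfold b. generalize (Rabs_pos t). lra. }
  assert (Hn : forall n s, Rabs s <= b ->
    norm (u s) <= C * (1 / 2) ^ n * exp (2 * M * Rabs s)).
  { induction n as [|n IH]; intros s Hs.
    - simpl. rewrite Rmult_1_r. apply Rle_trans with (C * 1).
      + rewrite Rmult_1_r. left. apply HC. now apply Rabs_le_between.
      + apply Rmult_le_compat_l; [exact HC0|]. rewrite <- exp_0.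
        apply exp_monotone. apply Rmult_le_pos; [lra|apply Rabs_pos].
    - replace (C * (1 / 2) ^ S n) with (M * (C * (1 / 2) ^ n) / (2 * M))
        by (simpl; field; lra).
      apply (derive_exp_le u (fun t => B t (u t)) (2 * M) _ b).
      + lra.
      + exact Hu.
      + intros r. apply (sc_continuous_apply B HB). apply Hc.
      + exact H0.
      + intros r Hr. eapply Rle_trans; [now apply HBM|].
        rewrite Rmult_assoc. apply Rmult_le_compat_l; [lra|]. now apply IH.
      + exact Hs. }
  apply norm_eq_zero. apply Rle_antisym; [|apply norm_ge_0].
  apply Rnot_lt_le. intros Hlt.
  destruct (pow_half_lt (C * exp (2 * M * b)) (norm (u t)) Hlt) as [n Hn'].
  specialize (Hn n t (Rle_refl _)). fold b in Hn. lra.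
Qed.

Lemma ode_unique (u v : R -> nm E) :
  (forall t, is_derive u t (B t (u t))) -> (forall t, is_derive v t (B t (v t))) ->
  u 0 = v 0 -> forall t, u t = v t.
Proof.
  intros Hu Hv H0 t.
  assert (Hz : minus (u t) (v t) = zero).
  { apply (ode_unique_zero (fun s => minus (u s) (v s))).
    - intros s. apply (is_derive_eq _ _ (minus (B s (u s)) (B s (v s)))).
      + apply (is_derive_minus (V := nm E)); auto.
      + symmetry. apply (linear_minus _ _ _ (sc_linear B HB s)).
    - rewrite H0. vec (nm E). }
  replace (u t) with (plus (minus (u t) (v t)) (v t)) by vec (nm E).
  rewrite Hz. vec (nm E).
Qed.

Fixpoint picard (x : nm E) (n : nat) (t : R) : nm E :=
  match n with
  | O => x
  | S n => plus x (RInt (V := E) (fun s => B s (picard x n s)) 0 t)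
  end.

Lemma picard_step_derive (x : nm E) (v : R -> nm E) (t : R) :
  (forall s, continuous v s) ->
  is_derive (fun t => plus x (RInt (V := E) (fun s => B s (v s)) 0 t : nm E)) t (B t (v t)).
Proof.
  intros Hv. apply (is_derive_eq _ _ (plus zero (B t (v t)))).
  - apply (is_derive_plus (V := nm E)).
    + apply (is_derive_const (V := nm E)).
    + apply (is_derive_primitive (fun s => B s (v s))).
      intros s. now apply (sc_continuous_apply B HB).
  - vec (nm E).
Qed.

Lemma picard_continuous (x : nm E) (n : nat) (t : R) : continuous (picard x n) t.
Proof.
  revert t. induction n as [|n IH]; intros t; simpl.
  - apply continuous_const.
  - apply (is_derive_continuous (fun t =>
      plus x (RInt (V := E) (fun s => B s (picard x n s)) 0 t : nm E)) t (B t (picard x n t))).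
    now apply picard_step_derive.
Qed.

Lemma picard_zero (x : nm E) (n : nat) : picard x n 0 = x.
Proof.
  destruct n as [|n]; [reflexivity|]. simpl.
  rewrite (RInt_0_0 (fun s => B s (picard x n s))). vec (nm E).
Qed.

Lemma picard_increment (b M : R) (x : nm E) :
  0 < M -> (forall t y, Rabs t <= b -> norm (B t y) <= M * norm y) ->
  forall n t, Rabs t <= b ->
    norm (minus (picard x (S n) t) (picard x n t))
    <= norm x * (1 / 2) ^ n * (1 / 2) * exp (2 * M * Rabs t).
Proof.
  intros HM HBM. induction n as [|n IH]; intros t Ht.
  - replace (norm x * (1 / 2) ^ 0 * (1 / 2)) with (M * norm x / (2 * M)) by (simpl; field; lra).
    apply (derive_exp_le (fun t => minus (picard x 1 t) (picard x 0 t)) (fun s => B s x) (2 * M) _ b).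
    + lra.
    + intros s. apply (is_derive_eq _ _ (minus (B s x) zero)); [|vec (nm E)].
      apply (is_derive_minus (V := nm E)).
      * apply (picard_step_derive x (fun _ => x)). intros. apply continuous_const.
      * apply (is_derive_const (V := nm E)).
    + intros s. apply HB.
    + rewrite !picard_zero. vec (nm E).
    + intros s Hs. eapply Rle_trans; [now apply HBM|].
      rewrite <- (Rmult_1_r (M * norm x)) at 1.
      apply Rmult_le_compat_l.
      * apply Rmult_le_pos; [lra|apply norm_ge_0].
      * rewrite <- exp_0. apply exp_monotone.
        apply Rmult_le_pos; [lra|apply Rabs_pos].
    + exact Ht.
  - replace (norm x * (1 / 2) ^ S n * (1 / 2))
      with (M * (norm x * (1 / 2) ^ n * (1 / 2)) / (2 * M)) by (simpl; field; lra).
    apply (derive_exp_le (fun t => minus (picard x (S (S n)) t) (picard x (S n) t))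
      (fun s => minus (B s (picard x (S n) s)) (B s (picard x n s))) (2 * M) _ b).
    + lra.
    + intros s. apply (is_derive_minus (V := nm E));
        apply picard_step_derive; intros; apply picard_continuous.
    + intros s. apply (continuous_minus (V := nm E));
        apply (sc_continuous_apply B HB); apply picard_continuous.
    + rewrite !picard_zero. vec (nm E).
    + intros s Hs. rewrite <- (linear_minus _ _ _ (sc_linear B HB s)).
      eapply Rle_trans; [now apply HBM|]. rewrite (Rmult_assoc M).
      apply Rmult_le_compat_l; [lra|]. now apply IH.
    + exact Ht.
Qed.

(** The limit is one function on the whole line, while the constants depend on the interval; hence
    [u] is chosen before [b] and [M]. *)
Lemma picard_limit (x : nm E) : exists u : R -> nm E,
  forall b M, 0 < M -> (forall t y, Rabs t <= b -> norm (B t y) <= M * norm y) ->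
  forall n t, Rabs t <= b ->
    norm (minus (u t) (picard x n t)) <= norm x * exp (2 * M * Rabs t) * (1 / 2) ^ n.
Proof.
  assert (H : forall t, exists l : nm E,
    tends (fun n => picard x n t) l).
  { intros t. destruct (sc_bounded B HB (Rabs t)) as (M & HM & HBM).
    destruct (telescoping_tends (fun n => picard x n t)
      (fun n => norm x * exp (2 * M * Rabs t) * (1 / 2) ^ n)) as (l & Hl & _).
    - intros n. eapply Rle_trans; [apply (picard_increment (Rabs t) M); auto; lra|].
      apply Req_le. simpl. field.
    - intros n. apply Rmult_le_pos; [apply Rmult_le_pos|].
      + apply norm_ge_0.
      + left; apply exp_pos.
      + left; apply pow_half_pos.
    - intros eps. apply pow_half_lt.
    - now exists l. }
  exists (fun t => proj1_sig (constructive_indefinite_description _ (H t))).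
  intros b M HM HBM n t Ht.
  set (l := proj1_sig (constructive_indefinite_description _ (H t))).
  assert (Hl : tends (fun n => picard x n t) l)
    by exact (proj2_sig (constructive_indefinite_description _ (H t))).
  destruct (telescoping_tends (fun n => picard x n t)
    (fun n => norm x * exp (2 * M * Rabs t) * (1 / 2) ^ n)) as (l' & Hl' & Hn).
  - intros m. eapply Rle_trans; [apply (picard_increment b M); auto|].
    apply Req_le. simpl. field.
  - intros m. apply Rmult_le_pos; [apply Rmult_le_pos|].
    + apply norm_ge_0.
    + left; apply exp_pos.
    + left; apply pow_half_pos.
  - intros eps. apply pow_half_lt.
  - rewrite (tends_unique _ l l' Hl Hl'). apply Hn.
Qed.

(** The last clause bounds the solution by its initial value; it makes the solution map a bounded
    operator in [evolution_exists]. *)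
Lemma ode_exists (x : nm E) : exists u : R -> nm E,
  u 0 = x /\ (forall t, is_derive u t (B t (u t))) /\
  forall t M, 0 < M -> (forall s y, Rabs s <= Rabs t -> norm (B s y) <= M * norm y) ->
    norm (u t) <= norm x * (1 + exp (2 * M * Rabs t)).
Proof.
  destruct (picard_limit x) as [u Hu]. exists u.
  assert (Hc : forall t, continuous u t).
  { intros t. apply continuous_R_iff. intros eps He.
    destruct (sc_bounded B HB (Rabs t + 1)) as (M & HM & HBM).
    specialize (Hu _ M HM HBM).
    destruct (pow_half_lt (norm x * exp (2 * M * (Rabs t + 1))) (eps / 3)) as [n Hn]; [lra|].
    destruct (proj1 (continuous_R_iff _ t) (picard_continuous x n t) (eps / 3))
      as (d & Hd & H); [lra|].
    exists (Rmin 1 d). split; [apply Rmin_glb_lt; lra|].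
    assert (Hclose : forall s, Rabs s <= Rabs t + 1 -> norm (minus (u s) (picard x n s)) < eps / 3).
    { intros s Hs. eapply Rle_lt_trans; [now apply Hu|]. eapply Rle_lt_trans; [|exact Hn].
      apply Rmult_le_compat_r; [left; apply pow_half_pos|].
      apply Rmult_le_compat_l; [apply norm_ge_0|]. apply exp_monotone.
      apply Rmult_le_compat_l; lra. }
    intros s Hs.
    assert (Hs1 : Rabs (s - t) < 1) by (eapply Rlt_le_trans; [exact Hs|apply Rmin_l]).
    assert (Hs2 : Rabs (s - t) < d) by (eapply Rlt_le_trans; [exact Hs|apply Rmin_r]).
    assert (Hst : Rabs s <= Rabs t + 1).
    { generalize (Rabs_triang (s - t) t). replace (s - t + t) with s by ring. lra. }
    eapply Rle_lt_trans; [apply (norm_dist_le _ (picard x n s))|].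
    eapply Rle_lt_trans; [apply Rplus_le_compat_l, (norm_dist_le _ (picard x n t))|].
    generalize (Hclose s Hst) (Hclose t) (H s Hs2).
    rewrite (norm_minus_sym (u t)). lra. }
  (* [w] is the Picard image of [u] and differentiable by construction. Comparing both with the
     iterate [S n] shows w = u, and so the derivative passes to [u]. *)
  set (w := fun t => plus x (RInt (V := E) (fun s => B s (u s)) 0 t : nm E)).
  assert (Hw : forall t, is_derive w t (B t (u t))).
  { intros t. now apply picard_step_derive. }
  assert (Hwu : forall t, w t = u t).
  { intros t. destruct (sc_bounded B HB (Rabs t)) as (M & HM & HBM).
    specialize (Hu _ M HM HBM).
    assert (Hz : minus (w t) (u t) = zero).
    { apply norm_eq_zero. apply Rle_antisym; [|apply norm_ge_0].
      apply Rnot_lt_le. intros Hlt.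
      destruct (pow_half_lt (norm x * exp (2 * M * Rabs t)) (norm (minus (w t) (u t)))) as [n Hn];
        [exact Hlt|].
      assert (H1 : norm (minus (w t) (picard x (S n) t))
        <= M * (norm x * (1 / 2) ^ n) / (2 * M) * exp (2 * M * Rabs t)).
      { apply (derive_exp_le (fun t => minus (w t) (picard x (S n) t))
          (fun s => minus (B s (u s)) (B s (picard x n s))) (2 * M) _ (Rabs t)).
        - lra.
        - intros s. apply (is_derive_minus (V := nm E)); [apply Hw|].
          apply picard_step_derive; intros; apply picard_continuous.
        - intros s. apply (continuous_minus (V := nm E));
            apply (sc_continuous_apply B HB); [apply Hc|apply picard_continuous].
        - rewrite picard_zero. unfold w. rewrite (RInt_0_0 (fun s => B s (u s))). vec (nm E).
        - intros s Hs. rewrite <- (linear_minus _ _ _ (sc_linear B HB s)).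
          eapply Rle_trans; [now apply HBM|]. rewrite (Rmult_assoc M).
          apply Rmult_le_compat_l; [lra|].
          eapply Rle_trans; [now apply Hu|]. apply Req_le; ring.
        - lra. }
      specialize (Hu (S n) t (Rle_refl _)).
      generalize (norm_dist_le (w t) (picard x (S n) t) (u t)).
      rewrite (norm_minus_sym (picard x (S n) t) (u t)).
      replace (M * (norm x * (1 / 2) ^ n) / (2 * M) * exp (2 * M * Rabs t))
        with (norm x * exp (2 * M * Rabs t) * (1 / 2) ^ n * (1 / 2)) in H1 by (field; lra).
      replace ((1 / 2) ^ S n) with ((1 / 2) ^ n * (1 / 2)) in Hu by (simpl; ring).
      lra. }
    replace (u t) with (minus (w t) (minus (w t) (u t))) by vec (nm E).
    rewrite Hz. vec (nm E). }
  split; [|split].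
  - rewrite <- Hwu. unfold w. rewrite (RInt_0_0 (fun s => B s (u s))). vec (nm E).
  - intros t. apply (is_derive_ext w u); [exact Hwu|apply Hw].
  (* The error bound at n = 0, where the iterate is x itself. *)
  - intros t M HM HBM. specialize (Hu _ M HM HBM 0%nat t (Rle_refl _)).
    simpl in Hu. rewrite Rmult_1_r in Hu.
    eapply Rle_trans; [apply (norm_le_dist _ x)|]. lra.
Qed.

(** Solutions are chosen separately for each initial value; uniqueness makes them depend linearly on
    it. *)
Lemma evolution_exists : exists V : R -> nm E -> nm E,
  strongly_continuous V /\ (forall x, V 0 x = x) /\
  (forall x t, is_derive (fun s => V s x) t (B t (V t x))).
Proof.
  set (V := fun t x => proj1_sig (constructive_indefinite_description _ (ode_exists x)) t).
  assert (HV : forall x, V 0 x = x /\ (forall t, is_derive (fun t => V t x) t (B t (V t x))) /\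
    forall t M, 0 < M -> (forall s y, Rabs s <= Rabs t -> norm (B s y) <= M * norm y) ->
    norm (V t x) <= norm x * (1 + exp (2 * M * Rabs t))).
  { intros x. exact (proj2_sig (constructive_indefinite_description _ (ode_exists x))). }
  exists V. split; [split|split].
  - intros t. apply Build_is_linear.
    + intros x y. apply (ode_unique (fun t => V t (plus x y)) (fun t => plus (V t x) (V t y))).
      * apply HV.
      * intros s. rewrite (linear_plus _ (sc_linear B HB s)).
        apply (is_derive_plus (V := nm E)); apply HV.
      * rewrite !(proj1 (HV _)). reflexivity.
    + intros a x. apply (ode_unique (fun t => V t (scal a x)) (fun t => scal a (V t x))).
      * apply HV.
      * intros s. rewrite (linear_scal _ (sc_linear B HB s)).
        apply (is_derive_linear (fun y => scal a y) (fun t => V t x));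
          [apply is_linear_scal_R|apply HV].
      * rewrite !(proj1 (HV _)). reflexivity.
    + destruct (sc_bounded B HB (Rabs t)) as (M & HM & HBM).
      exists (1 + exp (2 * M * Rabs t)). split.
      * generalize (exp_pos (2 * M * Rabs t)). lra.
      * intros x. rewrite Rmult_comm. now apply HV.
  - intros x t. apply (is_derive_continuous (fun s => V s x) t (B t (V t x))). apply HV.
  - apply HV.
  - apply HV.
Qed.

End LinearODE.

(** * Groups and their generators *)

Lemma is_derive_unique_vec {E : NormedModule R_AbsRing} (f : R -> E) (t : R) (l l' : E) :
  is_derive f t l -> is_derive f t l' -> l = l'.
Proof.
  intros H H'.
  assert (H0 : is_derive (fun s => minus (f s) (f s)) t (minus l l'))
    by now apply (is_derive_minus (V := E)).
  assert (Hz : norm (minus l l') <= 0).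
  { apply Rnot_lt_le. intros Hlt.
    destruct (proj1 (is_derive_iff _ t _) H0 (norm (minus l l') / 2)) as (d & Hd & Hs); [lra|].
    specialize (Hs (t + d / 2)). replace (t + d / 2 - t) with (d / 2) in Hs by ring.
    rewrite Rabs_pos_eq in Hs by lra.
    replace (minus (minus (minus (f (t + d / 2)) (f (t + d / 2))) (minus (f t) (f t)))
               (scal (d / 2) (minus l l')))
      with (scal (- (d / 2)) (minus l l')) in Hs by vec E.
    rewrite norm_scal_R, Rabs_Ropp, Rabs_pos_eq in Hs by lra.
    assert (d / 2 * norm (minus l l') <= norm (minus l l') / 2 * (d / 2)) by (apply Hs; lra).
    assert (0 < d * norm (minus l l')) by (apply Rmult_lt_0_compat; lra).
    lra. }
  assert (Hm : minus l l' = zero).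
  { apply norm_eq_zero. generalize (norm_ge_0 (minus l l')). lra. }
  replace l with (plus (minus l l') l') by vec E. rewrite Hm. vec E.
Qed.

Lemma sc_integral {E F : rbanach} (B : R -> nm E -> nm F) :
  strongly_continuous B ->
  strongly_continuous (fun t x => RInt (V := F) (fun s => B s x) 0 t : nm F).
Proof.
  intros HB.
  assert (Hd : forall x t, is_derive (fun t => RInt (V := F) (fun s => B s x) 0 t : nm F) t (B t x)).
  { intros x t. apply (is_derive_primitive (fun s => B s x)). apply HB. }
  split.
  - intros t. apply Build_is_linear.
    + intros x y.
      apply (eq_derive_eq (fun t => RInt (V := F) (fun s => B s (plus x y)) 0 t : nm F)
        (fun t => plus (RInt (V := F) (fun s => B s x) 0 t : nm F) (RInt (V := F) (fun s => B s y) 0 t : nm F))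
        (fun t => B t (plus x y))).
      * apply Hd.
      * intros s. rewrite (linear_plus _ (sc_linear B HB s)).
        apply (is_derive_plus (V := nm F)); apply Hd.
      * rewrite (RInt_0_0 (fun s => B s (plus x y))), (RInt_0_0 (fun s => B s x)),
          (RInt_0_0 (fun s => B s y)). vec (nm F).
    + intros a x.
      apply (eq_derive_eq (fun t => RInt (V := F) (fun s => B s (scal a x)) 0 t : nm F)
        (fun t => scal a (RInt (V := F) (fun s => B s x) 0 t : nm F))
        (fun t => B t (scal a x))).
      * apply Hd.
      * intros s. rewrite (linear_scal _ (sc_linear B HB s)).
        apply (is_derive_linear (fun y => scal a y) (fun t => RInt (V := F) (fun s => B s x) 0 t));
          [apply is_linear_scal_R|apply Hd].
      * rewrite (RInt_0_0 (fun s => B s (scal a x))), (RInt_0_0 (fun s => B s x)).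
        vec (nm F).
    + destruct (sc_bounded B HB (Rabs t)) as (M & HM & HBM).
      exists (M * Rabs t + 1). split.
      * generalize (Rmult_le_pos M (Rabs t)) (Rabs_pos t). lra.
      * intros x. apply Rle_trans with (M * norm x * Rabs t).
        -- apply (norm_RInt_bound (fun s => B s x)); [apply HB|].
           intros s Hs. now apply HBM.
        -- generalize (norm_ge_0 x). lra.
  - intros x t. apply (is_derive_continuous _ t _ (Hd x t)).
Qed.

(** The iteration z |-> x + N z from zero contracts by 1 / 2. [Z] is chosen pointwise and is linear
    because 1 - N is injective. *)
Lemma neumann {E : rbanach} (N : nm E -> nm E) :
  is_linear N -> (forall x, norm (N x) <= 1 / 2 * norm x) ->
  exists Z : nm E -> nm E, is_linear Z /\ (forall x, minus (Z x) (N (Z x)) = x) /\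
    (forall x, norm (Z x) <= 2 * norm x).
Proof.
  intros HN Hn.
  assert (Hu : forall z : nm E, minus z (N z) = zero -> z = zero).
  { intros z Hz. apply norm_eq_zero. generalize (norm_ge_0 z) (Hn z).
    replace (N z) with z; [lra|].
    transitivity (plus (minus z (N z)) (N z)); [vec (nm E)|]. rewrite Hz. vec (nm E). }
  assert (Hex : forall x : nm E, exists z : nm E, minus z (N z) = x /\ norm z <= 2 * norm x).
  { intros x. set (z := nat_rect (fun _ => nm E : Type) zero (fun _ w => plus x (N w))).
    destruct (telescoping_tends z (fun n => 2 * norm x * (1 / 2) ^ n)) as (l & Hl & Hb).
    - intros n. apply Rle_trans with (norm x * (1 / 2) ^ n); [|apply Req_le; simpl; field].
      induction n as [|n IH].
      + change (norm (minus (plus x (N zero)) (zero : nm E)) <= norm x * 1).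
        rewrite (linear_zero _ HN).
        replace (minus (plus x (zero : nm E)) (zero : nm E)) with x by vec (nm E). lra.
      + change (z (S (S n))) with (plus x (N (z (S n)))).
        change (z (S n)) with (plus x (N (z n))) at 2.
        replace (minus (plus x (N (z (S n)))) (plus x (N (z n))))
          with (N (minus (z (S n)) (z n)))
          by (rewrite (linear_minus _ _ _ HN); vec (nm E)).
        eapply Rle_trans; [apply Hn|]. rewrite <- tech_pow_Rmult. lra.
    - intros n. apply Rmult_le_pos; [|left; apply pow_half_pos].
      generalize (norm_ge_0 x); lra.
    - intros eps. apply pow_half_lt.
    - exists l. split.
      + assert (H1 : tends (fun n => z (S n)) (plus x (N l))).
        { apply (tends_plus (fun _ => x) (fun n => N (z n))).
          - apply tends_const.
          - now apply tends_linear. }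
        assert (H2 : tends (fun n => z (S n)) l).
        { apply tends_iff. intros eps He. destruct (proj1 (tends_iff z l) Hl eps He) as [k Hk].
          exists k. intros n Hnk. apply Hk. lia. }
        rewrite (tends_unique _ l _ H2 H1) at 1. vec (nm E).
      + specialize (Hb 0%nat). simpl in Hb. rewrite Rmult_1_r in Hb.
        change (norm (minus l (zero : nm E)) <= 2 * norm x) in Hb.
        replace (minus l (zero : nm E)) with l in Hb by vec (nm E). exact Hb. }
  set (Z := fun x => proj1_sig (constructive_indefinite_description _ (Hex x))).
  assert (HZ : forall x : nm E, minus (Z x) (N (Z x)) = x /\ norm (Z x) <= 2 * norm x).
  { intros x. exact (proj2_sig (constructive_indefinite_description _ (Hex x))). }
  assert (Hinj : forall z w : nm E, minus z (N z) = minus w (N w) -> z = w).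
  { intros z w H. replace z with (plus (minus z w) w) by vec (nm E).
    rewrite (Hu (minus z w)); [vec (nm E)|].
    rewrite (linear_minus _ _ _ HN).
    replace (minus (minus z w) (minus (N z) (N w)))
      with (minus (minus z (N z)) (minus w (N w))) by vec (nm E).
    rewrite H. vec (nm E). }
  exists Z. split; [|split; intros; apply HZ].
  apply Build_is_linear.
  - intros x y. apply Hinj. rewrite (proj1 (HZ _)), (linear_plus _ HN).
    transitivity (plus (minus (Z x) (N (Z x))) (minus (Z y) (N (Z y)))); [|vec (nm E)].
    now rewrite !(proj1 (HZ _)).
  - intros a x. apply Hinj. rewrite (proj1 (HZ _)), (linear_scal _ HN).
    transitivity (scal a (minus (Z x) (N (Z x)))); [|vec (nm E)].
    now rewrite !(proj1 (HZ _)).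
  - exists 2. split; [lra|]. intros x. apply HZ.
Qed.

Record c0_group {E : rbanach} (U : R -> nm E -> nm E) : Prop := {
  group_sc : strongly_continuous U;
  group_zero : forall x, U 0 x = x;
  group_plus : forall t s x, U (t + s) x = U t (U s x)
}.

(** The graph of the generator as a relation: domain questions, closedness and perturbations become
    statements about pairs, without a partially defined map. *)
Definition generates {E : rbanach} (U : R -> nm E -> nm E) (x y : nm E) : Prop :=
  is_derive (fun t => U t x) 0 y.

Section Group.

Context {E : rbanach} (U : R -> nm E -> nm E).

Hypothesis HU : c0_group U.

Let HUsc := group_sc U HU.
Let HUlin t := sc_linear U HUsc t.

Lemma group_opp_l (t : R) (x : nm E) : U (- t) (U t x) = x.
Proof. rewrite <- (group_plus U HU). rewrite Rplus_opp_l. apply (group_zero U HU). Qed.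

Lemma group_opp_r (t : R) (x : nm E) : U t (U (- t) x) = x.
Proof. rewrite <- (group_plus U HU). rewrite Rplus_opp_r. apply (group_zero U HU). Qed.

Lemma group_comm (t s : R) (x : nm E) : U t (U s x) = U s (U t x).
Proof. rewrite <- !(group_plus U HU). now rewrite Rplus_comm. Qed.

Lemma generates_derive (x y : nm E) :
  generates U x y -> forall t, is_derive (fun s => U s x) t (U t y).
Proof.
  intros H t. apply (is_derive_ext (fun s => U t (U (s + - t) x))).
  - intros s. rewrite <- (group_plus U HU). f_equal. ring.
  - apply (is_derive_linear (U t) (fun s => U (s + - t) x)); [apply HUlin|].
    apply (is_derive_shift (fun s => U s x)). now rewrite Rplus_opp_r.
Qed.

Lemma generates_invariant (x y : nm E) (t : R) :
  generates U x y -> generates U (U t x) (U t y).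
Proof.
  intros H. apply (is_derive_ext (fun s => U t (U s x))).
  - intros s. apply group_comm.
  - apply (is_derive_linear (U t) (fun s => U s x)); [apply HUlin|exact H].
Qed.

(** U t applied to the integral over [0, h] is the integral over [t, h + t], since both have the
    same derivative in h; then differentiate at t = 0. *)
Lemma generates_integral (x : nm E) (h : R) :
  generates U (RInt (V := E) (fun s => U s x) 0 h) (minus (U h x) x).
Proof.
  assert (Hd : forall t, is_derive (fun t => RInt (V := E) (fun s => U s x) 0 t : nm E) t (U t x)).
  { intros t. apply (is_derive_primitive (fun s => U s x)). apply HUsc. }
  assert (Heq : forall t h, U t (RInt (V := E) (fun s => U s x) 0 h)
    = minus (RInt (V := E) (fun s => U s x) 0 (h + t) : nm E) (RInt (V := E) (fun s => U s x) 0 t : nm E)).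
  { intros t. apply (eq_derive_eq (fun h => U t (RInt (V := E) (fun s => U s x) 0 h)) _
      (fun h => U t (U h x))).
    - intros s. apply (is_derive_linear (U t) (fun s => RInt (V := E) (fun s => U s x) 0 s));
        [apply HUlin|apply Hd].
    - intros s. apply (is_derive_eq _ _ (minus (U (s + t) x) zero)).
      + apply (is_derive_minus (V := nm E)); [|apply (is_derive_const (V := nm E))].
        apply (is_derive_shift (fun t => RInt (V := E) (fun s => U s x) 0 t : nm E)). apply Hd.
      + rewrite Rplus_comm, (group_plus U HU). vec (nm E).
    - rewrite Rplus_0_l. rewrite (RInt_0_0 (fun s => U s x)), (linear_zero _ (HUlin t)).
      vec (nm E). }
  unfold generates. eapply is_derive_ext; [intros t; symmetry; apply Heq|].
  apply (is_derive_eq _ _ (minus (U h x) (U 0 x))); [|now rewrite (group_zero U HU)].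
  apply (is_derive_minus (V := nm E)); [|apply Hd].
  apply (is_derive_ext (fun t => RInt (V := E) (fun s => U s x) 0 (t + h) : nm E)).
  - intros t. now rewrite Rplus_comm.
  - apply (is_derive_shift (fun t => RInt (V := E) (fun s => U s x) 0 t : nm E)).
    rewrite Rplus_0_l. apply Hd.
Qed.

(** The integrated form contains no derivative and therefore passes to limits; closedness of the
    generator follows. *)
Lemma generates_iff_integral (x y : nm E) :
  generates U x y <->
  forall t, RInt (V := E) (fun s => U s y) 0 t = minus (U t x) x.
Proof.
  split.
  - intros H t. rewrite (RInt_derive_eq (fun s => U s x) (fun s => U s y)).
    + now rewrite (group_zero U HU).
    + now apply generates_derive.
    + apply HUsc.
  - intros H. unfold generates.
    apply (is_derive_ext (fun t => plus x (RInt (V := E) (fun s => U s y) 0 t : nm E))).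
    + intros t. eapply eq_trans; [apply f_equal, H|]. vec (nm E).
    + apply (is_derive_eq _ _ (plus zero (U 0 y))).
      * apply (is_derive_plus (V := nm E)); [apply (is_derive_const (V := nm E))|].
        apply (is_derive_primitive (fun s => U s y)). apply HUsc.
      * rewrite (group_zero U HU). vec (nm E).
Qed.

Lemma generates_closed (u v : nat -> nm E) (x y : nm E) :
  tends u x -> tends v y -> (forall n, generates U (u n) (v n)) -> generates U x y.
Proof.
  intros Hu Hv H. apply generates_iff_integral. intros t.
  apply (tends_unique (fun n => minus (U t (u n)) (u n))).
  - apply (filterlim_ext (fun n => RInt (V := E) (fun s => U s (v n)) 0 t : nm E)).
    + intros n. now apply generates_iff_integral.
    + apply (tends_linear (fun y => RInt (V := E) (fun s => U s y) 0 t : nm E) v y); [|exact Hv].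
      apply (sc_linear _ (sc_integral U HUsc)).
  - apply (tends_minus (fun n => U t (u n)) u); [now apply tends_linear|exact Hu].
Qed.

Lemma generates_unique (x y y' : nm E) :
  generates U x y -> generates U x y' -> y = y'.
Proof. apply is_derive_unique_vec. Qed.

Lemma generates_plus (x y x' y' : nm E) :
  generates U x y -> generates U x' y' -> generates U (plus x x') (plus y y').
Proof.
  intros H H'. unfold generates.
  apply (is_derive_ext (fun t => plus (U t x) (U t x'))).
  - intros t. symmetry. apply (linear_plus _ (HUlin t)).
  - now apply (is_derive_plus (V := nm E)).
Qed.

Lemma generates_scal (a : R) (x y : nm E) :
  generates U x y -> generates U (scal a x) (scal a y).
Proof.
  intros H. unfold generates.
  apply (is_derive_ext (fun t => scal a (U t x))).
  - intros t. symmetry. apply (linear_scal _ (HUlin t)).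
  - apply (is_derive_linear (fun z => scal a z) (fun t => U t x)); [apply is_linear_scal_R|exact H].
Qed.

Lemma generates_minus (x y x' y' : nm E) :
  generates U x y -> generates U x' y' -> generates U (minus x x') (minus y y').
Proof.
  intros H H'. replace (minus x x') with (plus x (scal (-1) x')) by vec (nm E).
  replace (minus y y') with (plus y (scal (-1) y')) by vec (nm E).
  apply generates_plus; [exact H|]. now apply generates_scal.
Qed.

(** The averages of the orbit over [0, h] lie in the domain and tend to x as h tends to 0. *)
Lemma generates_dense (x : nm E) (eps : R) :
  0 < eps -> exists x' y', generates U x' y' /\ norm (minus x x') < eps.
Proof.
  intros He.
  assert (Hd : is_derive (fun t => RInt (V := E) (fun s => U s x) 0 t : nm E) 0 (U 0 x)).
  { apply (is_derive_primitive (fun s => U s x)). apply HUsc. }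
  rewrite (group_zero U HU) in Hd.
  destruct (proj1 (is_derive_iff _ 0 x) Hd (eps / 2)) as (d & Hd0 & H); [lra|].
  set (h := d / 2). specialize (H h).
  rewrite Rminus_0_r, Rabs_pos_eq in H by (unfold h; lra).
  exists (scal (/ h) (RInt (V := E) (fun s => U s x) 0 h : nm E)), (scal (/ h) (minus (U h x) x)).
  split; [apply generates_scal, generates_integral|].
  assert (Hh : 0 < h) by (unfold h; lra).
  rewrite norm_minus_sym. rewrite (RInt_0_0 (fun s => U s x)) in H.
  set (p := RInt (V := E) (fun s => U s x) 0 h : nm E) in *.
  apply (norm_lt_eq _ (scal (/ h) (minus (minus p (zero : nm E)) (scal h x)))); [vec (nm E)|].
  rewrite norm_scal_R, Rabs_pos_eq by (left; now apply Rinv_0_lt_compat).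
  apply Rle_lt_trans with (/ h * (eps / 2 * h)).
  - apply Rmult_le_compat_l; [left; now apply Rinv_0_lt_compat|]. apply H. unfold h; lra.
  - replace (/ h * (eps / 2 * h)) with (eps / 2) by (field; lra). lra.
Qed.

End Group.

Lemma eq_on_dense {E F : rbanach} (L L' : nm E -> nm F) (P : nm E -> Prop) :
  is_linear L -> is_linear L' ->
  (forall x eps, 0 < eps -> exists x', P x' /\ norm (minus x x') < eps) ->
  (forall x, P x -> L x = L' x) -> forall x, L x = L' x.
Proof.
  intros HL HL' Hd HP x.
  destruct (linear_norm _ HL) as (M & HM & HLM).
  destruct (linear_norm _ HL') as (M' & HM' & HLM').
  assert (Hz : norm (minus (L x) (L' x)) <= 0).
  { apply Rnot_lt_le. intros Hlt.
    destruct (Hd x (norm (minus (L x) (L' x)) / (M + M'))) as (x' & Hx' & Hn).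
    { apply Rdiv_lt_0_compat; lra. }
    assert (H : minus (L x) (L' x) = minus (L (minus x x')) (L' (minus x x'))).
    { rewrite (linear_minus _ _ _ HL), (linear_minus _ _ _ HL'), (HP x' Hx'). vec (nm F). }
    assert (H1 : norm (minus (L x) (L' x)) <= (M + M') * norm (minus x x')).
    { rewrite H. eapply Rle_trans; [apply norm_minus_le|].
      generalize (HLM (minus x x')) (HLM' (minus x x')). lra. }
    apply (Rmult_lt_compat_l (M + M')) in Hn; [|lra].
    replace ((M + M') * (norm (minus (L x) (L' x)) / (M + M')))
      with (norm (minus (L x) (L' x))) in Hn by (field; lra).
    lra. }
  assert (Hm : minus (L x) (L' x) = zero).
  { apply norm_eq_zero. generalize (norm_ge_0 (minus (L x) (L' x))). lra. }
  replace (L x) with (plus (minus (L x) (L' x)) (L' x)) by vec (nm F).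
  rewrite Hm. vec (nm F).
Qed.

(** For x in the domain, V (- s) (B (U s x)) has derivative zero in s; density does the rest. Scalar
    linearity, reflection symmetry and the splitting into summands are all instances. *)
Lemma group_intertwine {E F : rbanach} (U : R -> nm E -> nm E) (V : R -> nm F -> nm F)
  (B : nm E -> nm F) :
  c0_group U -> c0_group V -> is_linear B ->
  (forall x y, generates U x y -> generates V (B x) (B y)) ->
  forall t x, B (U t x) = V t (B x).
Proof.
  intros HU HV HB H t.
  assert (HW : strongly_continuous (fun t => V (- t))).
  { apply (sc_reparam V (fun t => - t)); [|apply (group_sc V HV)].
    intros s. apply continuous_neg. }
  apply (eq_on_dense (fun x => B (U t x)) (fun x => V t (B x)) (fun x => exists y, generates U x y)).
  - apply (is_linear_comp (U t) B); [apply (group_sc U HU)|exact HB].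
  - apply (is_linear_comp B (V t)); [exact HB|apply (group_sc V HV)].
  - intros x eps He. destruct (generates_dense U HU x eps He) as (x' & y' & Hg & Hn).
    exists x'. split; [now exists y'|exact Hn].
  - intros x [y Hxy].
    assert (Hd : forall s, is_derive (fun s => V (- s) (B (U s x))) s zero).
    { intros s. set (w := B (U s y)).
      apply (is_derive_eq _ _ (plus (opp (V (- s) w)) (V (- s) w))); [|vec (nm F)].
      apply (sc_derive_apply (fun t => V (- t)) HW (fun s => B (U s x))).
      - apply (is_derive_linear B (fun s => U s x)); [exact HB|].
        now apply (generates_derive U HU).
      - apply (is_derive_ext (fun r => V (0 - r) (B (U s x)))).
        + intros r. f_equal. ring.
        + apply (is_derive_reflect (fun r => V r (B (U s x)))).
          replace (0 - s) with (- s) by ring. apply (generates_derive V HV).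
          apply H. now apply (generates_invariant U HU). }
    assert (He : V (- t) (B (U t x)) = V (- 0) (B (U 0 x))).
    { apply (eq_derive_eq (fun s => V (- s) (B (U s x))) (fun _ => V (- 0) (B (U 0 x)))
        (fun _ => zero)); [exact Hd| |reflexivity].
      intros s. apply (is_derive_const (V := nm F)). }
    rewrite Ropp_0, (group_zero U HU), (group_zero V HV) in He.
    rewrite <- He. symmetry. apply (group_opp_r V HV).
Qed.

Lemma group_rescale {E : rbanach} (U : R -> nm E -> nm E) (l : R) :
  c0_group U -> c0_group (fun t x => scal (exp (- l * t)) (U t x)).
Proof.
  intros HU. split; [split|..].
  - intros t. apply (is_linear_comp (U t) (fun x => scal (exp (- l * t)) x)).
    + apply (group_sc U HU).
    + apply is_linear_scal_R.
  - intros x t. apply (continuous_scal (K := R_AbsRing) (V := nm E) (fun t => exp (- l * t))).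
    + apply (ex_derive_continuous (V := R_NormedModule)). auto_derive. easy.
    + apply (group_sc U HU).
  - intros x. rewrite Rmult_0_r, exp_0, (group_zero U HU). vec (nm E).
  - intros t s x. rewrite (linear_scal _ (sc_linear U (group_sc U HU) t)).
    rewrite Rmult_plus_distr_l, exp_plus, (group_plus U HU). vec (nm E).
Qed.

(** One direction is the product rule; the other is the same implication for the rescaled group,
    rescaled back by - l. *)
Lemma generates_rescale {E : rbanach} (U : R -> nm E -> nm E) (l : R) (x y : nm E) :
  c0_group U ->
  generates (fun t x => scal (exp (- l * t)) (U t x)) x y <->
  generates U x (plus y (scal l x)).
Proof.
  assert (Hone : forall (U : R -> nm E -> nm E) l x y, c0_group U -> generates U x y ->
    generates (fun t x => scal (exp (- l * t)) (U t x)) x (minus y (scal l x))).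
  { intros V m z w HV H. unfold generates.
    assert (Hs : strongly_continuous (fun (t : R) (z : nm E) => scal (exp (- m * t)) z)).
    { split.
      - intros t. apply is_linear_scal_R.
      - intros p t. apply (continuous_scal (K := R_AbsRing) (V := nm E) (fun t => exp (- m * t)) (fun _ => p)).
        + apply (ex_derive_continuous (V := R_NormedModule)). auto_derive. easy.
        + apply continuous_const. }
    apply (is_derive_eq _ _ (plus (scal (- m) (V 0 z)) (scal (exp (- m * 0)) w))).
    - apply (sc_derive_apply _ Hs (fun t => V t z)); [exact H|].
      apply (is_derive_scal_l (K := R_AbsRing) (V := nm E) (fun t => exp (- m * t))).
      apply (is_derive_ext (fun t => exp (- m * t))); [easy|].
      evar_last; [auto_derive; [easy|reflexivity]|]. rewrite Rmult_0_r, exp_0. ring.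
    - rewrite (group_zero V HV), Rmult_0_r, exp_0. vec (nm E). }
  intros HU. split; intros H.
  - specialize (Hone _ (- l) x y (group_rescale U l HU) H).
    replace (plus y (scal l x)) with (minus y (scal (- l) x)) by vec (nm E).
    eapply is_derive_ext; [|exact Hone].
    intros t. simpl. replace (- - l * t) with (- (- l * t)) by ring.
    rewrite exp_Ropp. vec (nm E). field. apply Rgt_not_eq, exp_pos.
  - specialize (Hone _ l x _ HU H).
    eapply is_derive_eq; [exact Hone|]. vec (nm E).
Qed.

(** * Resolvents and bounded perturbations *)

Lemma exp_opp_small (c eps L0 : R) : 0 < eps ->
  exists l, L0 <= l /\ 0 < l /\ c / l <= eps /\ c * exp (- l) <= eps.
Proof.
  intros He. set (l := Rmax 1 (Rmax L0 (Rabs c / eps))).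
  assert (Hl : 1 <= l /\ L0 <= l /\ Rabs c / eps <= l).
  { unfold l. repeat split.
    - apply Rmax_l.
    - eapply Rle_trans; [apply Rmax_l|apply Rmax_r].
    - eapply Rle_trans; [apply Rmax_r|apply Rmax_r]. }
  destruct Hl as (H1 & H2 & H3).
  assert (H4 : Rabs c / l <= eps).
  { apply (Rmult_le_compat_r (eps / l)) in H3.
    - replace (Rabs c / eps * (eps / l)) with (Rabs c / l) in H3 by (field; lra).
      replace (l * (eps / l)) with eps in H3 by (field; lra). exact H3.
    - left. apply Rdiv_lt_0_compat; lra. }
  assert (H5 : c / l <= Rabs c / l).
  { apply Rmult_le_compat_r; [left; apply Rinv_0_lt_compat; lra|apply Rle_abs]. }
  assert (H6 : exp (- l) <= / l).
  { rewrite exp_Ropp. apply Rinv_le_contravar; [lra|].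
    generalize (exp_ineq1 l). lra. }
  exists l. repeat split; try lra.
  apply Rle_trans with (Rabs c * / l); [|exact H4].
  apply Rle_trans with (Rabs c * exp (- l)).
  - apply Rmult_le_compat_r; [left; apply exp_pos|apply Rle_abs].
  - apply Rmult_le_compat_l; [apply Rabs_pos|exact H6].
Qed.

Section Resolvent.

Context {E : rbanach} (U : R -> nm E -> nm E).

(** For the generator A of [U], the last two clauses are (l - A) Q = 1 and Q (l - A) = 1 on the
    domain of A. *)
Record is_resolvent (l : R) (Q : nm E -> nm E) : Prop := {
  resolvent_linear : is_linear Q;
  resolvent_right : forall x, generates U (Q x) (minus (scal l (Q x)) x);
  resolvent_left : forall x y, generates U x y -> Q (minus (scal l x) y) = x
}.

Hypothesis HU : c0_group U.

(* The resolvent is [V (1 - exp (-l) U 1)^-1], where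
   [V x = int_0^1 exp (- l s) U s x ds] satisfies [(l - A) V = 1 - exp (-l) U 1]. *)
Lemma resolvent_exists (eps : R) : 0 < eps ->
  exists l Q, is_resolvent l Q /\ forall x, norm (Q x) <= eps * norm x.
Proof.
  intros He. destruct (sc_bounded U (group_sc U HU) 1) as (M & HM & HUM).
  (* 2 M exp (- l) <= 1 makes exp (- l) U 1 a contraction by 1 / 2, and 2 M / l <= eps is the final
     bound, from norm M / l for [V] and 2 for the Neumann inverse. *)
  destruct (exp_opp_small (2 * M) (Rmin 1 eps) 1) as (l & Hl1 & Hl0 & Hl2 & Hl3).
  { apply Rmin_glb_lt; lra. }
  assert (Hle : 2 * M * exp (- l) <= 1) by (eapply Rle_trans; [exact Hl3|apply Rmin_l]).
  assert (Hlq : 2 * M / l <= eps) by (eapply Rle_trans; [exact Hl2|apply Rmin_r]).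
  set (Ul := fun (t : R) (x : nm E) => scal (exp (- l * t)) (U t x)).
  assert (HUl : c0_group Ul) by now apply group_rescale.
  assert (HUlsc := group_sc Ul HUl).
  set (V := fun x : nm E => RInt (V := E) (fun s => Ul s x) 0 1 : nm E).
  assert (HV : is_linear V) by apply (sc_linear _ (sc_integral Ul HUlsc)).
  destruct (neumann (Ul 1)) as (Z & HZ & HZ1 & HZ2).
  { apply HUlsc. }
  { intros x. unfold Ul. rewrite norm_scal_R, Rmult_1_r, Rabs_pos_eq by (left; apply exp_pos).
    apply Rle_trans with (exp (- l) * (M * norm x)).
    - apply Rmult_le_compat_l; [left; apply exp_pos|]. apply HUM. rewrite Rabs_R1; lra.
    - rewrite <- Rmult_assoc. apply Rmult_le_compat_r; [apply norm_ge_0|]. lra. }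
  assert (Hr : forall x, generates U (V (Z x)) (minus (scal l (V (Z x))) x)).
  { intros x. assert (H := generates_integral Ul HUl (Z x) 1).
    apply generates_rescale in H; [|exact HU].
    eapply is_derive_eq; [exact H|].
    transitivity (minus (scal l (V (Z x))) (minus (Z x) (Ul 1 (Z x))));
      [unfold V; vec (nm E)|]. now rewrite HZ1. }
  (* A solution of A x = l x is constant along the rescaled group, but [Ul 1] at least halves norms,
     so x = 0. *)
  assert (Hinj : forall x, generates U x (scal l x) -> x = zero).
  { intros x Hx. assert (H : generates Ul x zero).
    { apply generates_rescale; [exact HU|]. eapply is_derive_eq; [exact Hx|]. vec (nm E). }
    assert (Hd : forall t, is_derive (fun t => Ul t x) t zero).
    { intros t. eapply is_derive_eq; [now apply (generates_derive Ul HUl _ _ H)|].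
      apply (linear_zero _ (sc_linear Ul HUlsc t)). }
    assert (Hc : Ul 1 x = x).
    { rewrite <- (group_zero Ul HUl x) at 2.
      symmetry. apply (eq_is_derive (fun t => Ul t x) 0 1); [auto|lra]. }
    apply norm_eq_zero. apply Rle_antisym; [|apply norm_ge_0].
    assert (Hn : norm (Ul 1 x) <= 1 / 2 * norm x).
    { unfold Ul. rewrite norm_scal_R, Rmult_1_r, Rabs_pos_eq by (left; apply exp_pos).
      apply Rle_trans with (exp (- l) * (M * norm x)).
      - apply Rmult_le_compat_l; [left; apply exp_pos|]. apply HUM. rewrite Rabs_R1; lra.
      - rewrite <- Rmult_assoc. apply Rmult_le_compat_r; [apply norm_ge_0|]. lra. }
    rewrite Hc in Hn. lra. }
  exists l, (fun x => V (Z x)). split; [split|].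
  - now apply (is_linear_comp Z V).
  - exact Hr.
  - intros x y Hxy. set (w := minus (scal l x) y).
    assert (Hz : minus (V (Z w)) x = zero).
    { apply Hinj. eapply is_derive_eq; [apply (generates_minus U HU _ _ _ _ (Hr w) Hxy)|].
      unfold w. vec (nm E). }
    transitivity (plus (minus (V (Z w)) x) x); [vec (nm E)|]. rewrite Hz. vec (nm E).
  - intros x.
    assert (HVn : forall z, norm (V z) <= M / l * norm z).
    { intros z. replace (M / l * norm z) with
        ((M * norm z * (- / l * exp (- l * 1))) - M * norm z * (- / l * exp (- l * 0))
          - M * norm z * (- / l * exp (- l * 1))) by (rewrite Rmult_0_r, exp_0; field; lra).
      apply Rle_trans with (M * norm z * (- / l * exp (- l * 1)) - M * norm z * (- / l * exp (- l * 0))).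
      - apply (norm_RInt_le (V := nm E) (fun s => Ul s z) (fun s => M * norm z * exp (- l * s)) 0 1).
        + lra.
        + intros s Hs. unfold Ul. rewrite norm_scal_R, Rabs_pos_eq by (left; apply exp_pos).
          rewrite Rmult_comm. apply Rmult_le_compat_r; [left; apply exp_pos|].
          apply HUM. rewrite Rabs_pos_eq; lra.
        + apply (RInt_correct (V := E)). apply ex_RInt_continuous. intros. apply HUlsc.
        + apply (is_RInt_derive (V := R_CompleteNormedModule)
            (fun s => M * norm z * (- / l * exp (- l * s))) (fun s => M * norm z * exp (- l * s))).
          * intros s _. auto_derive; [easy|]. field. lra.
          * intros s _. apply (ex_derive_continuous (V := R_NormedModule)). auto_derive. easy.
      - assert (0 <= M * norm z * (/ l * exp (- l * 1))); [|lra].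
        apply Rmult_le_pos; [apply Rmult_le_pos; [lra|apply norm_ge_0]|].
        apply Rmult_le_pos; left; [now apply Rinv_0_lt_compat|apply exp_pos]. }
    eapply Rle_trans; [apply HVn|].
    apply Rle_trans with (M / l * (2 * norm x)).
    + apply Rmult_le_compat_l; [|apply HZ2]. left. apply Rdiv_lt_0_compat; lra.
    + replace (M / l * (2 * norm x)) with (2 * M / l * norm x) by (field; lra).
      apply Rmult_le_compat_r; [apply norm_ge_0|exact Hlq].
Qed.

(* [W t = U t V t] where [V] solves [V' = U (- t) Q U t V], [V 0 = 1]. *)
Lemma bounded_perturbation (Q : nm E -> nm E) :
  is_linear Q ->
  exists W, c0_group W /\
    forall x y, generates W x y <-> generates U x (minus y (Q x)).
Proof.
  intros HQ. assert (HUsc := group_sc U HU).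
  assert (HUm : strongly_continuous (fun t => U (- t))).
  { apply (sc_reparam U (fun t => - t)); [|exact HUsc].
    intros s. apply continuous_neg. }
  set (B := fun t x => U (- t) (Q (U t x))).
  assert (HB : strongly_continuous B).
  { apply (sc_comp (fun t => U (- t)) (fun t x => Q (U t x))); [exact HUm|].
    apply (sc_comp (fun _ => Q) U); [now apply sc_const|exact HUsc]. }
  destruct (evolution_exists B HB) as (V & HV & HV0 & HVd).
  assert (HW0 : strongly_continuous (fun t x => U t (V t x))) by now apply sc_comp.
  (* This cocycle identity is the group law of U t V t. As functions of t, both sides solve the
     equation with coefficient B (t + s). *)
  assert (HVplus : forall t s x, V (t + s) x = U (- s) (V t (U s (V s x)))).
  { intros t s x. revert t.
    assert (HBs : strongly_continuous (fun t => B (t + s))).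
    { apply (sc_reparam B (fun t => t + s)); [|exact HB]. intros t.
      apply continuous_shift. }
    apply (ode_unique (fun t => B (t + s)) HBs).
    - intros t. apply (is_derive_shift (fun t => V t x)). apply HVd.
    - intros t. set (z := U s (V s x)).
      apply (is_derive_eq _ _ (U (- s) (B t (V t z)))).
      + apply (is_derive_linear (U (- s)) (fun t => V t z)); [apply HUsc|apply HVd].
      + unfold B. rewrite <- !(group_plus U HU).
        assert (e1 : forall a b : R, a + b + - b = a) by (intros; ring).
        assert (e2 : forall a b : R, - b + - a = - (a + b)) by (intros; ring).
        now rewrite e1, e2.
    - rewrite Rplus_0_l, HV0. symmetry. apply (group_opp_l U HU). }
  exists (fun t x => U t (V t x)). split.
  - split; [exact HW0|..].
    + intros x. now rewrite HV0, (group_zero U HU).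
    + intros t s x. rewrite HVplus, <- (group_plus U HU). f_equal. ring.
  (* U t (V t x - x) is differentiable at 0 for every x, with derivative Q x. Thus U t V t x and U t
     x are differentiable at 0 for the same x. *)
  - assert (Hd : forall x, is_derive (fun t => U t (minus (V t x) x)) 0 (Q x)).
    { intros x. apply (is_derive_eq _ _ (plus zero (U 0 (Q x)))).
      - apply (sc_derive_apply U HUsc (fun t => minus (V t x) x)).
        + apply (is_derive_eq _ _ (minus (B 0 (V 0 x)) zero)).
          * apply (is_derive_minus (V := nm E)); [apply HVd|apply (is_derive_const (V := nm E))].
          * unfold B. rewrite HV0, Ropp_0, !(group_zero U HU). vec (nm E).
        + apply (is_derive_ext (fun _ => zero)).
          * intros t. rewrite HV0. symmetry.
            transitivity (U t zero); [|apply (linear_zero _ (sc_linear U HUsc t))].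
            f_equal. vec (nm E).
          * apply (is_derive_const (V := nm E)).
      - rewrite (group_zero U HU). vec (nm E). }
    intros x y. unfold generates. split; intros H.
    + apply (is_derive_ext (fun t => minus (U t (V t x)) (U t (minus (V t x) x)))).
      * intros t. rewrite (linear_minus _ _ _ (sc_linear U HUsc t)). vec (nm E).
      * apply (is_derive_minus (V := nm E)); [exact H|apply Hd].
    + apply (is_derive_ext (fun t => plus (U t x) (U t (minus (V t x) x)))).
      * intros t. rewrite (linear_minus _ _ _ (sc_linear U HUsc t)). vec (nm E).
      * eapply is_derive_eq; [apply (is_derive_plus (V := nm E)); [exact H|apply Hd]|].
        vec (nm E).
Qed.

End Resolvent.

Lemma group_conjugate {E : rbanach} (U : R -> nm E -> nm E) (S T : nm E -> nm E) :
  c0_group U -> is_linear S -> is_linear T ->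
  (forall x, S (T x) = x) -> (forall x, T (S x) = x) ->
  c0_group (fun t x => S (U t (T x))) /\
  forall x y, generates (fun t x => S (U t (T x))) x y <-> generates U (T x) (T y).
Proof.
  intros HU HS HT HST HTS. split.
  - split.
    + apply (sc_comp (fun _ => S) (fun t x => U t (T x))); [now apply sc_const|].
      apply (sc_comp U (fun _ => T)); [apply HU|now apply sc_const].
    + intros x. now rewrite (group_zero U HU).
    + intros t s x. now rewrite HTS, (group_plus U HU).
  - intros x y. unfold generates. split; intros H.
    + apply (is_derive_ext (fun t => T (S (U t (T x))))); [intros; apply HTS|].
      now apply (is_derive_linear T (fun t => S (U t (T x)))).
    + apply (is_derive_eq _ _ (S (T y))); [|apply HST].
      now apply (is_derive_linear S (fun t => U t (T x))).
Qed.

(** * Perturbations bounded on the domain of the generator *)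

Section DomainPerturbation.

Context {E : rbanach} (U : R -> nm E -> nm E).

Hypothesis HU : c0_group U.

Variable P : nm E -> nm E.

Let D x := exists y, generates U x y.

Hypothesis P_plus : forall x x', D x -> D x' -> P (plus x x') = plus (P x) (P x').
Hypothesis P_scal : forall a x, D x -> P (scal a x) = scal a (P x).
Hypothesis P_bound : exists M, forall x y, generates U x y ->
  exists z, generates U (P x) z /\ norm (P x) + norm z <= M * (norm x + norm y).

Variables (l : R) (Q : nm E -> nm E).

Hypothesis HQ : is_resolvent U l Q.

Lemma resolvent_domain (x : nm E) : D (Q x).
Proof. eexists. apply (resolvent_right U l Q HQ). Qed.

(** From A Q = l Q - 1, [Q] is bounded into the domain with its graph norm, with constant m + (|l| m
    + 1). *)
Lemma perturbed_resolvent_bound : exists M, 0 < M /\ forall x,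
  exists z, generates U (P (Q x)) z /\ norm (P (Q x)) + norm z <= M * norm x.
Proof.
  destruct P_bound as (M & HM).
  destruct (linear_norm _ (resolvent_linear U l Q HQ)) as (m & Hm & HQm).
  exists (Rabs M * (m + (Rabs l * m + 1)) + 1). split.
  { assert (0 <= Rabs M * (m + (Rabs l * m + 1))); [|lra].
    apply Rmult_le_pos; [apply Rabs_pos|]. generalize (Rmult_le_pos (Rabs l) m (Rabs_pos l)). lra. }
  intros x. destruct (HM _ _ (resolvent_right U l Q HQ x)) as (z & Hz & Hn).
  exists z. split; [exact Hz|].
  eapply Rle_trans; [exact Hn|].
  assert (H1 : norm (minus (scal l (Q x)) x) <= Rabs l * (m * norm x) + norm x).
  { eapply Rle_trans; [apply (norm_minus_le (E := nm E) (scal l (Q x)) x)|]. rewrite norm_scal_R.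
    apply Rplus_le_compat_r, Rmult_le_compat_l; [apply Rabs_pos|apply HQm]. }
  apply Rle_trans with (Rabs M * (m * norm x + (Rabs l * (m * norm x) + norm x))).
  - apply Rle_trans with (Rabs M * (norm (Q x) + norm (minus (scal l (Q x)) x))).
    + apply Rmult_le_compat_r; [|apply Rle_abs].
      generalize (norm_ge_0 (Q x)) (norm_ge_0 (minus (scal l (Q x)) x)). lra.
    + apply Rmult_le_compat_l; [apply Rabs_pos|]. generalize (HQm x). lra.
  - generalize (norm_ge_0 x). nra.
Qed.

(* [T] is the bounded operator [(l - A) P (l - A)^-1]. *)
Lemma conjugated_perturbation : is_linear (fun x => P (Q x)) /\
  exists T : nm E -> nm E, is_linear T /\
    forall x, generates U (P (Q x)) (minus (scal l (P (Q x))) (T x)).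
Proof.
  destruct perturbed_resolvent_bound as (M & HM & HPQ).
  assert (HQl := resolvent_linear U l Q HQ).
  assert (HPlin : is_linear (fun x => P (Q x))).
  { apply Build_is_linear.
    - intros x x'. rewrite (linear_plus _ HQl). apply P_plus; apply resolvent_domain.
    - intros a x. rewrite (linear_scal _ HQl). apply P_scal, resolvent_domain.
    - exists M. split; [exact HM|]. intros x. destruct (HPQ x) as (z & _ & Hn).
      generalize (norm_ge_0 z). lra. }
  split; [exact HPlin|].
  set (Z := fun x => proj1_sig (constructive_indefinite_description _ (HPQ x))).
  assert (HZ : forall x, generates U (P (Q x)) (Z x) /\ norm (P (Q x)) + norm (Z x) <= M * norm x).
  { intros x. exact (proj2_sig (constructive_indefinite_description _ (HPQ x))). }
  exists (fun x => minus (scal l (P (Q x))) (Z x)). split.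
  - assert (HZl : is_linear Z).
    { apply Build_is_linear.
      - intros x x'. apply (generates_unique U (P (Q (plus x x')))); [apply HZ|].
        rewrite (linear_plus _ HPlin). apply generates_plus; auto; apply HZ.
      - intros a x. apply (generates_unique U (P (Q (scal a x)))); [apply HZ|].
        rewrite (linear_scal _ HPlin). apply generates_scal; auto; apply HZ.
      - exists M. split; [exact HM|]. intros x. destruct (HZ x) as [_ Hn].
        generalize (norm_ge_0 (P (Q x))). lra. }
    apply Build_is_linear.
    + intros x x'. rewrite (linear_plus _ HPlin), (linear_plus _ HZl). vec (nm E).
    + intros a x. rewrite (linear_scal _ HPlin), (linear_scal _ HZl). vec (nm E).
    + exists (Rabs l * M + M). split.
      { generalize (Rmult_le_pos (Rabs l) M (Rabs_pos l)). lra. }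
      intros x. destruct (HZ x) as [_ Hn].
      eapply Rle_trans; [apply (norm_minus_le (E := nm E) (scal l (P (Q x))) (Z x))|]. rewrite norm_scal_R, Rmult_plus_distr_r, Rmult_assoc.
      generalize (norm_ge_0 (P (Q x))) (norm_ge_0 (Z x)). intros.
      apply Rplus_le_compat; [apply Rmult_le_compat_l; [apply Rabs_pos|]|]; lra.
  - intros x. eapply is_derive_eq; [apply HZ|]. vec (nm E).
Qed.

End DomainPerturbation.

(* With [Q] the resolvent at [l], [V = 1 - P Q] and [T = (l - A) P Q] one has
   [l - A - P = V (l - A)] and [l - A - T = (l - A) V], so that [A + P] is
   similar, through [V], to the bounded perturbation [A + T]. *)
Lemma domain_perturbation {E : rbanach} (U : R -> nm E -> nm E) (P : nm E -> nm E) :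
  c0_group U ->
  (forall x x' y y', generates U x y -> generates U x' y' -> P (plus x x') = plus (P x) (P x')) ->
  (forall a x y, generates U x y -> P (scal a x) = scal a (P x)) ->
  (exists M, forall x y, generates U x y ->
    exists z, generates U (P x) z /\ norm (P x) + norm z <= M * (norm x + norm y)) ->
  exists W, c0_group W /\
    forall x y, generates W x y <-> generates U x (minus y (P x)).
Proof.
  intros HU Hp Hs HPb.
  assert (P_plus : forall x x', (exists y, generates U x y) -> (exists y, generates U x' y) ->
    P (plus x x') = plus (P x) (P x')) by (intros x x' [y Hy] [y' Hy']; eauto).
  assert (P_scal : forall a x, (exists y, generates U x y) -> P (scal a x) = scal a (P x))
    by (intros a x [y Hy]; eauto).
  clear Hp Hs.
  (* Two resolvents are used: [T] varies with l, so its size cannot be fixed before l is chosen.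
     [T0] belongs to a first value l0, and l is then taken so that Q T0 contracts by 1 / 2. *)
  destruct (resolvent_exists U HU 1) as (l0 & Q0 & HQ0 & _); [lra|].
  destruct (conjugated_perturbation U HU P P_plus P_scal HPb l0 Q0 HQ0) as (HPQ0 & T0 & HT0 & HgT0).
  destruct (linear_norm _ HT0) as (m0 & Hm0 & HT0n).
  destruct (resolvent_exists U HU (/ (2 * m0))) as (l & Q & HQ & HQn).
  { apply Rinv_0_lt_compat; lra. }
  destruct (conjugated_perturbation U HU P P_plus P_scal HPb l Q HQ) as (HPQ & T & HT & HgT).
  assert (HQl := resolvent_linear U l Q HQ).
  assert (HQ0l := resolvent_linear U l0 Q0 HQ0).
  assert (HNn : forall x, norm (Q (T0 x)) <= 1 / 2 * norm x).
  { intros x. eapply Rle_trans; [apply HQn|].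
    apply Rle_trans with (/ (2 * m0) * (m0 * norm x)).
    - apply Rmult_le_compat_l; [left; apply Rinv_0_lt_compat; lra|apply HT0n].
    - apply Req_le. field. lra. }
  destruct (neumann (fun x => Q (T0 x))) as (Z & HZ & HZ1 & _).
  { now apply (is_linear_comp T0 Q). }
  { exact HNn. }
  assert (HQT0 : forall e, Q (T0 e) = plus (scal (l0 - l) (Q (P (Q0 e)))) (P (Q0 e))).
  { intros e. set (y := P (Q0 e)).
    assert (H := resolvent_left U l Q HQ _ _ (HgT0 e)). fold y in H.
    rewrite <- H at 2.
    rewrite <- (linear_scal _ HQl), <- (linear_plus _ HQl). f_equal. vec (nm E). }
  assert (HQ0Q : forall y, Q0 (plus (scal (l0 - l) (Q y)) y) = Q y).
  { intros y. rewrite <- (resolvent_left U l0 Q0 HQ0 _ _ (resolvent_right U l Q HQ y)) at 2.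
    f_equal. vec (nm E). }
  set (V := fun a : nm E => minus a (P (Q a))).
  (* Put R = 1 + (l0 - l) Q. Then P Q = (P Q0) R and Q T0 = R (P Q0), so 1 - P Q and 1 - Q T0 are
     related like 1 - a b and 1 - b a: the inverse of the former is 1 + (P Q0) (1 - Q T0)^-1 R. *)
  set (Vi := fun b => plus b (P (Q0 (Z (plus (scal (l0 - l) (Q b)) b))))).
  assert (HV : is_linear V).
  { apply Build_is_linear.
    - intros x x'. unfold V. rewrite (linear_plus _ HPQ). vec (nm E).
    - intros a x. unfold V. rewrite (linear_scal _ HPQ). vec (nm E).
    - destruct (linear_norm _ HPQ) as (m & Hm & Hn). exists (1 + m). split; [lra|].
      intros x. eapply Rle_trans; [apply (norm_minus_le x (P (Q x)))|].
      generalize (Hn x). lra. }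
  assert (HVi : is_linear Vi).
  { assert (Hg : is_linear (fun b => plus (scal (l0 - l) (Q b)) b)).
    { apply Build_is_linear.
      - intros x x'. rewrite (linear_plus _ HQl). vec (nm E).
      - intros a x. rewrite (linear_scal _ HQl). vec (nm E).
      - destruct (linear_norm _ HQl) as (m & Hm & Hn). exists (Rabs (l0 - l) * m + 1). split.
        + generalize (Rmult_le_pos (Rabs (l0 - l)) m (Rabs_pos _)). lra.
        + intros x. eapply Rle_trans; [apply (norm_triangle (scal (l0 - l) (Q x)) x)|].
          rewrite norm_scal_R, Rmult_plus_distr_r, Rmult_assoc, Rmult_1_l.
          apply Rplus_le_compat_r, Rmult_le_compat_l; [apply Rabs_pos|apply Hn]. }
    assert (Hc : is_linear (fun b => P (Q0 (Z (plus (scal (l0 - l) (Q b)) b))))).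
    { apply (is_linear_comp (fun b => Z (plus (scal (l0 - l) (Q b)) b)) (fun e => P (Q0 e)));
        [|exact HPQ0].
      now apply (is_linear_comp (fun b => plus (scal (l0 - l) (Q b)) b) Z). }
    apply Build_is_linear.
    - intros x x'. unfold Vi. rewrite (linear_plus _ Hc). vec (nm E).
    - intros a x. unfold Vi. rewrite (linear_scal _ Hc). vec (nm E).
    - destruct (linear_norm _ Hc) as (m & Hm & Hn). exists (1 + m). split; [lra|].
      intros x. eapply Rle_trans; [apply (norm_triangle (V := nm E) x)|].
      generalize (Hn x). lra. }
  assert (HVVi : forall b : nm E, V (Vi b) = b).
  { intros b. set (e := Z (plus (scal (l0 - l) (Q b)) b)).
    assert (He : Q (plus b (P (Q0 e))) = Q0 e).
    { rewrite (linear_plus _ HQl), <- (HQ0Q b), <- (HQ0Q (P (Q0 e))), <- HQT0.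
      rewrite <- (linear_plus _ HQ0l). f_equal.
      rewrite <- (HZ1 (plus (scal (l0 - l) (Q b)) b)). fold e. vec (nm E). }
    unfold V, Vi. fold e. rewrite He. vec (nm E). }
  (* If a = P Q a, then e = R a is a fixed point of Q T0, hence zero, and a = P Q0 e vanishes as
     well. *)
  assert (HVinj : forall a : nm E, V a = zero -> a = zero).
  { intros a Ha. assert (HaP : a = P (Q a)).
    { transitivity (plus (V a) (P (Q a))); [unfold V; vec (nm E)|]. rewrite Ha. vec (nm E). }
    set (e := plus (scal (l0 - l) (Q a)) a : nm E).
    assert (HQe : Q0 e = Q a) by apply HQ0Q.
    assert (HN : Q (T0 e) = e).
    { rewrite HQT0, HQe, <- HaP. reflexivity. }
    assert (He : e = (zero : nm E)).
    { apply (norm_eq_zero (V := nm E)). generalize (HNn e) (norm_ge_0 e). rewrite HN. lra. }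
    rewrite HaP, <- HQe, He. apply (linear_zero _ HPQ0). }
  assert (HViV : forall a : nm E, Vi (V a) = a).
  { intros a. assert (Hz : minus (Vi (V a)) a = zero).
    { apply HVinj. rewrite (linear_minus _ _ _ HV), HVVi. vec (nm E). }
    transitivity (plus (minus (Vi (V a)) a) a); [vec (nm E)|]. rewrite Hz. vec (nm E). }
  destruct (bounded_perturbation U HU T HT) as (U2 & HU2 & HgU2).
  destruct (group_conjugate U2 V Vi HU2 HV HVi HVVi HViV) as (HW & HgW).
  exists (fun t x => V (U2 t (Vi x))). split; [exact HW|].
  intros x y. rewrite HgW, HgU2. clear HgW HW HgU2 HU2.
  set (w := Vi x). set (u := Vi y).
  assert (Hx : x = minus w (P (Q w))) by (symmetry; apply HVVi).
  assert (Hy : y = minus u (P (Q u))) by (symmetry; apply HVVi).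
  (* In both directions the vector d = l w - u turns out to satisfy Q d = x, whence P x = l P Q w -
     P Q u. *)
  assert (HPl : forall d, d = minus (scal l w) u ->
    P (Q d) = minus (scal l (P (Q w))) (P (Q u))).
  { intros d ->. rewrite (linear_minus _ _ _ HPQ), (linear_scal _ HPQ). reflexivity. }
  split; intros H.
  - assert (H1 := resolvent_left U l Q HQ _ _ H).
    assert (H2 := resolvent_left U l Q HQ _ _ (HgT w)).
    assert (H3 : Q (minus (scal l w) u) = x).
    { rewrite Hx, <- H2. rewrite <- H1 at 2.
      rewrite <- (linear_minus _ _ _ HQl). f_equal. vec (nm E). }
    assert (H4 := HPl _ eq_refl). rewrite H3 in H4.
    rewrite H4, Hy. rewrite Hx at 1.
    eapply is_derive_eq; [apply (generates_minus U HU _ _ _ _ H (HgT w))|]. vec (nm E).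
  (* This is l - A applied to x, written with A x = y - P x. *)
  - set (d := plus (minus (scal l x) y) (P x)).
    assert (Hd : Q d = x).
    { rewrite <- (resolvent_left U l Q HQ _ _ H) at 1. f_equal. unfold d. vec (nm E). }
    assert (Hd2 : d = minus (scal l w) u).
    { rewrite <- (HViV d). unfold w, u.
      rewrite <- (linear_scal _ HVi), <- (linear_minus _ _ _ HVi). f_equal.
      unfold V. rewrite Hd. unfold d. vec (nm E). }
    assert (H4 := HPl d Hd2). rewrite Hd in H4.
    assert (Hw : w = plus x (P (Q w))) by (rewrite Hx at 1; vec (nm E)).
    rewrite Hw at 1.
    eapply is_derive_eq; [apply (generates_plus U HU _ _ _ _ H (HgT w))|].
    rewrite H4. rewrite Hy at 1. vec (nm E).
Qed.

(** Left quotients come from right ones: for s = - h < 0 the remainder U s x - x - s y equals h (y -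
    U s y) minus U s applied to the remainder at h. *)
Lemma right_derivative_generates {E : rbanach} (U : R -> nm E -> nm E) (x y : nm E) :
  c0_group U ->
  (forall eps, 0 < eps -> exists d, 0 < d /\ forall h, 0 < h < d ->
    norm (minus (minus (U h x) x) (scal h y)) <= eps * h) ->
  generates U x y.
Proof.
  intros HU H. apply is_derive_iff. intros eps He.
  rewrite (group_zero U HU).
  destruct (sc_locally_bounded U (group_sc U HU) 0) as (M & HM & HUM).
  destruct (H (eps / (2 * (M + 1)))) as (d1 & Hd1 & H1).
  { apply Rdiv_lt_0_compat; lra. }
  destruct (proj1 (continuous_R_iff (fun s => U s y) 0) (sc_continuous U (group_sc U HU) y 0) (eps / 2))
    as (d2 & Hd2 & H2); [lra|].
  rewrite (group_zero U HU) in H2.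
  exists (Rmin 1 (Rmin d1 d2)). split; [repeat apply Rmin_glb_lt; lra|].
  intros s Hs. rewrite Rminus_0_r in *.
  assert (Hsd : Rabs s < 1 /\ Rabs s < d1 /\ Rabs s < d2).
  { generalize (Rmin_l 1 (Rmin d1 d2)) (Rmin_r 1 (Rmin d1 d2)) (Rmin_l d1 d2) (Rmin_r d1 d2). lra. }
  destruct Hsd as (Hs1 & Hs2 & Hs3).
  assert (Hq : 0 < eps / (2 * (M + 1))) by (apply Rdiv_lt_0_compat; lra).
  assert (Hq2 : eps / (2 * (M + 1)) <= eps).
  { apply Rmult_le_reg_r with (2 * (M + 1)); [lra|].
    replace (eps / (2 * (M + 1)) * (2 * (M + 1))) with eps by (field; lra). nra. }
  assert (Hq3 : M * (eps / (2 * (M + 1))) <= eps / 2).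
  { apply Rmult_le_reg_r with (2 * (M + 1)); [lra|].
    replace (M * (eps / (2 * (M + 1))) * (2 * (M + 1))) with (M * eps) by (field; lra). nra. }
  destruct (Rtotal_order s 0) as [Hneg|[->|Hpos]].
  - rewrite Rabs_left in * by lra. set (h := - s) in *.
    specialize (H1 h). specialize (H2 s).
    assert (H1' : norm (minus (minus (U h x) x) (scal h y)) <= eps / (2 * (M + 1)) * h)
      by (apply H1; unfold h in *; lra).
    assert (H2' : norm (minus (U s y) y) < eps / 2).
    { apply H2. rewrite Rminus_0_r, Rabs_left; unfold h in *; lra. }
    apply (norm_le_eq _ (minus (scal h (minus y (U s y)))
      (U s (minus (minus (U h x) x) (scal h y))))).
    + rewrite !(linear_minus _ _ _ (sc_linear U (group_sc U HU) s)),
        (linear_scal _ (sc_linear U (group_sc U HU) s)).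
      replace (U s (U h x)) with x.
      * unfold h. vec (nm E).
      * rewrite <- (group_plus U HU). unfold h. rewrite Rplus_opp_r. symmetry. apply (group_zero U HU).
    + eapply Rle_trans; [apply (norm_minus_le (E := nm E))|].
      rewrite norm_scal_R, Rabs_pos_eq by (unfold h; lra).
      rewrite (norm_minus_sym (E := nm E) y).
      assert (Ha : norm (U s (minus (minus (U h x) x) (scal h y))) <= M * (eps / (2 * (M + 1)) * h)).
      { eapply Rle_trans; [apply HUM|].
        - rewrite Rminus_0_r, Rabs_left; unfold h in *; lra.
        - apply Rmult_le_compat_l; lra. }
      assert (Hh : 0 < h) by (unfold h; lra).
      assert (h * norm (minus (U s y) y) <= h * (eps / 2)) by (apply Rmult_le_compat_l; lra).
      assert (M * (eps / (2 * (M + 1)) * h) <= eps / 2 * h).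
      { rewrite <- Rmult_assoc. apply Rmult_le_compat_r; lra. }
      lra.
  - rewrite (group_zero U HU), Rabs_R0, Rmult_0_r.
    apply (norm_le_eq _ (zero : nm E)); [vec (nm E)|]. rewrite norm_zero. lra.
  - rewrite Rabs_pos_eq in * by lra.
    eapply Rle_trans; [apply H1; lra|]. apply Rmult_le_compat_r; lra.
Qed.

(** * Semigroups that extend to groups *)

(* Semigroups are extended to the left by the identity, so that all functions
   are continuous on the whole line. *)
Definition right_extension {E : rbanach} (S : R -> nm E -> nm E) : R -> nm E -> nm E :=
  fun t => S (Rmax 0 t).

Record semigroup {E : rbanach} (S : R -> nm E -> nm E) : Prop := {
  semigroup_sc : strongly_continuous (right_extension S);
  semigroup_zero : forall x, S 0 x = x;
  semigroup_plus : forall t s x, 0 <= t -> 0 <= s -> S (t + s) x = S t (S s x)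
}.

(** The right derivative at 0, multiplied by h so that estimates involve no division. *)
Definition right_generates {E : rbanach} (S : R -> nm E -> nm E) (x y : nm E) : Prop :=
  forall eps, 0 < eps -> exists d, 0 < d /\ forall h, 0 < h < d ->
    norm (minus (minus (S h x) x) (scal h y)) <= eps * h.

Lemma right_extension_pos {E : rbanach} (S : R -> nm E -> nm E) (t : R) :
  0 <= t -> right_extension S t = S t.
Proof. intros Ht. unfold right_extension. now rewrite Rmax_right. Qed.

Section Semigroup.

Context {E : rbanach} (S : R -> nm E -> nm E).

Hypothesis HS : semigroup S.

Let HSc := semigroup_sc S HS.

Lemma semigroup_linear (t : R) : 0 <= t -> is_linear (S t).
Proof. intros Ht. rewrite <- (right_extension_pos S t Ht). apply HSc. Qed.

Lemma right_generates_invariant (x y : nm E) (t : R) :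
  0 <= t -> right_generates S x y -> right_generates S (S t x) (S t y).
Proof.
  intros Ht H eps He.
  assert (Hl := semigroup_linear t Ht).
  destruct (linear_norm _ Hl) as (M & HM & HSM).
  destruct (H (eps / M)) as (d & Hd & H'); [now apply Rdiv_lt_0_compat|].
  exists d. split; [exact Hd|]. intros h Hh.
  rewrite <- (semigroup_plus S HS), Rplus_comm, (semigroup_plus S HS) by lra.
  rewrite <- (linear_scal _ Hl), <- !(linear_minus _ _ _ Hl).
  eapply Rle_trans; [apply HSM|].
  replace (eps * h) with (M * (eps / M * h)) by (field; lra).
  apply Rmult_le_compat_l; [lra|auto].
Qed.

(** As for groups, but the shift under the integral is available only for nonnegative times, so only
    the right derivative is obtained. *)
Lemma right_generates_integral (x : nm E) (h : R) :
  0 <= h ->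
  right_generates S (RInt (V := E) (fun s => right_extension S s x) 0 h) (minus (S h x) x).
Proof.
  intros Hh. set (T := right_extension S).
  set (p := fun t => RInt (V := E) (fun s => T s x) 0 t : nm E).
  assert (Hd : forall t, is_derive p t (T t x)).
  { intros t. apply (is_derive_primitive (fun s => T s x)). apply HSc. }
  assert (Heq : forall t, 0 <= t -> S t (p h) = minus (p (h + t)) (p t)).
  { intros t Ht. unfold p at 1.
    rewrite (linear_RInt (S t) (fun s => T s x) (semigroup_linear t Ht)); [|apply HSc].
    rewrite (RInt_ext (V := E) _ (fun s => T (s + t) x)).
    - rewrite (RInt_derive_eq (fun s => p (s + t)) (fun s => T (s + t) x)).
      + now rewrite Rplus_0_l.
      + intros s. apply (is_derive_shift p). apply Hd.
      + intros s. apply (continuous_comp (fun s => s + t) (fun s => T s x)).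
        * apply continuous_shift.
        * apply HSc.
    - intros s Hs. rewrite Rmin_left, Rmax_right in Hs by lra.
      unfold T. rewrite !right_extension_pos by lra.
      rewrite Rplus_comm, (semigroup_plus S HS); [reflexivity|lra|lra]. }
  assert (Hder : is_derive (fun t => minus (p (t + h)) (p t)) 0 (minus (S h x) x)).
  { apply (is_derive_eq _ _ (minus (T h x) (T 0 x))).
    - apply (is_derive_minus (V := nm E)); [|apply Hd].
      apply (is_derive_shift p). rewrite Rplus_0_l. apply Hd.
    - unfold T. rewrite !right_extension_pos by lra. now rewrite (semigroup_zero S HS). }
  intros eps He. destruct (proj1 (is_derive_iff _ _ _) Hder eps He) as (d & Hd0 & H).
  exists d. split; [exact Hd0|]. intros t Ht. specialize (H t).
  rewrite Rminus_0_r, Rabs_pos_eq, Rplus_0_l in H by lra.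
  change (norm (minus (minus (S t (p h)) (p h)) (scal t (minus (S h x) x))) <= eps * t).
  rewrite Heq by lra.
  apply (norm_le_eq _ (minus (minus (minus (p (t + h)) (p t)) (minus (p h) (p 0)))
    (scal t (minus (S h x) x)))); [|apply H; lra].
  replace (p 0) with (zero : nm E) by (symmetry; apply (RInt_0_0 (fun s => T s x))).
  rewrite (Rplus_comm h t). vec (nm E).
Qed.

Lemma right_generates_scal (a : R) (x y : nm E) :
  right_generates S x y -> right_generates S (scal a x) (scal a y).
Proof.
  intros H eps He. destruct (H (eps / (Rabs a + 1))) as (d & Hd & H').
  { apply Rdiv_lt_0_compat; [lra|]. generalize (Rabs_pos a). lra. }
  exists d. split; [exact Hd|]. intros h Hh. specialize (H' h Hh).
  apply (norm_le_eq _ (scal a (minus (minus (S h x) x) (scal h y)))).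
  - rewrite (linear_scal _ (semigroup_linear h (Rlt_le _ _ (proj1 Hh)))). vec (nm E).
  - rewrite norm_scal_R.
    apply Rle_trans with (Rabs a * (eps / (Rabs a + 1) * h)).
    + apply Rmult_le_compat_l; [apply Rabs_pos|exact H'].
    + generalize (Rabs_pos a). intros Ha.
      replace (Rabs a * (eps / (Rabs a + 1) * h)) with (eps * h * (Rabs a / (Rabs a + 1)))
        by (field; lra).
      rewrite <- (Rmult_1_r (eps * h)) at 2. apply Rmult_le_compat_l.
      * apply Rmult_le_pos; lra.
      * apply Rmult_le_reg_r with (Rabs a + 1); [lra|].
        replace (Rabs a / (Rabs a + 1) * (Rabs a + 1)) with (Rabs a) by (field; lra). lra.
Qed.

Lemma right_generates_dense (x : nm E) (eps : R) :
  0 < eps -> exists x' y', right_generates S x' y' /\ norm (minus x x') < eps.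
Proof.
  intros He. set (p := fun t => RInt (V := E) (fun s => right_extension S s x) 0 t : nm E).
  assert (Hd : is_derive p 0 (right_extension S 0 x)).
  { apply (is_derive_primitive (fun s => right_extension S s x)). apply HSc. }
  rewrite right_extension_pos, (semigroup_zero S HS) in Hd by lra.
  destruct (proj1 (is_derive_iff _ 0 x) Hd (eps / 2)) as (d & Hd0 & H); [lra|].
  set (h := d / 2). specialize (H h).
  assert (Hh : 0 < h) by (unfold h; lra).
  rewrite Rminus_0_r, Rabs_pos_eq in H by (unfold h; lra).
  exists (scal (/ h) (p h)), (scal (/ h) (minus (S h x) x)).
  split; [apply right_generates_scal, right_generates_integral; lra|].
  rewrite norm_minus_sym.
  apply (norm_lt_eq _ (scal (/ h) (minus (minus (p h) (p 0)) (scal h x)))).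
  - replace (p 0) with (zero : nm E)
      by (symmetry; apply (RInt_0_0 (fun s => right_extension S s x))).
    vec (nm E).
  - rewrite norm_scal_R, Rabs_pos_eq by (left; now apply Rinv_0_lt_compat).
    apply Rle_lt_trans with (/ h * (eps / 2 * h)).
    + apply Rmult_le_compat_l; [left; now apply Rinv_0_lt_compat|]. apply H. unfold h; lra.
    + replace (/ h * (eps / 2 * h)) with (eps / 2) by (field; lra). lra.
Qed.

End Semigroup.

(* A semigroup [S] and a semigroup [S'] generated by the opposite operator are
   inverse to each other: [S t (S' t x)] has right derivative [0]. *)
Lemma opposite_semigroups_inverse {E : rbanach} (S S' : R -> nm E -> nm E) :
  semigroup S -> semigroup S' ->
  (forall x y, right_generates S' x y -> right_generates S x (opp y)) ->
  forall t x, 0 <= t -> S t (S' t x) = x.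
Proof.
  intros HS HS' Hg t x Ht. revert x.
  apply (eq_on_dense (fun x => S t (S' t x)) (fun x => x) (fun x => exists y, right_generates S' x y)).
  - apply (is_linear_comp (S' t) (S t)); now apply semigroup_linear.
  - apply is_linear_id.
  - intros x eps He. destruct (right_generates_dense S' HS' x eps He) as (x' & y' & H & Hn).
    exists x'. split; [now exists y'|exact Hn].
  - intros x [y Hxy].
    set (f := fun s => S s (S' s x)).
    assert (Hc : strongly_continuous (fun s x => right_extension S s (right_extension S' s x))).
    { apply sc_comp; [apply (semigroup_sc S HS)|apply (semigroup_sc S' HS')]. }
    transitivity (f 0).
    2:{ unfold f. now rewrite (semigroup_zero S HS), (semigroup_zero S' HS'). }
    apply (right_derivative_zero_constant f 0 t Ht).
    + intros s Hs eps He.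
      destruct (proj1 (continuous_R_iff _ s) (sc_continuous _ Hc x s) eps He) as (d & Hd & H).
      exists d. split; [exact Hd|]. intros r Hr Hrs. specialize (H r Hrs).
      now rewrite !right_extension_pos in H by lra.
    + intros s Hs eps He.
      assert (Hq := right_generates_invariant S' HS' x y s (proj1 Hs) Hxy).
      set (q := S' s x) in *. set (q' := S' s y) in *.
      assert (Hq2 := Hg _ _ Hq).
      assert (HSs := semigroup_linear S HS s (proj1 Hs)).
      destruct (linear_norm _ HSs) as (M & HM & HSM).
      destruct (sc_locally_bounded _ (semigroup_sc S HS) 0) as (m & Hm & HSm).
      (* [M] bounds S s and [m] bounds S h for small h; the three remainders below add up to M (m +
         2) e h = eps h. *)
      set (e := eps / (M * (m + 2))).
      assert (He0 : 0 < e).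
      { apply Rdiv_lt_0_compat; [lra|]. apply Rmult_lt_0_compat; lra. }
      destruct (Hq e He0) as (d1 & Hd1 & H1).
      destruct (Hq2 e He0) as (d2 & Hd2 & H2).
      destruct (proj1 (continuous_R_iff _ 0) (sc_continuous _ (semigroup_sc S HS) q' 0) e He0)
        as (d3 & Hd3 & H3).
      exists (Rmin 1 (Rmin d1 (Rmin d2 d3))). split; [repeat apply Rmin_glb_lt; lra|].
      intros h Hh.
      assert (Hh1 : h < 1 /\ h < d1 /\ h < d2 /\ h < d3).
      { generalize (Rmin_l 1 (Rmin d1 (Rmin d2 d3))) (Rmin_r 1 (Rmin d1 (Rmin d2 d3)))
          (Rmin_l d1 (Rmin d2 d3)) (Rmin_r d1 (Rmin d2 d3)) (Rmin_l d2 d3) (Rmin_r d2 d3). lra. }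
      specialize (H1 h). specialize (H2 h). specialize (H3 h).
      specialize (HSm h). rewrite Rminus_0_r, Rabs_pos_eq in HSm by lra.
      rewrite Rminus_0_r, Rabs_pos_eq in H3 by lra.
      rewrite right_extension_pos in HSm by lra.
      rewrite !right_extension_pos, (semigroup_zero S HS) in H3 by lra.
      assert (HSh := semigroup_linear S HS h (Rlt_le _ _ (proj1 Hh))).
      (* S h (S' h q) - q is split into the remainder of S' under S h, the remainder of S with
         derivative - q', and h (S h q' - q'); the first-order terms cancel. *)
      apply (norm_le_eq _ (S s (plus (plus (S h (minus (minus (S' h q) q) (scal h q')))
        (minus (minus (S h q) q) (scal h (opp q')))) (scal h (minus (S h q') q'))))).
      { unfold f. rewrite (semigroup_plus S HS) by lra.
        rewrite (Rplus_comm s h), (semigroup_plus S' HS') by lra. fold q.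
        rewrite <- (linear_minus _ _ _ HSs). f_equal.
        rewrite !(linear_minus _ _ _ HSh), (linear_scal _ HSh). vec (nm E). }
      eapply Rle_trans; [apply HSM|].
      assert (Ha : norm (S h (minus (minus (S' h q) q) (scal h q'))) <= m * (e * h)).
      { eapply Rle_trans; [apply HSm; lra|]. apply Rmult_le_compat_l; [lra|]. apply H1; lra. }
      assert (Hb : norm (minus (minus (S h q) q) (scal h (opp q'))) <= e * h) by (apply H2; lra).
      assert (Hc' : norm (scal h (minus (S h q') q')) <= h * e).
      { rewrite norm_scal_R, Rabs_pos_eq by lra. apply Rmult_le_compat_l; [lra|]. left. apply H3; lra. }
      apply Rle_trans with (M * (m * (e * h) + e * h + h * e)).
      * apply Rmult_le_compat_l; [lra|].
        apply norm_plus_le; [|exact Hc']. now apply norm_plus_le.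
      * apply Req_le. unfold e. field. split; lra.
Qed.

Lemma semigroup_conjugate {E : rbanach} (S : R -> nm E -> nm E) (J : nm E -> nm E) :
  semigroup S -> is_linear J -> (forall x, J (J x) = x) ->
  semigroup (fun t x => J (S t (J x))).
Proof.
  intros HS HJ HJJ. split.
  - apply (sc_comp (fun _ => J) (fun t x => right_extension S t (J x))); [now apply sc_const|].
    apply (sc_comp (right_extension S) (fun _ => J)); [apply HS|now apply sc_const].
  - intros x. now rewrite (semigroup_zero S HS).
  - intros t s x Ht Hs. now rewrite HJJ, (semigroup_plus S HS).
Qed.

Lemma right_generates_conjugate {E : rbanach} (S : R -> nm E -> nm E) (J : nm E -> nm E) (x y : nm E) :
  is_linear J -> (forall x, J (J x) = x) ->
  right_generates (fun t x => J (S t (J x))) x y -> right_generates S (J x) (J y).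
Proof.
  intros HJ HJJ H eps He. destruct (linear_norm _ HJ) as (M & HM & HJM).
  destruct (H (eps / M)) as (d & Hd & H'); [now apply Rdiv_lt_0_compat|].
  exists d. split; [exact Hd|]. intros h Hh. specialize (H' h Hh).
  apply (norm_le_eq _ (J (minus (minus (J (S h (J x))) x) (scal h y)))).
  - now rewrite !(linear_minus _ _ _ HJ), (linear_scal _ HJ), HJJ.
  - eapply Rle_trans; [apply HJM|].
    replace (eps * h) with (M * (eps / M * h)) by (field; lra).
    apply Rmult_le_compat_l; lra.
Qed.

(** The involution [J] carries the generator to its opposite, so J S J is the semigroup of the
    opposite generator and is inverse to [S]; it provides the negative times. *)
Lemma semigroup_extends_to_group {E : rbanach} (S : R -> nm E -> nm E) (J : nm E -> nm E) :
  semigroup S -> is_linear J -> (forall x, J (J x) = x) ->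
  (forall x y, right_generates S x y -> right_generates S (J x) (opp (J y))) ->
  exists U, c0_group U /\ forall x y, generates U x y <-> right_generates S x y.
Proof.
  intros HS HJ HJJ Hg.
  set (S' := fun t x => J (S t (J x))).
  assert (HS' : semigroup S') by now apply semigroup_conjugate.
  assert (Hinv : forall t x, 0 <= t -> S t (S' t x) = x).
  { apply opposite_semigroups_inverse; auto. intros x y H.
    apply right_generates_conjugate in H; auto. apply Hg in H. now rewrite !HJJ in H. }
  assert (Hinv' : forall t x, 0 <= t -> S' t (S t x) = x).
  { intros t x Ht. unfold S'. rewrite <- (HJJ (S t x)).
    rewrite <- (HJJ x) at 1. rewrite (HJJ (S t (J (J x)))).
    change (J (S t (S' t (J x))) = x). now rewrite Hinv, HJJ. }
  (* Insert x = S b (S' b x) and exchange a and b in S (a + b). *)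
  assert (Hcomm : forall a b x, 0 <= a -> 0 <= b -> S' b (S a x) = S a (S' b x)).
  { intros a b x Ha Hb. rewrite <- (Hinv b x Hb) at 1.
    rewrite <- (semigroup_plus S HS), Rplus_comm, (semigroup_plus S HS) by lra.
    now rewrite Hinv'. }
  (* One factor is always the identity, frozen by [right_extension] at time 0. *)
  set (U := fun t x => right_extension S t (right_extension S' (- t) x)).
  (* A formula common to both signs of t when |t| <= r; with it the group law involves nonnegative
     times only. *)
  assert (HUr : forall r t x, Rabs t <= r -> U t x = S (t + r) (S' r x)).
  { intros r t x Hr. unfold U. destruct (Rle_lt_dec 0 t) as [Ht|Ht].
    - rewrite right_extension_pos by lra. unfold right_extension. rewrite Rmax_left by lra.
      rewrite (semigroup_zero S' HS'), (semigroup_plus S HS).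
      + rewrite Hinv; [reflexivity|]. generalize (Rabs_pos t). lra.
      + lra.
      + generalize (Rabs_pos t). lra.
    - rewrite Rabs_left in Hr by lra.
      rewrite (right_extension_pos S' (- t)) by lra. unfold right_extension.
      rewrite Rmax_left, (semigroup_zero S HS) by lra.
      replace r with ((t + r) + - t) at 2 by ring.
      rewrite (semigroup_plus S' HS') by lra. rewrite Hinv; [reflexivity|lra]. }
  assert (HU : c0_group U).
  { split.
    - apply (sc_comp (right_extension S) (fun t => right_extension S' (- t))); [apply HS|].
      apply (sc_reparam (right_extension S') (fun t => - t)); [|apply HS'].
      intros s. apply continuous_neg.
    - intros x. rewrite (HUr 0) by (rewrite Rabs_R0; lra).
      rewrite Rplus_0_l, (semigroup_zero S HS). apply (semigroup_zero S' HS').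
    - intros t s x. set (r := Rabs t + Rabs s).
      assert (Hr : Rabs t <= r /\ Rabs s <= r /\ Rabs (t + s) <= r + r).
      { unfold r. generalize (Rabs_pos t) (Rabs_pos s) (Rabs_triang t s). lra. }
      assert (Htr : 0 <= t + r /\ 0 <= s + r /\ 0 <= r).
      { generalize (Rle_abs (- t)) (Rle_abs (- s)) (Rabs_pos t). rewrite !Rabs_Ropp. lra. }
      rewrite (HUr (r + r) (t + s)), (HUr r t), (HUr r s) by lra.
      replace (t + s + (r + r)) with (t + r + (s + r)) by ring.
      rewrite (semigroup_plus S HS), (semigroup_plus S' HS') by lra.
      now rewrite Hcomm by lra. }
  assert (HUpos : forall t x, 0 <= t -> U t x = S t x).
  { intros t x Ht. unfold U. rewrite right_extension_pos by lra. f_equal.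
    unfold right_extension. rewrite Rmax_left by lra. apply (semigroup_zero S' HS'). }
  exists U. split; [exact HU|]. intros x y. split.
  - intros H eps He. destruct (proj1 (is_derive_iff _ _ _) H eps He) as (d & Hd & H').
    exists d. split; [exact Hd|]. intros h Hh. specialize (H' h).
    rewrite Rminus_0_r, Rabs_pos_eq, (group_zero U HU), HUpos in H' by lra. apply H'. lra.
  - intros H. apply right_derivative_generates; [exact HU|]. intros eps He.
    destruct (H eps He) as (d & Hd & H'). exists d. split; [exact Hd|].
    intros h Hh. rewrite HUpos by lra. now apply H'.
Qed.

(** * Real and complex scalars *)

Notation re E := (CompleteNormedModule.NormedModule R_AbsRing (realify E)) (only parsing).

Section Realification.

Context {k : scalar_field}.

Lemma realify_linear {E F : banach k} (L : E -> F) :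
  is_linear L -> is_linear (L : re E -> re F).
Proof.
  intros HL. apply Build_is_linear.
  - apply (linear_plus _ HL).
  - intros a x. apply (linear_scal _ HL (of_real k a) x).
  - apply (linear_norm _ HL).
Qed.

Lemma realify_scal_linear {E : banach k} (a : k) :
  is_linear ((fun x : E => scal a x) : re E -> re E).
Proof.
  apply (Build_is_linear (fun x : re E => scal a (x : E) : re E)).
  - intros x y. apply (scal_distr_l a (x : E) y).
  - intros r x. change (scal a (scal (of_real k r) (x : E)) = scal (of_real k r) (scal a (x : E))).
    rewrite !scal_assoc. f_equal. destruct k; [apply Rmult_comm|apply Cmult_comm].
  - exists (abs a + 1). split.
    + generalize (abs_ge_0 a). lra.
    + intros x. apply Rle_trans with (abs a * norm (x : E)).
      * apply (norm_scal a (x : E)).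
      * apply Rmult_le_compat_r; [apply (norm_ge_0 (x : E))|lra].
Qed.

Lemma linear_of_real_linear {E F : banach k} (L : E -> F) :
  is_linear (L : re E -> re F) -> (forall a x, L (scal a x) = scal a (L x)) -> is_linear L.
Proof.
  intros HL Hs. apply Build_is_linear.
  - apply (linear_plus _ HL).
  - exact Hs.
  - apply (linear_norm _ HL).
Qed.

Context {E : banach k}.

Lemma c0_semigroup_real (S : R -> E -> E) :
  is_c0_semigroup S -> semigroup (S : R -> re E -> re E).
Proof.
  intros HS. split; [split|..].
  - intros t. apply realify_linear, (c0_bounded S HS). apply Rmax_l.
  - intros x t. apply continuous_R_iff. intros eps He.
    assert (H := c0_continuous S HS x (Rmax 0 t) (Rmax_l 0 t)).
    assert (H1 := proj1 (filterlim_norm_iff (within (fun s => 0 <= s) (locally (Rmax 0 t)))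
      (fun s => S s x) (S (Rmax 0 t) x)) H eps He).
    unfold within in H1. apply locally_R_iff in H1. destruct H1 as (d & Hd & H1).
    exists d. split; [exact Hd|]. intros s Hs. apply H1; [|apply Rmax_l].
    (* [Rmax 0] is Lipschitz with constant 1. *)
    eapply Rle_lt_trans; [|exact Hs].
    unfold Rmax. destruct (Rle_dec 0 s), (Rle_dec 0 t); unfold Rabs;
      repeat destruct (Rcase_abs _); lra.
  - apply (c0_zero S HS).
  - intros t s x Ht Hs. now apply (c0_plus S HS).
Qed.

Lemma quotient_limit_iff (S : R -> E -> E) (x y : E) :
  filterlim (fun h : R => scal (of_real k (/ h)) (minus (S h x) x)) (at_right 0) (locally y)
  <-> right_generates (S : R -> re E -> re E) x y.
Proof.
  etransitivity; [apply (filterlim_norm_iff (at_right 0)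
    (fun h : R => scal (of_real k (/ h)) (minus (S h x) x)) y)|].
  assert (Hq : forall h, 0 < h ->
    norm (minus (scal (of_real k (/ h)) (minus (S h x) x)) y)
    = / h * norm (minus (minus (S h x : re E) x) (scal h (y : re E)))).
  { intros h Hh. rewrite <- (Rabs_pos_eq (/ h)) at 2 by (left; now apply Rinv_0_lt_compat).
    rewrite <- (norm_scal_R (/ h)).
    change (norm (minus (scal (/ h) (minus (S h x : re E) x)) (y : re E))
      = norm (scal (/ h) (minus (minus (S h x : re E) x) (scal h (y : re E))))).
    f_equal. vec (re E). }
  split; intros H eps He.
  - destruct (proj1 (at_right_0_iff _) (H eps He)) as (d & Hd & H').
    exists d. split; [exact Hd|]. intros h Hh. specialize (H' h Hh).
    rewrite Hq in H' by lra. left.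
    apply (Rmult_lt_compat_l h) in H'; [|lra].
    rewrite <- Rmult_assoc, Rinv_r, Rmult_1_l, Rmult_comm in H' by lra. exact H'.
  - destruct (H (eps / 2)) as (d & Hd & H'); [lra|].
    apply at_right_0_iff. exists d. split; [exact Hd|]. intros h Hh. specialize (H' h Hh).
    rewrite Hq by lra.
    apply Rle_lt_trans with (/ h * (eps / 2 * h)).
    + apply Rmult_le_compat_l; [left; apply Rinv_0_lt_compat; lra|exact H'].
    + replace (/ h * (eps / 2 * h)) with (eps / 2) by (field; lra). lra.
Qed.

Definition generates_group (T : operator E E) (U : R -> re E -> re E) : Prop :=
  c0_group U /\ forall x y, generates U x y <-> (dom T x /\ T x = y).

Lemma group_of_reversible (T : operator E E) (J : E -> E) :
  generates_c0_semigroup T -> is_linear J -> (forall x, J (J x) = x) ->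
  (forall x, dom T x -> dom T (J x) /\ T (J x) = opp (J (T x))) ->
  exists U, generates_group T U.
Proof.
  intros (S & HS & HG) HJ HJJ HJT.
  destruct (semigroup_extends_to_group (S : R -> re E -> re E) J) as (U & HU & HgU).
  - now apply c0_semigroup_real.
  - now apply realify_linear.
  - exact HJJ.
  - intros x y H. apply quotient_limit_iff, HG. apply quotient_limit_iff, HG in H.
    destruct H as [Hx <-]. now apply HJT.
  - exists U. split; [exact HU|]. intros x y. rewrite HgU.
    etransitivity; [symmetry; apply quotient_limit_iff|]. symmetry. apply HG.
Qed.

(** Multiplication by [a] is a bounded real operator preserving the graph of [T], so it commutes
    with the group. This restores linearity over the original scalars. *)
Lemma group_scal (T : operator E E) (U : R -> re E -> re E) :
  linear_operator T -> generates_group T U ->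
  forall t (a : k) x, U t (scal a (x : E)) = scal a (U t x : E).
Proof.
  intros HT [HU HG] t a x. symmetry.
  apply (group_intertwine U U (fun x : re E => scal a (x : E) : re E) HU HU).
  - apply realify_scal_linear.
  - intros z w H. apply HG in H. apply HG. destruct H as [Hz <-]. split.
    + now apply (dom_scal T HT).
    + now apply (app_scal T HT).
Qed.

Lemma group_c0_semigroup (T : operator E E) (U : R -> re E -> re E) :
  linear_operator T -> generates_group T U -> generates_c0_semigroup T.
Proof.
  intros HT HUT. destruct (HUT) as [HU HG]. exists U. split; [split|].
  - intros t _. apply linear_of_real_linear; [apply (group_sc U HU)|].
    intros a x. now apply (group_scal T).
  - apply (group_zero U HU).
  - intros t s _ _ x. apply (group_plus U HU).
  - intros x t _. eapply filterlim_filter_le_1; [|apply (sc_continuous U (group_sc U HU) x t)].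
    apply filter_le_within.
  - intros x y. etransitivity; [symmetry; apply HG|].
    etransitivity; [|symmetry; apply quotient_limit_iff].
    split.
    + intros H eps He. destruct (proj1 (is_derive_iff _ _ _) H eps He) as (d & Hd & H').
      exists d. split; [exact Hd|]. intros h Hh. specialize (H' h).
      rewrite Rminus_0_r, Rabs_pos_eq, (group_zero U HU) in H' by lra. apply H'. lra.
    + now apply right_derivative_generates.
Qed.

End Realification.

(** * Phase groups *)

Lemma norm_pair_le {K : AbsRing} {F E : CompleteNormedModule K} (v : F) (e : E) :
  norm ((v, e) : F \x E) <= norm v + norm e.
Proof.
  change (sqrt (norm v ^ 2 + norm e ^ 2) <= norm v + norm e).
  generalize (norm_ge_0 v) (norm_ge_0 e). intros Hv He.
  rewrite <- (sqrt_pow2 (norm v + norm e)) by lra.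
  apply sqrt_le_1_alt. nra.
Qed.

Lemma norm_pair_zero_le {K : AbsRing} {F E : CompleteNormedModule K} (e : E) :
  norm ((zero, e) : F \x E) <= norm e.
Proof.
  eapply Rle_trans; [apply (norm_pair_le (zero : F) e)|].
  replace (norm (zero : F)) with 0 by (symmetry; exact (norm_zero (V := nm F))). lra.
Qed.

Lemma norm_pair_zero_r_le {K : AbsRing} {F E : CompleteNormedModule K} (v : F) :
  norm ((v, zero) : F \x E) <= norm v.
Proof.
  eapply Rle_trans; [apply (norm_pair_le v (zero : E))|].
  replace (norm (zero : E)) with 0 by (symmetry; exact (norm_zero (V := nm E))). lra.
Qed.

Lemma norm_fst_le {K : AbsRing} {F E : CompleteNormedModule K} (p : F \x E) :
  norm (fst p) <= norm p.
Proof. apply (norm_le_prod_norm_1 (U := F) (V := E)). Qed.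

Lemma norm_snd_le {K : AbsRing} {F E : CompleteNormedModule K} (p : F \x E) :
  norm (snd p) <= norm p.
Proof. apply (norm_le_prod_norm_2 (U := F) (V := E)). Qed.

Lemma tends_pair {K : AbsRing} {F E : CompleteNormedModule K} (u : nat -> F) (w : nat -> E) v e :
  tends u v -> tends w e -> tends (fun n => (u n, w n) : F \x E) ((v, e) : F \x E).
Proof.
  intros Hu Hw. apply tends_iff. intros eps He.
  destruct (proj1 (tends_iff u v) Hu (eps / 2)) as [N1 H1]; [lra|].
  destruct (proj1 (tends_iff w e) Hw (eps / 2)) as [N2 H2]; [lra|].
  exists (max N1 N2). intros n Hn.
  eapply Rle_lt_trans; [apply (norm_pair_le (minus (u n) v) (minus (w n) e))|].
  specialize (H1 n). specialize (H2 n).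
  assert (norm (minus (u n) v) < eps / 2) by (apply H1; lia).
  assert (norm (minus (w n) e) < eps / 2) by (apply H2; lia).
  lra.
Qed.

Lemma operator_zero {k : scalar_field} {E : banach k} (T : operator E E) :
  linear_operator T -> T zero = zero.
Proof.
  intros HT. assert (H := app_scal T HT zero zero (dom_zero T HT)).
  assert (Hz : forall x : E, scal (zero : k) x = zero) by (intros x; exact (scal_zero_l x)).
  now rewrite !Hz in H.
Qed.

Definition sequentially_closed {k : scalar_field} {E : banach k} (T : operator E E) : Prop :=
  forall u x y, (forall n, dom T (u n)) -> tends u x -> tends (fun n => T (u n)) y ->
    dom T x /\ T x = y.

Lemma closed_sequentially_closed {k : scalar_field} {E : banach k} (T : operator E E) :
  closed_operator T -> sequentially_closed T.
Proof.
  intros [_ HT] u x y Hu Hx Hy. apply (HT (x, y)). intros Hno.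
  assert (Hl := tends_pair u (fun n => T (u n)) x y Hx Hy).
  specialize (Hl _ Hno). destruct Hl as [N HN].
  apply (HN N (le_n N)). simpl. auto.
Qed.

Definition perturbed {k : scalar_field} {E : banach k} (T : operator E E) (B : E -> E) :
  operator E E := Operator (dom T) (fun x => plus (T x) (B x)).

Section Phase.

Context {k : scalar_field} {E F : banach k}.

(** The graph of the phase matrix in components, over the reals. The preimage of e under [j] appears
    as an unknown v' with j v' = e, which avoids [iota]. *)
Definition phase_group (T : operator E E) (j : F -> E)
  (U : R -> re (F \x E) -> re (F \x E)) : Prop :=
  c0_group U /\ forall v e v' e',
    generates U ((v, e) : re (F \x E)) ((v', e') : re (F \x E)) <->
    dom T (j v) /\ j v' = e /\ T (j v) = e'.

Lemma phase_group_ext (T T' : operator E E) (j : F -> E) U :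
  (forall x, dom T x <-> dom T' x) -> (forall x, dom T x -> T x = T' x) ->
  phase_group T j U -> phase_group T' j U.
Proof.
  intros Hd HT [HU HG]. split; [exact HU|]. intros v e v' e'. rewrite HG.
  split; intros (H1 & H2 & H3).
  - split; [now apply Hd|]. split; [exact H2|]. now rewrite <- HT.
  - split; [now apply Hd|]. split; [exact H2|]. rewrite HT; [exact H3|now apply Hd].
Qed.

Section PhaseMatrix.

Variables (T : operator E E) (j : F -> E).

Hypothesis HT : linear_operator T.
Hypothesis Hj : continuous_embedding j.

Let Hjl := proj1 Hj.
Let Hji := proj2 Hj.

Let Hj0 : j zero = zero := linear_zero _ Hjl.

(** Injectivity of [j] makes the preimage unique, hence equal to the one picked by [iota]. *)
Lemma phase_matrix_graph (v : F) (e : E) (q : F \x E) :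
  (dom (phase_matrix T j) (v, e) /\ phase_matrix T j (v, e) = q) <->
  (dom T (j v) /\ j (fst q) = e /\ T (j v) = snd q).
Proof.
  simpl. split.
  - intros [[Hv [w Hw]] <-]. simpl. repeat split; auto.
    apply (iota_correct (fun v => j v = e)). exists w. split; [exact Hw|].
    intros w' Hw'. apply Hji. congruence.
  - intros (Hv & Hw & Hq). split; [split; [exact Hv|now exists (fst q)]|].
    destruct q as [q1 q2]. simpl in *. f_equal; [|exact Hq].
    apply (iota_unique (fun v => j v = e)); [|exact Hw].
    intros w' Hw'. apply Hji. congruence.
Qed.

Lemma phase_matrix_linear : linear_operator (phase_matrix T j).
Proof.
  (* The first component of the value is known only through [j]; identities in that component are
     checked after applying [j]. *)
  assert (Hval : forall p, dom (phase_matrix T j) p ->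
    j (fst (phase_matrix T j p)) = snd p).
  { intros [v e] Hp. now apply (phase_matrix_graph v e). }
  assert (Hplus : forall x y, dom (phase_matrix T j) x -> dom (phase_matrix T j) y ->
    dom (phase_matrix T j) (plus x y)).
  { intros [v e] [v' e'] [H1 [w H2]] [H3 [w' H4]]. simpl in *. split.
    - rewrite (linear_plus _ Hjl). now apply (dom_plus T HT).
    - exists (plus w w'). now rewrite (linear_plus _ Hjl), H2, H4. }
  assert (Hscal : forall (a : k) x, dom (phase_matrix T j) x ->
    dom (phase_matrix T j) (scal a x)).
  { intros a [v e] [H1 [w H2]]. simpl in *. split.
    - rewrite (linear_scal _ Hjl). now apply (dom_scal T HT).
    - exists (scal a w). now rewrite (linear_scal _ Hjl), H2. }
  split.
  - simpl. split.
    + change (dom T (j (zero : F))).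
      rewrite Hj0.
      apply (dom_zero T HT).
    + exists zero. apply (linear_zero _ Hjl).
  - exact Hplus.
  - exact Hscal.
  - intros x y Hx Hy. assert (Hxy := Hplus x y Hx Hy).
    apply injective_projections.
    + apply Hji. rewrite (Hval _ Hxy).
      transitivity (plus (j (fst (phase_matrix T j x))) (j (fst (phase_matrix T j y)))).
      * now rewrite (Hval x Hx), (Hval y Hy).
      * symmetry. apply (linear_plus _ Hjl).
    + simpl. rewrite (linear_plus _ Hjl). apply (app_plus T HT); [apply Hx|apply Hy].
  - intros a x Hx. assert (Hax := Hscal a x Hx).
    apply injective_projections.
    + apply Hji. rewrite (Hval _ Hax).
      transitivity (scal a (j (fst (phase_matrix T j x)))).
      * now rewrite (Hval x Hx).
      * symmetry. apply (linear_scal _ Hjl).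
    + simpl. rewrite (linear_scal _ Hjl). apply (app_scal T HT). apply Hx.
Qed.

Definition reflection (p : F \x E) : F \x E := (fst p, opp (snd p)).

Lemma reflection_linear : is_linear reflection.
Proof.
  apply Build_is_linear.
  - intros [v e] [v' e']. unfold reflection.
    apply injective_projections; simpl; [reflexivity|]. exact (opp_plus e e').
  - intros a [v e]. apply injective_projections; simpl; [reflexivity|].
    symmetry. exact (scal_opp_r a e).
  - exists 2. split; [lra|]. intros [v e].
    eapply Rle_trans; [apply (norm_pair_le v (opp e))|].
    replace (norm (opp e)) with (norm e) by (symmetry; exact (norm_opp e)).
    generalize (norm_fst_le ((v, e) : F \x E)) (norm_snd_le ((v, e) : F \x E)). simpl. lra.
Qed.

Lemma reflection_involutive (p : F \x E) : reflection (reflection p) = p.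
Proof. destruct p as [v e]. unfold reflection. simpl. f_equal. exact (opp_opp e). Qed.

Lemma phase_group_iff :
  generates_c0_semigroup (phase_matrix T j) <-> exists U, phase_group T j U.
Proof.
  split.
  - intros H.
    destruct (group_of_reversible (phase_matrix T j) reflection H) as (U & HU & HG).
    + apply reflection_linear.
    + apply reflection_involutive.
    + intros [v e] Hp.
      assert (Hq := proj1 (phase_matrix_graph v e _) (conj Hp eq_refl)).
      apply (phase_matrix_graph v (opp e)). destruct Hq as (H1 & H2 & H3).
      split; [exact H1|]. split.
      * change (j (opp (fst (phase_matrix T j (v, e)))) = opp e).
        rewrite (linear_opp _ _ Hjl). f_equal. exact H2.
      * rewrite H3. symmetry. exact (opp_opp _).
    + exists U. split; [exact HU|]. intros v e v' e'. rewrite HG.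
      apply (phase_matrix_graph v e (v', e')).
  - intros (U & HU & HG). apply (group_c0_semigroup _ U phase_matrix_linear).
    split; [exact HU|]. intros [v e] [v' e']. rewrite HG. symmetry.
    apply (phase_matrix_graph v e (v', e')).
Qed.

Variable U : R -> re (F \x E) -> re (F \x E).

Hypothesis HU : phase_group T j U.

Let HUg := proj1 HU.
Let HG := proj2 HU.

(** An intertwining: the reflection carries the generator to its opposite, which generates U (- t).
    Evenness of the cosine function comes from here. *)
Lemma phase_reflection (t : R) (p : F \x E) : reflection (U t p) = U (- t) (reflection p).
Proof.
  assert (HV : c0_group (fun t => U (- t))).
  { split.
    - apply (sc_reparam U (fun t => - t)); [|apply HUg].
      intros s. apply continuous_neg.
    - intros x. rewrite Ropp_0. apply (group_zero U HUg).
    - intros s r x. rewrite Ropp_plus_distr. apply (group_plus U HUg). }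
  apply (group_intertwine U (fun t => U (- t)) (reflection : re (F \x E) -> re (F \x E)) HUg HV).
  - apply realify_linear, reflection_linear.
  - intros [v e] [v' e'] H. apply HG in H. destruct H as (H1 & H2 & H3).
    unfold generates. apply (is_derive_ext (fun t => U (0 - t) (reflection (v, e)))).
    { intros s. f_equal. unfold Rminus. apply Rplus_0_l. }
    apply (is_derive_eq _ _ (opp ((opp v', e') : re (F \x E)))).
    + apply (is_derive_reflect (fun t => U t (reflection (v, e)))).
      rewrite Rminus_0_r. apply (HG v (opp e) (opp v') e'). split; [exact H1|]. split; [|exact H3].
      rewrite (linear_opp _ _ Hjl). now f_equal.
    + change ((opp (opp v'), opp e') = (v', opp e')). f_equal. exact (opp_opp v').
Qed.

Lemma phase_generates_sine (v : F) : dom T (j v) ->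
  generates U ((zero, j v) : re (F \x E)) ((v, zero) : re (F \x E)).
Proof.
  intros Hv. apply HG. rewrite Hj0.
  split; [apply (dom_zero T HT)|]. split; [reflexivity|].
  now apply operator_zero.
Qed.

Lemma phase_generates_cosine (v : F) : dom T (j v) ->
  generates U ((v, zero) : re (F \x E)) ((zero, T (j v)) : re (F \x E)).
Proof.
  intros Hv. apply HG. split; [exact Hv|]. split; [exact Hj0|reflexivity].
Qed.

Lemma pair_fst_linear : is_linear (fst : re (F \x E) -> re F).
Proof. apply realify_linear. apply (is_linear_fst (U := F) (V := E)). Qed.

Lemma pair_snd_linear : is_linear (snd : re (F \x E) -> re E).
Proof. apply realify_linear. apply (is_linear_snd (U := F) (V := E)). Qed.

(* [v] is the first component of [U 1 (0, j v) - int_0^1 int_0^s U r (0, T (j v)) dr ds]. *)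
Lemma phase_domain_embeds : (forall x, dom T x -> exists v, j v = x) -> domain_embeds T j.
Proof.
  intros Hsub.
  assert (HUsc := group_sc U HUg).
  assert (H1 := sc_integral U HUsc). assert (H2 := sc_integral _ H1).
  set (I1 := fun t p => RInt (V := realify (F \x E)) (fun s => U s p) 0 t) in *.
  set (I2 := fun t p => RInt (V := realify (F \x E)) (fun s => I1 s p) 0 t) in *.
  destruct (sc_bounded U HUsc 1) as (M & HM & HUM).
  destruct (linear_norm _ (sc_linear _ H2 1)) as (m & Hm & HIm).
  exists (M + m). intros x Hx. destruct (Hsub x Hx) as [v <-]. exists v. split; [reflexivity|].
  set (p := (zero, j v) : re (F \x E)). set (q := (v, zero) : re (F \x E)).
  set (r := (zero, T (j v)) : re (F \x E)).
  assert (Hpq : generates U p q) by now apply phase_generates_sine.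
  assert (Hqr : generates U q r) by now apply phase_generates_cosine.
  (* Taylor's formula at time 1 along (0, j v), (v, 0), (0, T (j v)): U 1 p = p + q + I2 1 r. *)
  assert (HI : I2 1 r = minus (minus (U 1 p) q) p).
  { transitivity (minus (minus (U 1 p) (scal 1 q)) (minus (U 0 p) (scal 0 q))).
    - apply (RInt_derive_eq (fun t => minus (U t p) (scal t q)) (fun t => I1 t r)).
      + intros t. apply (is_derive_eq _ _ (minus (U t q) (scal 1 q))).
        * apply (is_derive_minus (V := re (F \x E))).
          -- now apply (generates_derive U HUg).
          -- apply (is_derive_scal_l (K := R_AbsRing) (V := re (F \x E)) (fun t => t)).
             apply (is_derive_id (K := R_AbsRing)).
        * transitivity (minus (U t q) q); [vec (re (F \x E))|].
          symmetry. exact (proj1 (generates_iff_integral U HUg q r) Hqr t).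
      + intros t. apply H1.
    - rewrite (group_zero U HUg). vec (re (F \x E)). }
  assert (Hq : q = minus (minus (U 1 p) (I2 1 r)) p) by (rewrite HI; vec (re (F \x E))).
  assert (Hv : v = minus (fst (U 1 p)) (fst (I2 1 r))).
  { change v with (fst q). rewrite Hq at 1.
    change (minus (minus (fst (U 1 p)) (fst (I2 1 r))) zero
      = minus (fst (U 1 p)) (fst (I2 1 r)) :> re F). vec (re F). }
  apply (norm_le_eq (E := nm F) _ _ _ Hv). eapply Rle_trans;
    [apply (norm_minus_le (E := nm F) (fst (U 1 p)) (fst (I2 1 r)))|].
  assert (Hp1 : norm (U 1 p) <= M * norm (j v)).
  { eapply Rle_trans; [apply HUM; rewrite Rabs_R1; lra|].
    apply Rmult_le_compat_l; [lra|].
    apply norm_pair_zero_le. }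
  assert (Hr1 : norm (I2 1 r : re (F \x E)) <= m * norm (T (j v))).
  { eapply Rle_trans; [apply HIm|].
    apply Rmult_le_compat_l; [lra|].
    apply norm_pair_zero_le. }
  unfold graph_norm.
  generalize (norm_fst_le (U 1 p : F \x E)) (norm_fst_le (I2 1 r : F \x E))
    (norm_ge_0 (j v)) (norm_ge_0 (T (j v))).
  intros Ha Hb Hc Hd.
  apply Rle_trans with (M * norm (j v) + m * norm (T (j v))).
  - apply Rplus_le_compat; eapply Rle_trans; eassumption.
  - assert (0 <= M * norm (T (j v))) by (apply Rmult_le_pos; lra).
    assert (0 <= m * norm (j v)) by (apply Rmult_le_pos; lra).
    lra.
Qed.

(** The embedding bound makes the preimages in F of a graph-convergent sequence Cauchy, so
    closedness of the group generator applies in the phase space. This supplies closedness for the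
    operator matrix, for which only linearity is known beforehand. *)
Lemma phase_sequentially_closed : domain_embeds T j -> sequentially_closed T.
Proof.
  intros [M HM] u x y Hu Hx Hy.
  assert (Hv : forall n, exists v, j v = u n).
  { intros n. destruct (HM _ (Hu n)) as (v & Hv & _). now exists v. }
  set (v := fun n => proj1_sig (constructive_indefinite_description _ (Hv n))).
  assert (Hjv : forall n, j (v n) = u n).
  { intros n. exact (proj2_sig (constructive_indefinite_description _ (Hv n))). }
  assert (Hneg : forall z, dom T z -> dom T (opp z) /\ T (opp z) = opp (T z)).
  { intros z Hz.
    assert (Ho : forall z : E, opp z = scal (opp one) z)
      by (intros w; symmetry; exact (scal_opp_one w)).
    rewrite !Ho. split.
    - now apply (dom_scal T HT).
    - now apply (app_scal T HT). }
  assert (Hc : exists l, tends v l).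
  { apply cauchy_tends. intros eps He.
    set (e := eps / (4 * (Rabs M + 1))).
    assert (HM0 := Rabs_pos M).
    assert (He0 : 0 < e) by (apply Rdiv_lt_0_compat; lra).
    destruct (proj1 (tends_iff _ _) Hx e He0) as [N1 H1].
    destruct (proj1 (tends_iff _ _) Hy e He0) as [N2 H2].
    exists (max N1 N2). intros n m Hn Hm.
    assert (Hd : dom T (minus (u n) (u m))).
    { apply (dom_plus T HT); [apply Hu|]. now apply Hneg. }
    assert (HTd : T (minus (u n) (u m)) = minus (T (u n)) (T (u m))).
    { unfold minus. rewrite (app_plus T HT) by (try apply Hneg; apply Hu).
      f_equal. now apply Hneg. }
    destruct (HM _ Hd) as (w & Hw & Hwn).
    assert (Hwv : w = minus (v n) (v m)).
    { apply Hji. rewrite Hw, (linear_minus _ _ _ Hjl), !Hjv. reflexivity. }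
    apply (norm_lt_eq (E := nm F) _ w); [now symmetry|].
    eapply Rle_lt_trans; [exact Hwn|]. unfold graph_norm. rewrite HTd.
    assert (Ha : norm (minus (u n) (u m)) < 2 * e).
    { eapply Rle_lt_trans; [apply (norm_dist_le (E := nm E) _ x)|]. rewrite (norm_minus_sym (E := nm E) x).
      assert (norm (minus (u n : nm E) x) < e) by (apply H1; lia).
      assert (norm (minus (u m : nm E) x) < e) by (apply H1; lia). lra. }
    assert (Hb : norm (minus (T (u n)) (T (u m))) < 2 * e).
    { eapply Rle_lt_trans; [apply (norm_dist_le (E := nm E) _ y)|]. rewrite (norm_minus_sym (E := nm E) y).
      assert (norm (minus (T (u n) : nm E) y) < e) by (apply H2; lia).
      assert (norm (minus (T (u m) : nm E) y) < e) by (apply H2; lia). lra. }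
    set (s := norm (minus (u n) (u m)) + norm (minus (T (u n)) (T (u m)))).
    assert (Hs : 0 <= s < 4 * e).
    { unfold s. generalize (norm_ge_0 (minus (u n) (u m)))
        (norm_ge_0 (minus (T (u n)) (T (u m)))). lra. }
    apply Rle_lt_trans with ((Rabs M + 1) * s).
    - apply Rmult_le_compat_r; [lra|]. generalize (Rle_abs M). lra.
    - replace eps with ((Rabs M + 1) * (4 * e)) by (unfold e; field; lra).
      apply Rmult_lt_compat_l; lra. }
  destruct Hc as [l Hl].
  assert (Hjl' : j l = x).
  { apply (tends_unique (fun n => j (v n))).
    - now apply tends_linear.
    - apply (filterlim_ext u); [intros n; symmetry; apply Hjv|exact Hx]. }
  assert (H : generates U ((l, zero) : re (F \x E)) ((zero, y) : re (F \x E))).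
  { apply (generates_closed U HUg (fun n => (v n, zero)) (fun n => (zero, T (u n)))).
    - apply (tends_pair v (fun _ => zero)); [exact Hl|apply tends_const].
    - apply (tends_pair (fun _ => zero) (fun n => T (u n))); [apply tends_const|exact Hy].
    - intros n. rewrite <- (Hjv n). apply phase_generates_cosine. rewrite Hjv. apply Hu. }
  apply HG in H. rewrite Hjl' in H. tauto.
Qed.

End PhaseMatrix.

End Phase.

(** * From phase groups to cosine functions *)

(** A second derivative is required at 0 only: g s - (s^2 / 2) l has derivative g1 s - s l, which is
    at most (eps / 2) s for small s > 0, and integration gives the bound. *)
Lemma second_derivative_limit {E : rbanach} (g g1 : R -> nm E) (l : nm E) :
  (forall t, is_derive g t (g1 t)) -> (forall t, continuous g1 t) ->
  is_derive g1 0 l -> g 0 = zero -> g1 0 = zero ->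
  forall eps, 0 < eps -> exists d, 0 < d /\ forall h, 0 < h < d ->
    norm (minus (scal (2 / (h * h)) (g h)) l) <= eps.
Proof.
  intros Hg Hg1 Hl H0 H1 eps He.
  destruct (proj1 (is_derive_iff _ _ _) Hl (eps / 2)) as (d & Hd & H); [lra|].
  exists d. split; [exact Hd|]. intros h Hh.
  set (r := fun s => minus (g s) (scal (s * s / 2) l)).
  assert (Hr : forall s, is_derive r s (minus (g1 s) (scal s l))).
  { intros s. apply (is_derive_minus (V := nm E)); [apply Hg|].
    apply (is_derive_scal_l (K := R_AbsRing) (V := nm E) (fun s => s * s / 2)).
    apply (is_derive_ext (fun s => s * s / 2)); [easy|].
    evar_last; [auto_derive; [easy|reflexivity]|]. field. }
  assert (Hrc : forall s, continuous (fun s => minus (g1 s) (scal s l)) s).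
  { intros s. apply (continuous_minus (V := nm E)); [apply Hg1|].
    apply (continuous_scal (K := R_AbsRing) (V := nm E) (fun s => s) (fun _ => l));
      [apply continuous_id|apply continuous_const]. }
  assert (Hb : norm (r h) <= eps / 2 * h * h).
  { apply (norm_le_eq _ (RInt (V := E) (fun s => minus (g1 s) (scal s l)) 0 h : nm E)).
    - rewrite (RInt_derive_eq r _ Hr Hrc). unfold r. rewrite H0. vec (nm E).
    - apply (norm_RInt_le (V := nm E) (fun s => minus (g1 s) (scal s l)) (fun _ => eps / 2 * h) 0 h).
      + lra.
      + intros s Hs. specialize (H s). rewrite Rminus_0_r, Rabs_pos_eq in H by lra.
        apply Rle_trans with (eps / 2 * s); [|apply Rmult_le_compat_l; lra].
        eapply norm_le_eq; [|apply H; lra]. rewrite H1. vec (nm E).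
      + apply (RInt_correct (V := E)). apply ex_RInt_continuous. auto.
      + replace (eps / 2 * h * h) with (scal (h - 0) (eps / 2 * h))
          by (change ((h - 0) * (eps / 2 * h) = eps / 2 * h * h); ring).
        apply (is_RInt_const (V := R_NormedModule)). }
  assert (Hhh : 0 < h * h) by (apply Rmult_lt_0_compat; lra).
  apply (norm_le_eq _ (scal (2 / (h * h)) (r h))).
  - unfold r. vec (nm E).
  - rewrite norm_scal_R, Rabs_pos_eq by (left; apply Rdiv_lt_0_compat; lra).
    apply Rle_trans with (2 / (h * h) * (eps / 2 * h * h)).
    + apply Rmult_le_compat_l; [|exact Hb]. left; apply Rdiv_lt_0_compat; lra.
    + apply Req_le. field. lra.
Qed.

Lemma even_derivative_zero {E : NormedModule R_AbsRing} (f : R -> E) (l : E) :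
  (forall t, f (- t) = f t) -> is_derive f 0 l -> l = zero.
Proof.
  intros Hf Hl.
  assert (Hr : is_derive f 0 (opp l)).
  { apply (is_derive_ext (fun t => f (0 - t))).
    - intros t. rewrite <- Hf. f_equal. change (- (0 - t) = t). ring.
    - apply is_derive_reflect. now rewrite Rminus_0_r. }
  assert (He := is_derive_unique_vec f 0 _ _ Hl Hr).
  transitivity (scal (/ 2) (minus l (opp l))); [vec E|]. rewrite <- He. vec E.
Qed.

Section PhaseCOF.

Context {k : scalar_field} {E F : banach k}.

Variables (T : operator E E) (j : F -> E) (U : R -> re (F \x E) -> re (F \x E)).

Hypothesis HT : linear_operator T.
Hypothesis Hj : continuous_embedding j.
Hypothesis HU : phase_group T j U.

Let HUg := proj1 HU.
Let HG := proj2 HU.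
Let HUsc := group_sc U HUg.

Lemma phase_group_scal (t : R) (a : k) (p : F \x E) :
  U t (scal a p) = scal a (U t p : F \x E).
Proof.
  apply (group_scal (phase_matrix T j) U); [now apply phase_matrix_linear|].
  split; [exact HUg|]. intros [v e] [v' e']. rewrite HG. symmetry.
  apply (phase_matrix_graph T j Hj v e (v', e')).
Qed.

Definition cosine (t : R) (y : E) : E := snd (U t ((zero, y) : re (F \x E))).

(** The vector (0, y) is the reflection of its own negative, so the reflection symmetry relates U (-
    t) and U t on it. *)
Lemma phase_cosine_opp (t : R) (y : E) :
  U (- t) ((zero, y) : re (F \x E)) =
  (opp (fst (U t ((zero, y) : re (F \x E)))), cosine t y).
Proof.
  unfold cosine. set (p := (zero, y) : re (F \x E)).
  assert (Hp : p = reflection (opp p)).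
  { unfold reflection, p. apply injective_projections; simpl.
    - symmetry. exact (opp_zero (G := F)).
    - symmetry. exact (opp_opp y). }
  rewrite Hp at 1. rewrite <- (phase_reflection T j Hj U HU).
  assert (Ho : U t (opp p) = opp (U t p)) by apply (linear_opp _ _ (sc_linear U HUsc t)).
  rewrite Ho. unfold reflection. apply injective_projections; simpl; [reflexivity|].
  exact (opp_opp (snd (U t p))).
Qed.

Lemma cosine_even (t : R) (y : E) : cosine (- t) y = cosine t y.
Proof. unfold cosine at 1. now rewrite phase_cosine_opp. Qed.

Lemma cosine_sc : strongly_continuous (cosine : R -> re E -> re E).
Proof.
  assert (Hin : is_linear ((fun y : E => (zero, y)) : re E -> re (F \x E))).
  { apply Build_is_linear.
    - intros x y. apply injective_projections; simpl; [|reflexivity].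
      symmetry. exact (plus_zero_l (zero : F)).
    - intros a x. apply injective_projections; simpl; [|reflexivity].
      symmetry. exact (scal_zero_r (of_real k a) (V := F)).
    - exists 1. split; [lra|]. intros x. rewrite Rmult_1_l. apply (norm_pair_zero_le (F := F) (E := E) x). }
  apply (sc_comp (fun _ => snd : re (F \x E) -> re E) ((fun t (y : E) => U t ((zero, y) : re (F \x E))) : R -> re E -> re (F \x E))).
  - apply sc_const, pair_snd_linear.
  - apply (sc_comp U (fun _ => (fun y : E => (zero, y)) : re E -> re (F \x E))); [exact HUsc|].
    now apply sc_const.
Qed.

Lemma cosine_is_cof : is_cof cosine.
Proof.
  split.
  - intros t. apply linear_of_real_linear; [apply cosine_sc|].
    intros a x. unfold cosine.
    etransitivity; [|exact (f_equal snd (phase_group_scal t a ((zero, x) : F \x E)))].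
    do 2 f_equal. apply injective_projections; simpl; [|reflexivity].
    symmetry. exact (scal_zero_r a (V := F)).
  - intros x. unfold cosine. now rewrite (group_zero U HUg).
  - intros t s x. set (p := (zero, x) : re (F \x E)).
    (* The first components of U s p and U (- s) p cancel; applying U t to this identity and taking
       second components is d'Alembert's equation. *)
    assert (Hs : plus (U s p) (U (- s) p) = scal 2 ((zero, cosine s x) : re (F \x E))).
    { unfold p at 2. rewrite phase_cosine_opp. fold p. apply injective_projections; simpl.
      - transitivity (zero : re F).
        + exact (plus_opp_r (fst (U s p) : F)).
        + symmetry. exact (scal_zero_r 2 (V := re F)).
      - change (plus (cosine s x : re E) (cosine s x : re E) = scal 2 (cosine s x : re E)).
        vec (re E). }
    transitivity (snd (plus (U (t + s) p) (U (t - s) p))); [reflexivity|].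
    unfold Rminus. rewrite !(group_plus U HUg), <- (linear_plus _ (sc_linear U HUsc t)), Hs.
    rewrite (linear_scal _ (sc_linear U HUsc t)). reflexivity.
  - intros x t. apply (sc_continuous _ cosine_sc x t).
Qed.

Lemma cosine_generator_sub (x : E) : (exists v, j v = x) -> dom T x ->
  exists f1 f2, is_C2 (fun t => cosine t x) f1 f2 /\ f2 0 = T x.
Proof.
  intros [v <-] Hv.
  assert (Hd : forall p q, generates U p q ->
    forall t, is_derive (fun t => snd (U t p) : re E) t (snd (U t q) : re E)).
  { intros p q Hpq t. apply (is_derive_linear (snd : re (F \x E) -> re E) (fun t => U t p)).
    - apply pair_snd_linear.
    - now apply (generates_derive U HUg). }
  exists (fun t => snd (U t ((v, zero) : re (F \x E)))), (fun t => cosine t (T (j v))).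
  split; [split; [|split]|].
  - apply Hd. now apply (phase_generates_sine T j HT Hj U HU).
  - apply Hd. now apply (phase_generates_cosine T j Hj U HU).
  - intros t. apply (sc_continuous _ cosine_sc).
  - apply cosine_is_cof.
Qed.

(** Integrating the orbit of (0, x) gives vectors g h in the domain with T (g h) = cosine h x - x
    and second derivative x at h = 0. Thus 2 g h / h^2 tends to x and its image under [T] tends to
    y; closedness concludes. *)
Lemma cosine_generator_sup (x y : E) :
  sequentially_closed T ->
  (exists f1 f2, is_C2 (fun t => cosine t x) f1 f2 /\ f2 0 = y) -> dom T x /\ T x = y.
Proof.
  intros Hcl (f1 & f2 & (Hf1 & Hf2 & Hf2c) & Hy).
  set (p := (zero, x) : re (F \x E)).
  set (I := fun t => RInt (V := realify (F \x E)) (fun s => U s p) 0 t : re (F \x E)).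
  assert (HI : forall t, is_derive I t (U t p)).
  { intros t. apply (is_derive_primitive (fun s => U s p)). apply HUsc. }
  assert (Hgen : forall t, dom T (j (fst (I t))) /\
    j (fst (U t p)) = snd (I t) /\ T (j (fst (I t))) = minus (cosine t x) x).
  { intros t. assert (H := generates_integral U HUg p t). fold (I t) in H.
    rewrite (surjective_pairing (I t)) in H. apply HG in H.
    destruct H as (H1 & H2 & H3). split; [exact H1|]. split; [|exact H3].
    rewrite <- H2. f_equal. symmetry. exact (minus_zero_r (fst (U t p) : F)). }
  set (g := fun t => j (fst (I t)) : re E).
  set (g1 := fun t => snd (I t) : re E).
  assert (Hg : forall t, is_derive g t (g1 t)).
  { intros t. unfold g, g1. rewrite <- (proj1 (proj2 (Hgen t))).
    apply (is_derive_linear (fun q : re (F \x E) => j (fst q) : re E) I); [|apply HI].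
    apply (is_linear_comp (fst : re (F \x E) -> re F) (j : re F -> re E)).
    - apply pair_fst_linear.
    - apply realify_linear, Hj. }
  assert (Hg1 : forall t, is_derive g1 t (cosine t x : re E)).
  { intros t. apply (is_derive_linear (snd : re (F \x E) -> re E) I); [|apply HI].
    apply pair_snd_linear. }
  assert (Hcont : forall t, continuous g1 t).
  { intros t. apply (is_derive_continuous g1 t _ (Hg1 t)). }
  assert (HI0 : I 0 = zero) by apply (RInt_0_0 (fun s => U s p)).
  assert (Hg0 : g 0 = zero).
  { unfold g. rewrite HI0. apply (linear_zero _ (proj1 Hj)). }
  assert (Hg10 : g1 0 = zero).
  { unfold g1. now rewrite HI0. }
  assert (Hc0 : cosine 0 x = x) by apply cosine_is_cof.
  assert (Hl := second_derivative_limit g g1 x Hg Hcont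
    (is_derive_eq _ _ _ _ (Hg1 0) Hc0) Hg0 Hg10).
  assert (Hf10 : f1 0 = zero).
  { apply (even_derivative_zero (E := re E) (fun t => cosine t x)); [|apply Hf1].
    intros t. apply cosine_even. }
  assert (Hf1c : forall t, continuous (f1 : R -> re E) t).
  { intros t. apply (is_derive_continuous (E := re E) f1 t _ (Hf2 t)). }
  set (c := fun t => minus (cosine t x : re E) (x : re E)).
  assert (Hcd : forall t, is_derive c t (f1 t : re E)).
  { intros t. apply (is_derive_eq _ _ (minus (f1 t : re E) zero)); [|vec (re E)].
    apply (is_derive_minus (V := re E)); [apply Hf1|apply (is_derive_const (V := re E))]. }
  assert (Hc0' : c 0 = zero).
  { unfold c. rewrite Hc0. vec (re E). }
  assert (Hm := second_derivative_limit c f1 y Hcd Hf1c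
    (is_derive_eq _ _ _ _ (Hf2 0) Hy) Hc0' Hf10).
  set (h := fun n : nat => / (INR n + 1)).
  assert (Hh : forall n, 0 < h n).
  { intros n. apply Rinv_0_lt_compat. generalize (pos_INR n). lra. }
  assert (Hhd : forall d, 0 < d -> exists N, forall n, (N <= n)%nat -> h n < d).
  { intros d Hd. destruct (INR_unbounded (/ d)) as [N HN]. exists N. intros n Hn.
    unfold h. rewrite <- (Rinv_inv d).
    apply Rinv_lt_contravar.
    - apply Rmult_lt_0_compat; [now apply Rinv_0_lt_compat|]. generalize (pos_INR n). lra.
    - apply le_INR in Hn. lra. }
  assert (Hlim : forall (f : R -> re E) l,
    (forall eps, 0 < eps -> exists d, 0 < d /\ forall h, 0 < h < d ->
      norm (minus (scal (2 / (h * h)) (f h)) l) <= eps) ->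
    tends (fun n => scal (2 / (h n * h n)) (f (h n))) l).
  { intros f l H. apply tends_iff. intros eps He.
    destruct (H (eps / 2)) as (d & Hd & H'); [lra|].
    destruct (Hhd d Hd) as [N HN]. exists N. intros n Hn.
    apply Rle_lt_trans with (eps / 2); [|lra]. apply H'. split; [apply Hh|now apply HN]. }
  apply (Hcl (fun n => scal (2 / (h n * h n)) (g (h n)))).
  - intros n. apply (dom_scal T HT (of_real k (2 / (h n * h n))) (g (h n))). apply Hgen.
  - apply Hlim, Hl.
  - apply (filterlim_ext (fun n => scal (2 / (h n * h n)) (c (h n)))); [|apply Hlim, Hm].
    intros n. symmetry.
    etransitivity; [apply (app_scal T HT (of_real k (2 / (h n * h n))) (g (h n))); apply Hgen|].
    unfold g. rewrite (proj2 (proj2 (Hgen (h n)))). reflexivity.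
Qed.

Lemma phase_generates_cof : domain_embeds T j -> exists C, cof_generated_by T C.
Proof.
  intros Hd. assert (Hcl := phase_sequentially_closed T j HT Hj U HU Hd).
  exists cosine. split; [apply cosine_is_cof|]. intros x y. split.
  - intros [Hx <-]. apply cosine_generator_sub; [|exact Hx].
    destruct Hd as [M HM]. destruct (HM x Hx) as (v & Hv & _). now exists v.
  - now apply cosine_generator_sup.
Qed.

(* The resolvent of the phase group is bounded, so that a closed operator
   defined on [D(T)] composed with it is bounded by the closed graph theorem. *)
Lemma closed_operator_bounded_by_graph_norm (T0 : operator E E) :
  domain_embeds T j ->
  linear_operator T0 -> sequentially_closed T0 -> (forall x, dom T x -> dom T0 x) ->
  exists M, forall x, dom T x -> norm (T0 x) <= M * graph_norm T x.
Proof.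
  intros [m Hm] HT0 Hcl Hsub.
  destruct (resolvent_exists U HUg 1) as (l & Q & HQ & _); [lra|].
  assert (HQl := resolvent_linear U l Q HQ).
  assert (HQd : forall p, dom T0 (j (fst (Q p)))).
  { intros p. apply Hsub. assert (H := resolvent_right U l Q HQ p).
    rewrite (surjective_pairing (Q p)) in H.
    rewrite (surjective_pairing (minus _ p)) in H. now apply HG in H. }
  assert (HjQ : is_linear ((fun p => j (fst (Q p))) : re (F \x E) -> re E)).
  { apply (is_linear_comp Q (fun q : re (F \x E) => j (fst q) : re E)); [exact HQl|].
    apply (is_linear_comp (fst : re (F \x E) -> re F) (j : re F -> re E)).
    - apply pair_fst_linear.
    - apply realify_linear, Hj. }
  assert (HL : is_linear ((fun p => T0 (j (fst (Q p)))) : re (F \x E) -> re E)).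
  { apply closed_graph.
    - intros p q. rewrite (linear_plus _ HjQ). apply (app_plus T0 HT0); apply HQd.
    - intros a p. rewrite (linear_scal _ HjQ). apply (app_scal T0 HT0 (of_real k a)). apply HQd.
    - intros u p y Hu Hy. apply (Hcl (fun n => j (fst (Q (u n))))).
      + intros n. apply HQd.
      + apply (tends_linear _ u p HjQ Hu).
      + exact Hy. }
  destruct (linear_norm _ HL) as (M & HM & HLM).
  exists (M * (Rabs l * Rabs m + 1)). intros x Hx.
  destruct (Hm x Hx) as (v & <- & Hv).
  (* This is l minus the generator applied to (v, 0); the resolvent returns (v, 0), and the norm of
     p is controlled by the graph norm. *)
  set (p := minus (scal l ((v, zero) : re (F \x E))) ((zero, T (j v)) : re (F \x E))).
  assert (Hp : Q p = ((v, zero) : re (F \x E))).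
  { apply (resolvent_left U l Q HQ). now apply (phase_generates_cosine T j Hj U HU). }
  specialize (HLM p). rewrite Hp in HLM. simpl in HLM.
  eapply Rle_trans; [exact HLM|]. rewrite Rmult_assoc. apply Rmult_le_compat_l; [lra|].
  eapply Rle_trans; [apply (norm_minus_le (E := re (F \x E)))|].
  rewrite norm_scal_R.
  assert (H1 : norm ((v, zero) : F \x E) <= norm v).
  { apply norm_pair_zero_r_le. }
  assert (H2 := norm_pair_zero_le (F := F) (T (j v))).
  assert (Hg : 0 <= graph_norm T (j v)).
  { unfold graph_norm. generalize (norm_ge_0 (j v)) (norm_ge_0 (T (j v))). lra. }
  assert (Hv' : norm v <= Rabs m * graph_norm T (j v)).
  { eapply Rle_trans; [exact Hv|]. apply Rmult_le_compat_r; [exact Hg|apply Rle_abs]. }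
  apply Rle_trans with (Rabs l * (Rabs m * graph_norm T (j v)) + graph_norm T (j v)).
  - apply Rplus_le_compat.
    + apply Rmult_le_compat_l; [apply Rabs_pos|].
      eapply Rle_trans; [exact H1|exact Hv'].
    + eapply Rle_trans; [exact H2|]. unfold graph_norm.
      generalize (norm_ge_0 (j v)). lra.
  - apply Req_le. ring.
Qed.

(** Adding [B] to [T] changes only the lower left entry of the phase matrix, by (v, e) |-> (0, B (j
    v)). *)
Lemma phase_group_perturbed (B : E -> E) (W : R -> re (F \x E) -> re (F \x E)) :
  c0_group W ->
  (forall p q, generates W p q <->
    generates U p (minus q ((zero, B (j (fst p))) : re (F \x E)))) ->
  phase_group (perturbed T B) j W.
Proof.
  intros HW HgW. split; [exact HW|]. intros v e v' e'. rewrite HgW.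
  etransitivity; [apply (HG v e (minus v' zero) (minus e' (B (j v))))|]. simpl.
  split; intros (H1 & H2 & H3); (split; [exact H1|]); split.
  - rewrite <- H2. f_equal. symmetry. exact (minus_zero_r v').
  - rewrite H3. change (plus (minus (e' : re E) (B (j v))) (B (j v)) = (e' : re E)). vec (re E).
  - rewrite <- H2. f_equal. exact (minus_zero_r v').
  - rewrite <- H3.
    change ((T (j v) : re E) = minus (plus (T (j v) : re E) (B (j v))) (B (j v))). vec (re E).
Qed.

(** An operator bounded on F gives a perturbation bounded on the whole phase space, because F
    carries the first component. *)
Lemma phase_bounded_perturbation (B : E -> E) :
  is_linear (fun v => B (j v)) -> exists W, phase_group (perturbed T B) j W.
Proof.
  intros HB.
  set (Q := (fun p => (zero, B (j (fst p)))) : re (F \x E) -> re (F \x E)).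
  assert (HQ : is_linear Q).
  { apply (realify_linear (E := F \x E) (F := F \x E) (fun p => (zero, B (j (fst p))))).
    apply (is_linear_prod (U := F) (V := E) (fun p : F \x E => (zero : F))
      (fun p : F \x E => B (j (fst p)))).
    - exact (is_linear_zero (U := nm (F \x E)) (V := nm F)).
    - apply (is_linear_comp (fst : F \x E -> F) (fun v => B (j v))); [|exact HB].
      apply (is_linear_fst (U := F) (V := E)). }
  destruct (bounded_perturbation U HUg Q HQ) as (W & HW & HgW).
  exists W. now apply phase_group_perturbed.
Qed.

(** Boundedness of [B] from the domain of [T] into F is what makes (v, e) |-> (0, B (j v)) bounded
    on the domain of the phase generator: with B (j v) = j w, the generator sends (0, j w) to (w,
    0). *)
Lemma phase_domain_perturbation (B : E -> E) (M : R) :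
  (forall x y, dom T x -> dom T y -> B (plus x y) = plus (B x) (B y)) ->
  (forall (a : k) x, dom T x -> B (scal a x) = scal a (B x)) ->
  (forall x, dom T x -> exists v, j v = B x /\ norm v <= M * graph_norm T x) ->
  exists W, phase_group (perturbed T B) j W.
Proof.
  intros Bp Bs HB.
  set (P := (fun p => (zero, B (j (fst p)))) : re (F \x E) -> re (F \x E)).
  assert (Hjl := proj1 Hj).
  destruct (linear_norm _ Hjl) as (m & Hm & Hjm).
  assert (Hdom : forall p q, generates U p q -> dom T (j (fst p)) /\
    j (fst q) = snd p /\ T (j (fst p)) = snd q).
  { intros [v e] [v' e'] H. now apply HG in H. }
  destruct (domain_perturbation U P HUg) as (W & HW & HgW).
  - intros p p' q q' H H'. apply Hdom in H. apply Hdom in H'.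
    apply injective_projections; simpl.
    + symmetry. exact (plus_zero_l (zero : F)).
    + change (B (j (plus (fst p) (fst p'))) = plus (B (j (fst p))) (B (j (fst p')))).
      rewrite (linear_plus _ Hjl). apply Bp; tauto.
  - intros a p q H. apply Hdom in H. apply injective_projections; simpl.
    + symmetry. exact (scal_zero_r (of_real k a) (V := F)).
    + change (B (j (scal (of_real k a) (fst p))) = scal (of_real k a) (B (j (fst p)))).
      rewrite (linear_scal _ Hjl). apply Bs; tauto.
  (* [m] bounds [j]. One factor m + 1 bounds the norms of (0, j w) and (w, 0) by that of w, the
     other bounds the graph norm of j (fst p) by the norms of p and q. *)
  - exists ((m + 1) * (Rabs M * (m + 1))). intros p q H. apply Hdom in H.
    destruct H as (H1 & H2 & H3). destruct (HB _ H1) as (w & Hw & Hn).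
    exists ((w, zero) : re (F \x E)). split.
    + unfold P. rewrite <- Hw. apply (HG zero (j w) w zero).
      assert (Hj0 : j zero = zero) by exact (linear_zero _ Hjl).
      rewrite Hj0. split; [apply (dom_zero T HT)|]. split; [reflexivity|].
      now apply operator_zero.
    + assert (Ha : norm (P p) <= norm (j w)).
      { unfold P. rewrite <- Hw. apply (norm_pair_zero_le (j w)). }
      assert (Hb : norm ((w, zero) : F \x E) <= norm w).
      { apply norm_pair_zero_r_le. }
      assert (Hc : graph_norm T (j (fst p)) <= m * norm (p : F \x E) + norm (q : F \x E)).
      { unfold graph_norm. rewrite H3.
        generalize (Hjm (fst p)) (norm_snd_le (q : F \x E)).
        assert (m * norm (fst p) <= m * norm (p : F \x E))
          by (apply Rmult_le_compat_l; [lra|apply norm_fst_le]). lra. }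
      assert (Hg : 0 <= graph_norm T (j (fst p))).
      { unfold graph_norm.
        generalize (norm_ge_0 (j (fst p))) (norm_ge_0 (T (j (fst p)))). lra. }
      assert (Hd : norm w <= Rabs M * ((m + 1) * (norm (p : F \x E) + norm (q : F \x E)))).
      { eapply Rle_trans; [exact Hn|].
        apply Rle_trans with (Rabs M * graph_norm T (j (fst p))).
        - apply Rmult_le_compat_r; [exact Hg|apply Rle_abs].
        - apply Rmult_le_compat_l; [apply Rabs_pos|].
          generalize (norm_ge_0 (p : F \x E)) (norm_ge_0 (q : F \x E)).
          intros. eapply Rle_trans; [exact Hc|]. nra. }
      change (norm (P p : F \x E) + norm ((w, zero) : F \x E)
        <= (m + 1) * (Rabs M * (m + 1)) * (norm (p : F \x E) + norm (q : F \x E))).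
      apply Rle_trans with ((m + 1) * norm w).
      * specialize (Hjm w).
        apply Rle_trans with (m * norm w + norm w); [|apply Req_le; ring].
        apply Rplus_le_compat; [|exact Hb]. eapply Rle_trans; [exact Ha|exact Hjm].
      * rewrite !Rmult_assoc. apply Rmult_le_compat_l; [lra|]. exact Hd.
  - exists W. now apply phase_group_perturbed.
Qed.

End PhaseCOF.

(** * Compactness of the sine function *)

Definition strictly_increasing (phi : nat -> nat) : Prop := forall n, (phi n < phi (S n))%nat.

Lemma strictly_increasing_lt (phi : nat -> nat) :
  strictly_increasing phi -> forall n m, (n < m)%nat -> (phi n < phi m)%nat.
Proof.
  intros H n m Hnm. induction Hnm as [|m Hnm IH]; [apply H|].
  specialize (H m). lia.
Qed.

Lemma strictly_increasing_ge (phi : nat -> nat) :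
  strictly_increasing phi -> forall n, (n <= phi n)%nat.
Proof.
  intros H n. induction n as [|n IH]; [lia|]. specialize (H n). lia.
Qed.

Lemma strictly_increasing_comp (phi psi : nat -> nat) :
  strictly_increasing phi -> strictly_increasing psi ->
  strictly_increasing (fun n => phi (psi n)).
Proof. intros Hp Hq n. apply strictly_increasing_lt; auto. Qed.

Section Subsequences.

Context {k : scalar_field} {E : banach k}.

(** The i-th extraction refines the previous ones to oscillation at most (1/2)^i; the diagonal is
    then Cauchy. *)
Lemma diagonal_subsequence (w : nat -> E) :
  (forall eps, 0 < eps -> forall phi, strictly_increasing phi ->
     exists psi, strictly_increasing psi /\
       forall n m, norm (minus (w (phi (psi n))) (w (phi (psi m)))) <= eps) ->
  has_convergent_subsequence w.
Proof.
  intros H.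
  set (inc := {phi : nat -> nat | strictly_increasing phi}).
  assert (Hstep : forall (i : nat) (phi : inc), exists psi : inc,
    forall n m, norm (minus (w (proj1_sig phi (proj1_sig psi n)))
                            (w (proj1_sig phi (proj1_sig psi m)))) <= (1 / 2) ^ i).
  { intros i [phi Hphi]. destruct (H _ (pow_half_pos i) phi Hphi) as (psi & Hpsi & Hn).
    now exists (exist _ psi Hpsi). }
  set (f := fun i (phi : inc) => proj1_sig (constructive_indefinite_description _ (Hstep i phi))).
  assert (Hf : forall i (phi : inc) n m, norm (minus (w (proj1_sig phi (proj1_sig (f i phi) n)))
                            (w (proj1_sig phi (proj1_sig (f i phi) m)))) <= (1 / 2) ^ i).
  { intros i phi. exact (proj2_sig (constructive_indefinite_description _ (Hstep i phi))). }
  set (comp := fun phi psi : inc =>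
    exist strictly_increasing (fun n => proj1_sig phi (proj1_sig psi n))
      (strictly_increasing_comp _ _ (proj2_sig phi) (proj2_sig psi)) : inc).
  set (Phi := nat_rect (fun _ => inc) (exist strictly_increasing (fun n => n) (fun n => Nat.lt_succ_diag_r n))
    (fun i phi => comp phi (f i phi))).
  set (d := fun n => proj1_sig (Phi n) n).
  assert (Hrange : forall i n m, (i <= n)%nat -> exists l, proj1_sig (Phi n) m = proj1_sig (Phi i) l).
  { intros i n m Hin. revert m. induction Hin as [|n Hin IH]; intros m; [now exists m|].
    change (proj1_sig (Phi (S n)) m) with (proj1_sig (Phi n) (proj1_sig (f n (Phi n)) m)).
    apply IH. }
  exists d. split.
  - intros n. unfold d.
    change (proj1_sig (Phi (S n)) (S n))
      with (proj1_sig (Phi n) (proj1_sig (f n (Phi n)) (S n))).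
    apply strictly_increasing_lt; [apply proj2_sig|].
    generalize (strictly_increasing_ge _ (proj2_sig (f n (Phi n))) (S n)). simpl. lia.
  - apply (cauchy_tends (fun n => w (d n))). intros eps He.
    (* The bound (1/2)^i holds on the range of [Phi (S i)], hence along the diagonal from index
       [S i] on. *)
    destruct (pow_half_lt 1 eps He) as [i Hi]. exists (S i). intros n m Hn Hm.
    destruct (Hrange (S i) n n Hn) as [a Ha]. destruct (Hrange (S i) m m Hm) as [b Hb].
    unfold d. rewrite Ha, Hb.
    eapply Rle_lt_trans; [apply (Hf i (Phi i) a b)|]. lra.
Qed.

(** Sequence form of the fact that norm limits of compact operators are compact: [a] is the image of
    a bounded sequence under a compact approximation. *)
Lemma approximable_convergent_subsequence (w : nat -> E) :
  (forall eps, 0 < eps -> exists a : nat -> E,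
     (forall n, norm (minus (w n) (a n)) <= eps) /\
     forall phi, strictly_increasing phi -> has_convergent_subsequence (fun n => a (phi n))) ->
  has_convergent_subsequence w.
Proof.
  intros H. apply diagonal_subsequence. intros eps He phi Hphi.
  destruct (H (eps / 4)) as (a & Ha & Hsub); [lra|].
  destruct (Hsub phi Hphi) as (psi & Hpsi & l & Hl).
  destruct (proj1 (tends_iff _ _) Hl (eps / 4)) as [N HN]; [lra|].
  exists (fun n => psi (n + N)%nat). split.
  - intros n. apply (Hpsi (n + N)%nat).
  - assert (Hn : forall n, norm (minus (w (phi (psi (n + N)%nat)) : nm E) l) <= eps / 2).
    { intros n. eapply Rle_trans;
        [apply (norm_dist_le (E := nm E) _ (a (phi (psi (n + N)%nat))))|].
      assert (norm (minus (w (phi (psi (n + N)%nat)) : nm E) (a (phi (psi (n + N)%nat)))) <= eps / 4)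
        by apply Ha.
      specialize (HN (n + N)%nat).
      assert (norm (minus (a (phi (psi (n + N)%nat)) : nm E) l) < eps / 4) by (apply HN; lia).
      lra. }
    intros n m. eapply Rle_trans; [apply (norm_dist_le (E := nm E) _ l)|].
    rewrite (norm_minus_sym (E := nm E) l). generalize (Hn n) (Hn m). lra.
Qed.

End Subsequences.

(** Integrate twice. In both approximations below the error r vanishes to first order at 0 and has a
    bounded second derivative, so that r h / h is of order h. *)
Lemma second_order_bound {E : rbanach} (r q c : R -> nm E) (M h : R) :
  (forall t, is_derive r t (q t)) -> (forall t, is_derive q t (c t)) ->
  (forall t, continuous c t) -> r 0 = zero -> q 0 = zero ->
  (forall t, Rabs t <= 1 -> norm (c t) <= M) -> 0 <= h <= 1 ->
  norm (r h) <= M * h * h.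
Proof.
  intros Hr Hq Hc Hr0 Hq0 HM Hh.
  assert (HqM : forall t, Rabs t <= 1 -> norm (q t) <= M * Rabs t).
  { intros t Ht. apply (norm_le_eq _ (RInt (V := E) c 0 t : nm E)).
    - rewrite (RInt_derive_eq q c Hq Hc), Hq0. vec (nm E).
    - apply norm_RInt_bound; [exact Hc|]. intros s Hs. apply HM. lra. }
  assert (HM0 : 0 <= M).
  { eapply Rle_trans; [apply (norm_ge_0 (c 0))|]. apply HM. rewrite Rabs_R0. lra. }
  assert (Hqc : forall t, continuous q t).
  { intros t. apply (is_derive_continuous q t _ (Hq t)). }
  apply (norm_le_eq _ (RInt (V := E) q 0 h : nm E)).
  - rewrite (RInt_derive_eq r q Hr Hqc), Hr0. vec (nm E).
  - rewrite <- (Rabs_pos_eq h) at 3 by lra. apply norm_RInt_bound; [exact Hqc|].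
    intros s Hs. rewrite (Rabs_pos_eq h) in Hs by lra.
    eapply Rle_trans; [apply HqM; lra|]. now apply Rmult_le_compat_l.
Qed.

(** * Integrals of a cosine function given by its generator, without a phase space *)

Section COF.

Context {k : scalar_field} {E : banach k}.

Variables (T : operator E E) (C : R -> E -> E).

Hypothesis HT : linear_operator T.
Hypothesis HC : cof_generated_by T C.

Let HCc := proj1 HC.
Let HCg := proj2 HC.

Lemma cof_sc : strongly_continuous (C : R -> re E -> re E).
Proof.
  split.
  - intros t. apply realify_linear, (cof_bounded C HCc).
  - intros x t. apply (cof_continuous C HCc x t).
Qed.

Definition double_sine (t : R) (x : re E) : re E :=
  RInt (V := realify E) (fun s => sine C s x) 0 t.

Lemma sine_sc : strongly_continuous (sine C : R -> re E -> re E).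
Proof. apply (sc_integral (C : R -> re E -> re E)), cof_sc. Qed.

Lemma double_sine_sc : strongly_continuous double_sine.
Proof. apply (sc_integral (sine C : R -> re E -> re E)), sine_sc. Qed.

Lemma sine_derive (x : re E) (t : R) :
  is_derive (fun t => sine C t x : re E) t (C t x : re E).
Proof. apply (is_derive_primitive (fun s => C s x : re E)). apply cof_sc. Qed.

Lemma double_sine_derive (x : re E) (t : R) :
  is_derive (fun t => double_sine t x) t (sine C t x : re E).
Proof. apply (is_derive_primitive (fun s => sine C s x : re E)). apply sine_sc. Qed.

Lemma sine_zero (x : re E) : sine C 0 x = (zero : re E).
Proof. apply (RInt_0_0 (E := realify E) (fun s => C s x)). Qed.

Lemma double_sine_zero (x : re E) : double_sine 0 x = zero.
Proof. apply (RInt_0_0 (E := realify E) (fun s => sine C s x)). Qed.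

Lemma cof_dalembert_real (t s : R) (x : re E) :
  plus (C (t + s) x : re E) (C (t - s) x : re E) = scal 2 (C t (C s x) : re E).
Proof. apply (cof_dalembert C HCc t s x). Qed.

Lemma cof_even (t : R) (x : E) : C (- t) x = C t x.
Proof.
  assert (H := cof_dalembert_real 0 t x).
  rewrite Rplus_0_l, (cof_zero C HCc) in H. unfold Rminus in H. rewrite Rplus_0_l in H.
  transitivity (minus (plus (C t x : re E) (C (- t) x : re E)) (C t x : re E)); [vec (re E)|].
  rewrite H. vec (re E).
Qed.

Lemma sine_odd (t : R) (x : re E) : (sine C (- t) x : re E) = opp (sine C t x : re E).
Proof.
  transitivity (opp (opp (sine C (0 - t) x : re E))).
  { unfold Rminus. rewrite Rplus_0_l. vec (re E). }
  f_equal. revert t.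
  apply (eq_derive_eq (fun t => opp (sine C (0 - t) x : re E)) _ (fun t => C t x : re E)).
  - intros t. apply (is_derive_eq _ _ (opp (opp (C (0 - t) x : re E)))).
    + apply (is_derive_opp (V := re E)).
      apply (is_derive_reflect (fun t => sine C t x : re E)). apply sine_derive.
    + unfold Rminus. rewrite Rplus_0_l, cof_even. vec (re E).
  - intros t. apply sine_derive.
  - rewrite Rminus_0_r, sine_zero. vec (re E).
Qed.

Lemma double_sine_even (t : R) (x : re E) : double_sine (- t) x = double_sine t x.
Proof.
  transitivity (double_sine (0 - t) x); [f_equal; ring|]. revert t.
  apply (eq_derive_eq (fun t => double_sine (0 - t) x) _ (fun t => sine C t x : re E)).
  - intros t. apply (is_derive_eq _ _ (opp (sine C (0 - t) x : re E))).
    + apply (is_derive_reflect (fun t => double_sine t x)). apply double_sine_derive.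
    + unfold Rminus. rewrite Rplus_0_l, sine_odd. vec (re E).
  - intros t. apply double_sine_derive.
  - now rewrite Rminus_0_r.
Qed.

(** D'Alembert's equation integrated twice in [t]. The subtracted term is the constant of
    integration: at t = 0 the left side vanishes, while the average of the shifts is
    [double_sine r x] by evenness. *)
Lemma cof_double_sine (r t : R) (x : re E) :
  (C r (double_sine t x) : re E) =
  minus (scal (/ 2) (plus (double_sine (t + r) x) (double_sine (t - r) x))) (double_sine r x).
Proof.
  assert (Hlin := sc_linear _ cof_sc r).
  assert (Hshift : forall (f g : R -> re E), (forall s, is_derive f s (g s)) -> forall t,
    is_derive (fun t => scal (/ 2) (plus (f (t + r)) (f (t - r)))) t
      (scal (/ 2) (plus (g (t + r)) (g (t - r))))).
  { intros f g H s. apply (is_derive_linear (fun y => scal (/ 2) y)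
      (fun t => plus (f (t + r)) (f (t - r)))); [apply is_linear_scal_R|].
    apply (is_derive_plus (V := re E)).
    - apply is_derive_shift, H.
    - apply (is_derive_shift f (- r)), H. }
  assert (H1 : forall t, (C r (sine C t x) : re E) =
    scal (/ 2) (plus (sine C (t + r) x : re E) (sine C (t - r) x : re E))).
  { apply (eq_derive_eq (fun t => C r (sine C t x) : re E) _ (fun t => C r (C t x) : re E)).
    - intros s. apply (is_derive_linear (C r : re E -> re E) (fun t => sine C t x : re E));
        [exact Hlin|apply sine_derive].
    - intros s. apply (is_derive_eq _ _ (scal (/ 2) (plus (C (s + r) x : re E) (C (s - r) x : re E)))).
      + apply (Hshift (fun t => sine C t x : re E) (fun t => C t x : re E)).
        intros. apply sine_derive.
      + rewrite Rplus_comm, <- (cof_even (s - r)).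
        replace (- (s - r)) with (r - s) by (rewrite Ropp_minus_distr; reflexivity).
        rewrite cof_dalembert_real. vec (re E).
    - unfold Rminus. rewrite !Rplus_0_l, sine_odd, sine_zero.
      etransitivity; [apply (linear_zero _ Hlin)|]. vec (re E). }
  revert t.
  apply (eq_derive_eq (fun t => C r (double_sine t x) : re E) _ (fun t => C r (sine C t x) : re E)).
  - intros s. apply (is_derive_linear (C r : re E -> re E) (fun t => double_sine t x));
      [exact Hlin|apply double_sine_derive].
  - intros s. apply (is_derive_eq _ _
      (minus (scal (/ 2) (plus (sine C (s + r) x : re E) (sine C (s - r) x : re E))) zero)).
    + apply (is_derive_minus (V := re E)); [|apply (is_derive_const (V := re E))].
      apply (Hshift (fun t => double_sine t x) (fun t => sine C t x : re E)).
      intros. apply double_sine_derive.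
    + rewrite H1. vec (re E).
  - unfold Rminus. rewrite !Rplus_0_l, double_sine_even, double_sine_zero.
    etransitivity; [apply (linear_zero _ Hlin)|]. vec (re E).
Qed.

(** By [cof_double_sine] the orbit r |-> C r (double_sine t x) is a combination of shifts of
    [double_sine], hence C^2, with second derivative C t x - x at 0. *)
Lemma double_sine_domain (t : R) (x : re E) :
  dom T (double_sine t x) /\ T (double_sine t x) = minus (C t x : re E) x.
Proof.
  apply HCg.
  assert (Hder : forall (f g : R -> re E), (forall s, is_derive f s (g s)) -> forall r,
    is_derive (fun r => f (t - r)) r (opp (g (t - r)))).
  { intros f g H r. apply is_derive_reflect, H. }
  assert (Hder' : forall (f g : R -> re E), (forall s, is_derive f s (g s)) -> forall r,
    is_derive (fun r => f (t + r)) r (g (t + r))).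
  { intros f g H r. apply (is_derive_ext (fun r => f (r + t))).
    - intros s. now rewrite Rplus_comm.
    - rewrite Rplus_comm. apply is_derive_shift, H. }
  exists (fun r => minus (scal (/ 2) (plus (sine C (t + r) x : re E)
                                          (opp (sine C (t - r) x : re E)))) (sine C r x : re E)).
  exists (fun r => minus (scal (/ 2) (plus (C (t + r) x : re E)
                                          (opp (opp (C (t - r) x : re E))))) (C r x : re E)).
  split; [split; [|split]|].
  - intros r. apply (is_derive_ext (fun r => minus (scal (/ 2)
      (plus (double_sine (t + r) x) (double_sine (t - r) x))) (double_sine r x))).
    { intros s. symmetry. apply cof_double_sine. }
    apply (is_derive_minus (V := re E)); [|apply double_sine_derive].
    apply (is_derive_linear (fun y => scal (/ 2) y)
      (fun r => plus (double_sine (t + r) x) (double_sine (t - r) x))); [apply is_linear_scal_R|].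
    apply (is_derive_plus (V := re E)).
    + apply (Hder' (fun s => double_sine s x) (fun s => sine C s x)).
      intros. apply double_sine_derive.
    + apply (Hder (fun s => double_sine s x) (fun s => sine C s x)).
      intros. apply double_sine_derive.
  - intros r. apply (is_derive_minus (V := re E)); [|apply sine_derive].
    apply (is_derive_linear (fun y => scal (/ 2) y)
      (fun r => plus (sine C (t + r) x : re E) (opp (sine C (t - r) x : re E))));
      [apply is_linear_scal_R|].
    apply (is_derive_plus (V := re E)).
    + apply (Hder' (fun s => sine C s x) (fun s => C s x)). intros. apply sine_derive.
    + apply (is_derive_opp (V := re E)).
      apply (Hder (fun s => sine C s x) (fun s => C s x)). intros. apply sine_derive.
  - intros r.
    assert (Hc : forall g : R -> R, (forall s, continuous g s) ->
      continuous (fun s => C (g s) x : re E) r).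
    { intros g Hg. apply (continuous_comp g (fun s => C s x : re E)); [apply Hg|apply cof_sc]. }
    apply (continuous_minus (V := re E)).
    + apply (continuous_scal (K := R_AbsRing) (V := re E) (fun _ => / 2)).
      * apply continuous_const.
      * apply (continuous_plus (V := re E)).
        -- apply (Hc (fun s => t + s)). intros s.
           apply (continuous_plus (V := R_NormedModule) (fun _ => t) (fun s => s));
             [apply continuous_const|apply continuous_id].
        -- apply (continuous_opp (V := re E)), (continuous_opp (V := re E)).
           apply (Hc (fun s => t - s)). intros s. apply continuous_minus_l.
    + apply (Hc (fun s => s)). intros s. apply continuous_id.
  - rewrite Rplus_0_r, Rminus_0_r, (cof_zero C HCc). vec (re E).
Qed.

(** Differentiating d'Alembert's equation twice in s, at s = 0 the second time, shows that the
    second derivative of C t x is C t (T x); the first derivative vanishes at 0 by evenness, and two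
    integrations remain. *)
Lemma cof_domain_expansion (x : E) : dom T x ->
  forall t, (C t x : re E) = plus (x : re E) (double_sine t (T x)).
Proof.
  intros Hx. destruct (proj1 (HCg x (T x)) (conj Hx eq_refl)) as (f1 & f2 & (H1 & H2 & _) & H0).
  assert (Hf1 : forall t s, plus (f1 (t + s) : re E) (opp (f1 (t - s) : re E))
    = scal 2 (C t (f1 s) : re E)).
  { intros t s. apply (is_derive_unique_vec
      (fun s => plus (C (t + s) x : re E) (C (t - s) x : re E)) s).
    - apply (is_derive_plus (V := re E)).
      + apply (is_derive_ext (fun s => C (s + t) x : re E)); [intros r; now rewrite Rplus_comm|].
        rewrite Rplus_comm. apply (is_derive_shift (fun s => C s x : re E)), H1.
      + apply (is_derive_reflect (fun s => C s x : re E)), H1.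
    - apply (is_derive_ext (fun s => scal 2 (C t (C s x) : re E))).
      + intros r. symmetry. apply cof_dalembert_real.
      + apply (is_derive_linear (fun y => scal 2 y) (fun s => C t (C s x) : re E));
          [apply is_linear_scal_R|].
        apply (is_derive_linear (C t : re E -> re E) (fun s => C s x : re E)); [apply cof_sc|apply H1]. }
  assert (Hf2 : forall t, (f2 t : re E) = (C t (T x) : re E)).
  { intros t. assert (Hd : plus (f2 (t + 0) : re E) (opp (opp (f2 (t - 0) : re E)))
      = scal 2 (C t (f2 0) : re E)).
    { apply (is_derive_unique_vec
        (fun s => plus (f1 (t + s) : re E) (opp (f1 (t - s) : re E))) 0).
      - apply (is_derive_plus (V := re E)).
        + apply (is_derive_ext (fun s => f1 (s + t) : re E)); [intros r; now rewrite Rplus_comm|].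
          rewrite Rplus_comm. apply (is_derive_shift (E := re E) f1), H2.
        + apply (is_derive_opp (V := re E)), (is_derive_reflect (E := re E) f1), H2.
      - apply (is_derive_ext (fun s => scal 2 (C t (f1 s) : re E))).
        + intros r. symmetry. apply Hf1.
        + apply (is_derive_linear (fun y => scal 2 y) (fun s => C t (f1 s) : re E));
            [apply is_linear_scal_R|].
          apply (is_derive_linear (C t : re E -> re E) (f1 : R -> re E)); [apply cof_sc|apply H2]. }
    rewrite Rplus_0_r, Rminus_0_r, H0 in Hd.
    transitivity (scal (/ 2) (plus (f2 t : re E) (opp (opp (f2 t : re E))))); [vec (re E)|].
    rewrite Hd. vec (re E). }
  assert (H10 : (f1 0 : re E) = zero).
  { apply (even_derivative_zero (fun t => C t x : re E)); [|apply H1].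
    intros t. apply cof_even. }
  assert (Hf1s : forall t, (f1 t : re E) = (sine C t (T x) : re E)).
  { apply (eq_derive_eq (E := re E) f1 (fun t => sine C t (T x)) f2).
    - apply H2.
    - intros t. rewrite Hf2. apply sine_derive.
    - now rewrite H10, sine_zero. }
  apply (eq_derive_eq (fun t => C t x : re E) _ (f1 : R -> re E)).
  - apply H1.
  - intros t. apply (is_derive_eq _ _ (plus zero (f1 t : re E))); [|vec (re E)].
    apply (is_derive_plus (V := re E)); [apply (is_derive_const (V := re E))|].
    rewrite Hf1s. apply double_sine_derive.
  - rewrite (cof_zero C HCc), double_sine_zero. vec (re E).
Qed.

Lemma sine_linear (t : R) : is_linear (sine C t).
Proof.
  apply linear_of_real_linear; [apply sine_sc|]. intros a x.
  symmetry. etransitivity; [apply (linear_RInt (E := realify E) (F := realify E)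
    (fun y : E => scal a y) (fun s => C s x : re E) (realify_scal_linear a))|].
  - apply cof_sc.
  - apply (RInt_ext (V := realify E)). intros s _. symmetry.
    apply (linear_scal _ (cof_bounded C HCc s)).
Qed.

Lemma scaled_convergent_subsequence (a : R) (u : nat -> E) :
  has_convergent_subsequence u ->
  has_convergent_subsequence (fun n => scal a (u n : re E) : E).
Proof.
  intros (phi & Hphi & l & Hl). exists phi. split; [exact Hphi|].
  exists (scal a (l : re E)).
  apply (tends_linear (E := re E) (F := re E) (fun y => scal a y) (fun n => u (phi n)) l);
    [apply is_linear_scal_R|exact Hl].
Qed.

Lemma embedding_compact_of_sine_compact :
  (forall t, compact_operator (sine C t)) -> compact_domain_embedding T.
Proof.
  intros Hcomp u Hu [M HM].
  destruct (sc_bounded _ sine_sc 1) as (K & HK & HSK).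
  apply approximable_convergent_subsequence. intros eps He.
  set (M0 := Rabs M + 1). assert (HM0 : 0 < M0) by (unfold M0; generalize (Rabs_pos M); lra).
  (* [K] bounds the sine function on [- 1, 1] and [M0] the graph norms; replacing u n by S t (u n) /
     t costs at most K M0 t. *)
  set (t := Rmin 1 (eps / (K * M0))).
  assert (HKM : 0 < K * M0) by now apply Rmult_lt_0_compat.
  assert (Ht : 0 < t <= 1 /\ K * M0 * t <= eps).
  { split; [split|].
    - apply Rmin_glb_lt; [lra|]. now apply Rdiv_lt_0_compat.
    - apply Rmin_l.
    - apply Rle_trans with (K * M0 * (eps / (K * M0))).
      + apply Rmult_le_compat_l; [lra|apply Rmin_r].
      + apply Req_le. field. split; lra. }
  exists (fun n => scal (/ t) (sine C t (u n) : re E) : E). split.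
  - intros n. set (x := u n).
    assert (Hb : norm (minus (sine C t x : re E) (scal t (x : re E))) <= K * M0 * t * t).
    { apply (second_order_bound (E := realify E)
        (fun s => minus (sine C s x : re E) (scal s (x : re E)))
        (fun s => double_sine s (T x)) (fun s => sine C s (T x))).
      - intros s. apply (is_derive_eq _ _ (minus (C s x : re E) (scal 1 (x : re E)))).
        + apply (is_derive_minus (V := re E)); [apply sine_derive|].
          apply (is_derive_scal_l (K := R_AbsRing) (V := re E) (fun s => s)).
          apply (is_derive_id (K := R_AbsRing)).
        + rewrite (cof_domain_expansion x (Hu n)). vec (re E).
      - intros s. apply double_sine_derive.
      - apply sine_sc.
      - rewrite sine_zero. vec (re E).
      - apply double_sine_zero.
      - intros s Hs. eapply Rle_trans; [now apply HSK|]. apply Rmult_le_compat_l; [lra|].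
        specialize (HM n). unfold graph_norm in HM. fold x in HM.
        apply Rle_trans with M; [|unfold M0; generalize (Rle_abs M); lra].
        eapply Rle_trans; [|exact HM].
        apply Rle_trans with (0 + norm (T x)).
        + apply Req_le. symmetry. apply Rplus_0_l.
        + apply Rplus_le_compat_r, norm_ge_0.
      - lra. }
    apply (norm_le_eq (E := re E) _
      (scal (- / t) (minus (sine C t x : re E) (scal t (x : re E))))).
    { change (minus (x : re E) (scal (/ t) (sine C t x : re E)) =
        scal (- / t) (minus (sine C t x : re E) (scal t (x : re E)))). vec (re E). }
    rewrite norm_scal_R, Rabs_Ropp, Rabs_pos_eq by (left; apply Rinv_0_lt_compat; lra).
    apply Rle_trans with (/ t * (K * M0 * t * t)).
    + apply Rmult_le_compat_l; [left; apply Rinv_0_lt_compat; lra|exact Hb].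
    + replace (/ t * (K * M0 * t * t)) with (K * M0 * t) by (field; lra). lra.
  - intros phi _. apply (scaled_convergent_subsequence (/ t) (fun n => sine C t (u (phi n)))).
    apply (Hcomp t). exists M. intros n.
    eapply Rle_trans; [|apply (HM (phi n))]. unfold graph_norm.
    rewrite <- (Rplus_0_r (norm (u (phi n)))) at 1. apply Rplus_le_compat_l, norm_ge_0.
Qed.

Lemma sine_compact_of_embedding_compact :
  compact_domain_embedding T -> forall t, compact_operator (sine C t).
Proof.
  intros Hcomp t. split; [apply sine_linear|]. intros u [M HM].
  destruct (sc_bounded _ cof_sc (Rabs t + 1)) as (K & HK & HCK).
  apply approximable_convergent_subsequence. intros eps He.
  set (M0 := Rabs M + 1). assert (HM0 : 0 < M0) by (unfold M0; generalize (Rabs_pos M); lra).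
  assert (HuM0 : forall n, norm (u n) <= M0).
  { intros n. eapply Rle_trans; [apply HM|]. unfold M0. generalize (Rle_abs M). lra. }
  (* Here [K] bounds C s for |s| <= |t| + 1; the difference quotient of step h has error at most K
     M0 h. *)
  set (h := Rmin 1 (eps / (K * M0))).
  assert (HKM : 0 < K * M0) by now apply Rmult_lt_0_compat.
  assert (Hh : 0 < h <= 1 /\ K * M0 * h <= eps).
  { split; [split|].
    - apply Rmin_glb_lt; [lra|]. now apply Rdiv_lt_0_compat.
    - apply Rmin_l.
    - apply Rle_trans with (K * M0 * (eps / (K * M0))).
      + apply Rmult_le_compat_l; [lra|apply Rmin_r].
      + apply Req_le. field. split; lra. }
  set (z := fun y : re E => minus (double_sine (h + t) y) (double_sine t y)).
  exists (fun n => scal (/ h) (z (u n)) : E). split.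
  - intros n. set (x := u n).
    assert (Hb : norm (minus (z x) (scal h (sine C t x : re E))) <= K * M0 * h * h).
    { unfold z. apply (second_order_bound (E := realify E)
        (fun s => minus (minus (double_sine (s + t) x) (double_sine t x)) (scal s (sine C t x : re E)))
        (fun s => minus (sine C (s + t) x : re E) (sine C t x : re E)) (fun s => C (s + t) x)).
      - intros s. apply (is_derive_eq _ _
          (minus (minus (sine C (s + t) x : re E) zero) (scal 1 (sine C t x : re E)))).
        + apply (is_derive_minus (V := re E)).
          * apply (is_derive_minus (V := re E)); [|apply (is_derive_const (V := re E))].
            apply (is_derive_shift (fun s => double_sine s x)). apply double_sine_derive.
          * apply (is_derive_scal_l (K := R_AbsRing) (V := re E) (fun s => s)).
            apply (is_derive_id (K := R_AbsRing)).
        + vec (re E).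
      - intros s. apply (is_derive_eq _ _ (minus (C (s + t) x : re E) zero)); [|vec (re E)].
        apply (is_derive_minus (V := re E)); [|apply (is_derive_const (V := re E))].
        apply (is_derive_shift (fun s => sine C s x : re E)). apply sine_derive.
      - intros s. apply (continuous_comp (fun s => s + t) (fun s => C s x : re E)); [|apply cof_sc].
        apply continuous_shift.
      - rewrite Rplus_0_l. vec (re E).
      - rewrite Rplus_0_l. vec (re E).
      - intros s Hs. eapply Rle_trans.
        + apply HCK. eapply Rle_trans; [apply Rabs_triang|]. lra.
        + apply Rmult_le_compat_l; [lra|]. apply HuM0.
      - lra. }
    apply (norm_le_eq (E := re E) _
      (scal (- / h) (minus (z x) (scal h (sine C t x : re E))))).
    { change (minus (sine C t x : re E) (scal (/ h) (z x)) =
        scal (- / h) (minus (z x) (scal h (sine C t x : re E)))). vec (re E). }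
    rewrite norm_scal_R, Rabs_Ropp, Rabs_pos_eq by (left; apply Rinv_0_lt_compat; lra).
    apply Rle_trans with (/ h * (K * M0 * h * h)).
    + apply Rmult_le_compat_l; [left; apply Rinv_0_lt_compat; lra|exact Hb].
    + replace (/ h * (K * M0 * h * h)) with (K * M0 * h) by (field; lra). lra.
  - intros phi _. apply (scaled_convergent_subsequence (/ h) (fun n => z (u (phi n)))).
    (* The graph norm of z y is bounded by a multiple of the norm of y, so the compact embedding
       applies to the approximants. *)
    assert (Hdz : forall y, dom T (z y) /\
      T (z y) = minus (C (h + t) y : re E) (C t y : re E)).
    { intros y. destruct (double_sine_domain (h + t) y) as [D1 V1].
      destruct (double_sine_domain t y) as [D2 V2].
      assert (D3 : dom T (scal (-1) (double_sine t y))) by now apply (dom_scal T HT (of_real k (-1))).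
      assert (V3 : T (scal (-1) (double_sine t y)) = scal (-1) (minus (C t y : re E) y)).
      { rewrite <- V2. now apply (app_scal T HT (of_real k (-1))). }
      assert (Hz : z y = plus (double_sine (h + t) y) (scal (-1) (double_sine t y)))
        by (unfold z; vec (re E)).
      rewrite Hz. split; [now apply (dom_plus T HT)|].
      etransitivity; [now apply (app_plus T HT)|]. rewrite V1, V3.
      change (plus (minus (C (h + t) y : re E) (y : re E)) (scal (-1) (minus (C t y : re E) (y : re E)))
        = minus (C (h + t) y : re E) (C t y : re E)). vec (re E). }
    apply Hcomp; [intros n; apply Hdz|].
    destruct (sc_bounded _ double_sine_sc (Rabs t + 1)) as (K2 & HK2 & HJK).
    exists (2 * K2 * M0 + 2 * K * M0). intros n. set (y := u (phi n)).
    assert (Hht : Rabs (h + t) <= Rabs t + 1).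
    { eapply Rle_trans; [apply Rabs_triang|]. rewrite (Rabs_pos_eq h); lra. }
    assert (Hy : norm (y : re E) <= M0) by apply HuM0.
    apply Rplus_le_compat.
    + apply Rle_trans with (K2 * norm (y : re E) + K2 * norm (y : re E)).
      * apply Rle_trans with (norm (double_sine (h + t) y) + norm (double_sine t y)).
        -- apply (norm_minus_le (E := re E)).
        -- apply Rplus_le_compat; apply HJK; lra.
      * assert (K2 * norm (y : re E) <= K2 * M0) by (apply Rmult_le_compat_l; lra). lra.
    + rewrite (proj2 (Hdz y)).
      apply Rle_trans with (K * norm (y : re E) + K * norm (y : re E)).
      * apply Rle_trans with (norm (C (h + t) y : re E) + norm (C t y : re E)).
        -- apply (norm_minus_le (E := re E)).
        -- apply Rplus_le_compat; apply HCK; lra.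
      * assert (K * norm (y : re E) <= K * M0) by (apply Rmult_le_compat_l; lra). lra.
Qed.

End COF.

(** * Perturbation of phase groups *)

Lemma sc_plus {E F : rbanach} (A B : R -> nm E -> nm F) :
  strongly_continuous A -> strongly_continuous B ->
  strongly_continuous (fun t x => plus (A t x) (B t x)).
Proof.
  intros HA HB. split.
  - intros t. assert (H1 := sc_linear A HA t). assert (H2 := sc_linear B HB t).
    apply Build_is_linear.
    + intros x y. rewrite (linear_plus _ H1), (linear_plus _ H2). vec (nm F).
    + intros a x. rewrite (linear_scal _ H1), (linear_scal _ H2). vec (nm F).
    + destruct (linear_norm _ H1) as (M & HM & HAM). destruct (linear_norm _ H2) as (m & Hm & HBm).
      exists (M + m). split; [lra|]. intros x. rewrite Rmult_plus_distr_r.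
      now apply norm_plus_le.
  - intros x t. apply (continuous_plus (V := nm F)); [apply HA|apply HB].
Qed.

(** * Direct sums and summands of groups *)

Section DirectSum.

Context {E E1 E2 : rbanach}.
Variables (i1 : nm E1 -> nm E) (i2 : nm E2 -> nm E) (p1 : nm E -> nm E1) (p2 : nm E -> nm E2).

Hypothesis Hi1 : is_linear i1.
Hypothesis Hi2 : is_linear i2.
Hypothesis Hp1 : is_linear p1.
Hypothesis Hp2 : is_linear p2.
Hypothesis H11 : forall x, p1 (i1 x) = x.
Hypothesis H22 : forall x, p2 (i2 x) = x.
Hypothesis H12 : forall x, p1 (i2 x) = zero.
Hypothesis H21 : forall x, p2 (i1 x) = zero.
Hypothesis Hsum : forall x, plus (i1 (p1 x)) (i2 (p2 x)) = x.

(** Injections and projections are abstract because (V x W) x (X x Y) is the sum of V x X and W x Y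
    only after reordering the factors. *)
Lemma group_direct_sum (U1 : R -> nm E1 -> nm E1) (U2 : R -> nm E2 -> nm E2) :
  c0_group U1 -> c0_group U2 ->
  exists U, c0_group U /\ forall x y, generates U x y <->
    generates U1 (p1 x) (p1 y) /\ generates U2 (p2 x) (p2 y).
Proof.
  intros HU1 HU2.
  set (U := fun t x => plus (i1 (U1 t (p1 x))) (i2 (U2 t (p2 x)))).
  assert (HpU1 : forall t x, p1 (U t x) = U1 t (p1 x)).
  { intros t x. unfold U. rewrite (linear_plus _ Hp1), H11, H12. vec (nm E1). }
  assert (HpU2 : forall t x, p2 (U t x) = U2 t (p2 x)).
  { intros t x. unfold U. rewrite (linear_plus _ Hp2), H22, H21. vec (nm E2). }
  exists U. split; [split|].
  - apply sc_plus.
    + apply (sc_comp (fun _ => i1) (fun t x => U1 t (p1 x))); [now apply sc_const|].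
      apply (sc_comp U1 (fun _ => p1)); [apply HU1|now apply sc_const].
    + apply (sc_comp (fun _ => i2) (fun t x => U2 t (p2 x))); [now apply sc_const|].
      apply (sc_comp U2 (fun _ => p2)); [apply HU2|now apply sc_const].
  - intros x. unfold U. rewrite (group_zero U1 HU1), (group_zero U2 HU2). apply Hsum.
  - intros t s x. unfold U at 1 2.
    now rewrite HpU1, HpU2, (group_plus U1 HU1), (group_plus U2 HU2).
  - intros x y. split.
    + intros H. split.
      * apply (is_derive_ext (fun t => p1 (U t x))); [intros t; apply HpU1|].
        now apply (is_derive_linear p1 (fun t => U t x)).
      * apply (is_derive_ext (fun t => p2 (U t x))); [intros t; apply HpU2|].
        now apply (is_derive_linear p2 (fun t => U t x)).
    + intros [H1 H2]. apply (is_derive_eq _ _ (plus (i1 (p1 y)) (i2 (p2 y)))); [|apply Hsum].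
      apply (is_derive_plus (V := nm E)).
      * now apply (is_derive_linear i1 (fun t => U1 t (p1 x))).
      * now apply (is_derive_linear i2 (fun t => U2 t (p2 x))).
Qed.

End DirectSum.

(** The projection i p preserves the generator, hence commutes with [U], and p U i inherits the
    group law. *)
Lemma group_summand {E E1 : rbanach} (i : nm E1 -> nm E) (p : nm E -> nm E1)
  (U : R -> nm E -> nm E) :
  c0_group U -> is_linear i -> is_linear p -> (forall x, p (i x) = x) ->
  (forall x y, generates U x y -> generates U (i (p x)) (i (p y))) ->
  exists U1, c0_group U1 /\ forall x y, generates U1 x y <-> generates U (i x) (i y).
Proof.
  intros HU Hi Hp Hpi Hg.
  assert (Hc : forall t x, i (p (U t x)) = U t (i (p x))).
  { apply (group_intertwine U U (fun x => i (p x)) HU HU); [|exact Hg].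
    now apply (is_linear_comp p i). }
  exists (fun t x => p (U t (i x))). split; [split|].
  - apply (sc_comp (fun _ => p) (fun t x => U t (i x))); [now apply sc_const|].
    apply (sc_comp U (fun _ => i)); [apply HU|now apply sc_const].
  - intros x. now rewrite (group_zero U HU).
  - intros t s x. now rewrite Hc, Hpi, (group_plus U HU).
  - intros x y. unfold generates. split; intros H.
    + apply (is_derive_ext (fun t => i (p (U t (i x))))).
      * intros t. now rewrite Hc, Hpi.
      * now apply (is_derive_linear i (fun t => p (U t (i x)))).
    + apply (is_derive_eq _ _ (p (i y))); [|apply Hpi].
      now apply (is_derive_linear p (fun t => U t (i x))).
Qed.

(** * Adding and removing the two kinds of perturbation *)

Section Perturbation.

Context {k : scalar_field} {E F : banach k}.

Lemma linear_operator_ext (T T' : operator E E) :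
  (forall x, dom T x <-> dom T' x) -> (forall x, dom T x -> T x = T' x) ->
  linear_operator T -> linear_operator T'.
Proof.
  intros Hd HTT HT. split.
  - apply Hd, (dom_zero T HT).
  - intros x y Hx Hy. apply Hd, (dom_plus T HT); now apply Hd.
  - intros a x Hx. apply Hd, (dom_scal T HT); now apply Hd.
  - intros x y Hx Hy. apply Hd in Hx, Hy.
    rewrite <- !HTT by (try apply (dom_plus T HT); assumption). now apply (app_plus T HT).
  - intros a x Hx. apply Hd in Hx.
    rewrite <- !HTT by (try apply (dom_scal T HT); assumption). now apply (app_scal T HT).
Qed.

Lemma perturbed_linear (T : operator E E) (B : E -> E) :
  linear_operator T ->
  (forall x y, dom T x -> dom T y -> B (plus x y) = plus (B x) (B y)) ->
  (forall (a : k) x, dom T x -> B (scal a x) = scal a (B x)) ->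
  linear_operator (perturbed T B).
Proof.
  intros HT Bp Bs. split.
  - apply (dom_zero T HT).
  - apply (dom_plus T HT).
  - apply (dom_scal T HT).
  - intros x y Hx Hy. simpl in *. rewrite Bp, (app_plus T HT) by assumption.
    change (plus (plus (T x : re E) (T y)) (plus (B x) (B y))
      = plus (plus (T x : re E) (B x)) (plus (T y : re E) (B y))). vec (re E).
  - intros a x Hx. simpl in *. rewrite Bs, (app_scal T HT) by assumption.
    symmetry. exact (scal_distr_l a (T x) (B x)).
Qed.

Lemma is_linear_opp_comp (L : F -> E) : is_linear L -> is_linear (fun v => opp (L v)).
Proof.
  intros HL. apply (is_linear_comp L (fun x : E => opp x)); [exact HL|].
  apply (is_linear_opp (V := nm E)).
Qed.

Variables (T : operator E E) (j : F -> E) (B1 B2 : E -> E) (M : R).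

Hypothesis HT : linear_operator T.
Hypothesis HTc : sequentially_closed T.
Hypothesis Hj : continuous_embedding j.
Hypothesis Hd : domain_embeds T j.
Hypothesis B1_plus : forall x y, dom T x -> dom T y -> B1 (plus x y) = plus (B1 x) (B1 y).
Hypothesis B1_scal : forall (a : k) x, dom T x -> B1 (scal a x) = scal a (B1 x).
Hypothesis B1_bound : forall x, dom T x -> exists v, j v = B1 x /\ norm v <= M * graph_norm T x.
Hypothesis B2_linear : is_linear (fun v => B2 (j v)).

Let T1 := perturbed T B1.
Let T2 := perturbed T1 B2.

Lemma domain_in_range (x : E) : dom T x -> exists v, j v = x.
Proof. intros Hx. destruct Hd as [m Hm]. destruct (Hm x Hx) as (v & Hv & _). now exists v. Qed.

Lemma perturbed1_linear : linear_operator T1.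
Proof. now apply perturbed_linear. Qed.

Lemma perturbed2_linear : linear_operator T2.
Proof.
  apply perturbed_linear; [apply perturbed1_linear|..].
  - intros x y Hx Hy. destruct (domain_in_range x Hx) as [v <-].
    destruct (domain_in_range y Hy) as [w <-].
    rewrite <- (linear_plus _ (proj1 Hj)). apply (linear_plus _ B2_linear).
  - intros a x Hx. destruct (domain_in_range x Hx) as [v <-].
    rewrite <- (linear_scal _ (proj1 Hj)). apply (linear_scal _ B2_linear).
Qed.

Lemma graph_norm_pos (S : operator E E) (x : E) : 0 <= graph_norm S x.
Proof. unfold graph_norm. generalize (norm_ge_0 x) (norm_ge_0 (S x)). lra. Qed.

(** Half of the equivalence of graph norms needed to transfer compactness of the domain embedding;
    the other half is a closed graph argument. *)
Lemma perturbed_graph_norm_le :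
  exists m, 0 <= m /\ forall x, dom T x -> graph_norm T2 x <= m * graph_norm T x.
Proof.
  destruct Hd as [m Hm].
  destruct (linear_norm _ (proj1 Hj)) as (c & Hc & Hjc).
  destruct (linear_norm _ B2_linear) as (b & Hb & HBb).
  exists (1 + c * Rabs M + b * Rabs m). split.
  { generalize (Rmult_le_pos c (Rabs M)) (Rmult_le_pos b (Rabs m)) (Rabs_pos m) (Rabs_pos M). lra. }
  intros x Hx. assert (Hg := graph_norm_pos T x).
  destruct (B1_bound x Hx) as (w & Hw & Hwn).
  assert (H1 : norm (B1 x) <= c * (Rabs M * graph_norm T x)).
  { rewrite <- Hw. eapply Rle_trans; [apply Hjc|]. apply Rmult_le_compat_l; [lra|].
    eapply Rle_trans; [exact Hwn|]. apply Rmult_le_compat_r; [exact Hg|apply Rle_abs]. }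
  assert (H2 : norm (B2 x) <= b * (Rabs m * graph_norm T x)).
  { destruct (Hm x Hx) as (v & Hv & Hvn). rewrite <- Hv at 1.
    eapply Rle_trans; [apply HBb|]. apply Rmult_le_compat_l; [lra|].
    eapply Rle_trans; [exact Hvn|]. apply Rmult_le_compat_r; [exact Hg|apply Rle_abs]. }
  assert (H3 : norm (T2 x) <= norm (T x) + norm (B1 x) + norm (B2 x)).
  { apply (norm_plus_le (E := nm E)); [|apply Rle_refl].
    apply (norm_plus_le (E := nm E)); apply Rle_refl. }
  unfold graph_norm in *.
  replace ((1 + c * Rabs M + b * Rabs m) * (norm x + norm (T x)))
    with (norm x + norm (T x) + c * (Rabs M * (norm x + norm (T x)))
          + b * (Rabs m * (norm x + norm (T x)))) by ring.
  lra.
Qed.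

Lemma phase_perturbation :
  (exists U, phase_group T j U) -> exists U, phase_group T2 j U.
Proof.
  intros [U HU].
  destruct (phase_domain_perturbation T j U HT Hj HU B1 M B1_plus B1_scal B1_bound) as [U1 HU1].
  now apply (phase_bounded_perturbation T1 j U1 HU1).
Qed.

(** [B2] is removed first, since its bound refers only to the norm of F. The bound on [B1] refers to
    the graph norm of [T] and must be restated in that of [T1]; comparing the closed operator [T]
    with the phase group of [T1] achieves this. *)
Lemma phase_perturbation_inverse :
  (exists U, phase_group T2 j U) -> exists U, phase_group T j U.
Proof.
  intros [U2 HU2].
  destruct (phase_bounded_perturbation T2 j U2 HU2 (fun x => opp (B2 x))) as [U1 HU1'].
  { now apply (is_linear_opp_comp (fun v => B2 (j v))). }
  assert (HU1 : phase_group T1 j U1).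
  { apply (phase_group_ext (perturbed T2 (fun x => opp (B2 x)))); [reflexivity| |exact HU1'].
    intros x _. simpl.
    change (plus (plus (plus (T x : re E) (B1 x)) (B2 x)) (opp (B2 x : re E))
      = plus (T x : re E) (B1 x)). vec (re E). }
  assert (HT1 := perturbed1_linear).
  (* The embedding bound in the graph norm of [T1] comes from its phase group; only the inclusion of
     domains is inherited from [T]. *)
  assert (Hd1 : domain_embeds T1 j).
  { apply (phase_domain_embeds T1 j HT1 Hj U1 HU1). exact domain_in_range. }
  destruct (closed_operator_bounded_by_graph_norm T1 j U1 Hj HU1 T Hd1 HT HTc (fun x Hx => Hx))
    as [m Hm].
  destruct (phase_domain_perturbation T1 j U1 HT1 Hj HU1 (fun x => opp (B1 x))
    (Rabs M * (1 + Rabs m))) as [U HU].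
  - intros x y Hx Hy. rewrite B1_plus by assumption. exact (opp_plus (B1 x) (B1 y)).
  - intros a x Hx. rewrite B1_scal by assumption. symmetry. exact (scal_opp_r a (B1 x)).
  - intros x Hx. destruct (B1_bound x Hx) as (v & Hv & Hn). exists (opp v). split.
    + rewrite <- Hv. apply (linear_opp _ _ (proj1 Hj)).
    + replace (norm (opp v)) with (norm v) by (symmetry; exact (norm_opp v)).
      eapply Rle_trans; [exact Hn|].
      apply Rle_trans with (Rabs M * graph_norm T x).
      * apply Rmult_le_compat_r; [apply graph_norm_pos|apply Rle_abs].
      * rewrite Rmult_assoc. apply Rmult_le_compat_l; [apply Rabs_pos|].
        specialize (Hm x Hx). assert (Hg := graph_norm_pos T1 x).
        assert (Hmm : m * graph_norm T1 x <= Rabs m * graph_norm T1 x)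
          by (apply Rmult_le_compat_r; [exact Hg|apply Rle_abs]).
        unfold graph_norm at 1.
        assert (Hxx : norm x <= graph_norm T1 x).
        { unfold graph_norm. generalize (norm_ge_0 (T1 x)). lra. }
        lra.
  - exists U. apply (phase_group_ext (perturbed T1 (fun x => opp (B1 x)))); [reflexivity| |exact HU].
    intros x _. simpl.
    change (plus (plus (T x : re E) (B1 x)) (opp (B1 x : re E)) = (T x : re E)). vec (re E).
Qed.

End Perturbation.

Lemma compact_embedding_compare {k : scalar_field} {E : banach k} (T T' : operator E E) (m : R) :
  (forall x, dom T' x -> dom T x /\ graph_norm T x <= m * graph_norm T' x) ->
  compact_domain_embedding T -> compact_domain_embedding T'.
Proof.
  intros H HT u Hu [M HM]. apply HT; [intros n; now apply H|].
  exists (Rabs m * M). intros n. eapply Rle_trans; [now apply H|].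
  apply Rle_trans with (Rabs m * graph_norm T' (u n)).
  - apply Rmult_le_compat_r; [apply graph_norm_pos|apply Rle_abs].
  - apply Rmult_le_compat_l; [apply Rabs_pos|apply HM].
Qed.

(** * Operator matrices *)

Section Matrix.

Context {k : scalar_field} {X Y V W : banach k}.

Definition diagonal_operator (A : operator X X) (D : operator Y Y) :
  operator (X \x Y) (X \x Y) :=
  Operator (fun p => dom A (fst p) /\ dom D (snd p)) (fun p => (A (fst p), D (snd p))).

Variables (A : operator X X) (D : operator Y Y) (jV : V -> X) (jW : W -> Y).

Lemma pair_linear {Z Z1 Z2 : banach k} (f : Z -> Z1) (g : Z -> Z2) :
  is_linear f -> is_linear g -> is_linear ((fun z => (f z, g z)) : Z -> Z1 \x Z2).
Proof. apply (is_linear_prod (T := nm Z) (U := nm Z1) (V := nm Z2)). Qed.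

Lemma fst_linear {Z1 Z2 : banach k} : is_linear (fst : Z1 \x Z2 -> Z1).
Proof. apply (is_linear_fst (U := nm Z1) (V := nm Z2)). Qed.

Lemma snd_linear {Z1 Z2 : banach k} : is_linear (snd : Z1 \x Z2 -> Z2).
Proof. apply (is_linear_snd (U := nm Z1) (V := nm Z2)). Qed.

Lemma prod_map_embedding :
  continuous_embedding jV -> continuous_embedding jW ->
  continuous_embedding (prod_map jV jW : V \x W -> X \x Y).
Proof.
  intros [HV1 HV2] [HW1 HW2]. split.
  - apply (pair_linear (fun p : V \x W => jV (fst p)) (fun p => jW (snd p))).
    + apply (is_linear_comp (fst : V \x W -> V) jV); [apply fst_linear|exact HV1].
    + apply (is_linear_comp (snd : V \x W -> W) jW); [apply snd_linear|exact HW1].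
  - intros [v w] [v' w'] H. injection H. intros Hw Hv.
    f_equal; [now apply HV2|now apply HW2].
Qed.

Lemma graph_norm_diagonal_fst (p : X \x Y) :
  graph_norm A (fst p) <= graph_norm (diagonal_operator A D) p.
Proof.
  unfold graph_norm. apply Rplus_le_compat; [apply norm_fst_le|].
  apply (norm_fst_le (diagonal_operator A D p)).
Qed.

Lemma graph_norm_diagonal_snd (p : X \x Y) :
  graph_norm D (snd p) <= graph_norm (diagonal_operator A D) p.
Proof.
  unfold graph_norm. apply Rplus_le_compat; [apply norm_snd_le|].
  apply (norm_snd_le (diagonal_operator A D p)).
Qed.

Lemma diagonal_domain_embeds :
  domain_embeds A jV -> domain_embeds D jW ->
  domain_embeds (diagonal_operator A D) (prod_map jV jW : V \x W -> X \x Y).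
Proof.
  intros [M HM] [m Hm]. exists (Rabs M + Rabs m). intros [x y] [Hx Hy].
  destruct (HM x Hx) as (v & <- & Hv). destruct (Hm y Hy) as (w & <- & Hw).
  exists (v, w). split; [reflexivity|].
  eapply Rle_trans; [apply norm_pair_le|]. rewrite Rmult_plus_distr_r.
  apply Rplus_le_compat.
  - eapply Rle_trans; [exact Hv|].
    apply Rle_trans with (Rabs M * graph_norm A (jV v)).
    + apply Rmult_le_compat_r; [apply graph_norm_pos|apply Rle_abs].
    + apply Rmult_le_compat_l; [apply Rabs_pos|].
      apply (graph_norm_diagonal_fst (jV v, jW w)).
  - eapply Rle_trans; [exact Hw|].
    apply Rle_trans with (Rabs m * graph_norm D (jW w)).
    + apply Rmult_le_compat_r; [apply graph_norm_pos|apply Rle_abs].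
    + apply Rmult_le_compat_l; [apply Rabs_pos|].
      apply (graph_norm_diagonal_snd (jV v, jW w)).
Qed.

Lemma diagonal_linear :
  linear_operator A -> linear_operator D -> linear_operator (diagonal_operator A D).
Proof.
  intros HA HD. split.
  - split; [apply (dom_zero A HA)|apply (dom_zero D HD)].
  - intros p q [H1 H2] [H3 H4]. split; [now apply (dom_plus A HA)|now apply (dom_plus D HD)].
  - intros a p [H1 H2]. split; [now apply (dom_scal A HA)|now apply (dom_scal D HD)].
  - intros p q [H1 H2] [H3 H4]. apply injective_projections;
      [now apply (app_plus A HA)|now apply (app_plus D HD)].
  - intros a p [H1 H2]. apply injective_projections;
      [now apply (app_scal A HA)|now apply (app_scal D HD)].
Qed.

Lemma tends_fst (u : nat -> X \x Y) (p : X \x Y) : tends u p -> tends (fun n => fst (u n)) (fst p).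
Proof. apply (tends_linear (fst : X \x Y -> X)), fst_linear. Qed.

Lemma tends_snd (u : nat -> X \x Y) (p : X \x Y) : tends u p -> tends (fun n => snd (u n)) (snd p).
Proof. apply (tends_linear (snd : X \x Y -> Y)), snd_linear. Qed.

Lemma diagonal_sequentially_closed :
  sequentially_closed A -> sequentially_closed D -> sequentially_closed (diagonal_operator A D).
Proof.
  intros HA HD u p q Hu Hp Hq.
  destruct (HA (fun n => fst (u n)) (fst p) (fst q)) as [H1 H2].
  - intros n. apply Hu.
  - now apply tends_fst.
  - apply (tends_fst _ _ Hq).
  - destruct (HD (fun n => snd (u n)) (snd p) (snd q)) as [H3 H4].
    + intros n. apply Hu.
    + now apply tends_snd.
    + apply (tends_snd _ _ Hq).
    + split; [now split|]. now apply injective_projections.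
Qed.

Lemma diagonal_compact_embedding :
  linear_operator A -> linear_operator D ->
  compact_domain_embedding (diagonal_operator A D) <->
  compact_domain_embedding A /\ compact_domain_embedding D.
Proof.
  intros HA HD.
  assert (HA0 := operator_zero A HA).
  assert (HD0 := operator_zero D HD).
  split.
  - intros H. split.
    + intros u Hu [M HM]. destruct (H (fun n => (u n, zero))) as (phi & Hphi & l & Hl).
      * intros n. split; [apply Hu|apply (dom_zero D HD)].
      * exists M. intros n. eapply Rle_trans; [|apply (HM n)].
        unfold graph_norm. apply Rplus_le_compat; simpl.
        -- apply norm_pair_zero_r_le.
        -- rewrite HD0. apply norm_pair_zero_r_le.
      * exists phi. split; [exact Hphi|]. exists (fst l). apply (tends_fst _ _ Hl).
    + intros u Hu [M HM]. destruct (H (fun n => (zero, u n))) as (phi & Hphi & l & Hl).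
      * intros n. split; [apply (dom_zero A HA)|apply Hu].
      * exists M. intros n. eapply Rle_trans; [|apply (HM n)].
        unfold graph_norm. apply Rplus_le_compat; simpl.
        -- apply (norm_pair_zero_le (u n)).
        -- rewrite HA0. apply (norm_pair_zero_le (D (u n))).
      * exists phi. split; [exact Hphi|]. exists (snd l). apply (tends_snd _ _ Hl).
  - intros [H1 H2] u Hu [M HM].
    destruct (H1 (fun n => fst (u n))) as (phi & Hphi & x & Hx).
    + intros n. apply Hu.
    + exists M. intros n. eapply Rle_trans; [apply graph_norm_diagonal_fst|apply HM].
    + destruct (H2 (fun n => snd (u (phi n)))) as (psi & Hpsi & y & Hy).
      * intros n. apply Hu.
      * exists M. intros n. eapply Rle_trans; [apply graph_norm_diagonal_snd|apply HM].
      * exists (fun n => phi (psi n)). split; [now apply strictly_increasing_comp|].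
        exists (x, y).
        assert (Hx' : tends (fun n => fst (u (phi (psi n)))) x).
        { apply tends_iff. intros eps He. destruct (proj1 (tends_iff _ _) Hx eps He) as [N HN].
          exists N. intros n Hn. apply HN.
          generalize (strictly_increasing_ge psi Hpsi n). lia. }
        apply (filterlim_ext (fun n => (fst (u (phi (psi n))), snd (u (phi (psi n)))))).
        { intros n. symmetry. apply surjective_pairing. }
        now apply (tends_pair (F := X) (E := Y)).
Qed.

(** [i1], [i2], [p1] and [p2] realize the reordering of the phase space of the matrix into those of
    [A] and [D]. *)
Let i1 (p : V \x X) : (V \x W) \x (X \x Y) := ((fst p, zero), (snd p, zero)).
Let i2 (p : W \x Y) : (V \x W) \x (X \x Y) := ((zero, fst p), (zero, snd p)).
Let p1 (p : (V \x W) \x (X \x Y)) : V \x X := (fst (fst p), fst (snd p)).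
Let p2 (p : (V \x W) \x (X \x Y)) : W \x Y := (snd (fst p), snd (snd p)).

Let zero_linear {Z Z' : banach k} : is_linear (fun _ : Z => zero : Z').
Proof. apply (is_linear_zero (U := nm Z) (V := nm Z')). Qed.

Let i1_linear : is_linear (i1 : re (V \x X) -> re ((V \x W) \x (X \x Y))).
Proof.
  apply realify_linear.
  apply (pair_linear (fun p : V \x X => (fst p, zero) : V \x W) (fun p => (snd p, zero) : X \x Y)).
  - apply (pair_linear (fst : V \x X -> V)); [apply fst_linear|apply zero_linear].
  - apply (pair_linear (snd : V \x X -> X)); [apply snd_linear|apply zero_linear].
Qed.

Let i2_linear : is_linear (i2 : re (W \x Y) -> re ((V \x W) \x (X \x Y))).
Proof.
  apply realify_linear.
  apply (pair_linear (fun p : W \x Y => (zero, fst p) : V \x W) (fun p => (zero, snd p) : X \x Y)).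
  - apply (pair_linear (fun _ : W \x Y => zero) (fst : W \x Y -> W)); [apply zero_linear|apply fst_linear].
  - apply (pair_linear (fun _ : W \x Y => zero) (snd : W \x Y -> Y)); [apply zero_linear|apply snd_linear].
Qed.

Let p1_linear : is_linear (p1 : re ((V \x W) \x (X \x Y)) -> re (V \x X)).
Proof.
  apply realify_linear.
  apply (pair_linear (fun p : (V \x W) \x (X \x Y) => fst (fst p)) (fun p => fst (snd p))).
  - apply (is_linear_comp (fst : (V \x W) \x (X \x Y) -> V \x W) (fst : V \x W -> V)); apply fst_linear.
  - apply (is_linear_comp (snd : (V \x W) \x (X \x Y) -> X \x Y) (fst : X \x Y -> X));
      [apply snd_linear|apply fst_linear].
Qed.

Let p2_linear : is_linear (p2 : re ((V \x W) \x (X \x Y)) -> re (W \x Y)).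
Proof.
  apply realify_linear.
  apply (pair_linear (fun p : (V \x W) \x (X \x Y) => snd (fst p)) (fun p => snd (snd p))).
  - apply (is_linear_comp (fst : (V \x W) \x (X \x Y) -> V \x W) (snd : V \x W -> W));
      [apply fst_linear|apply snd_linear].
  - apply (is_linear_comp (snd : (V \x W) \x (X \x Y) -> X \x Y) (snd : X \x Y -> Y)); apply snd_linear.
Qed.

Lemma phase_diagonal :
  (exists U, phase_group A jV U) -> (exists U, phase_group D jW U) ->
  exists U, phase_group (diagonal_operator A D) (prod_map jV jW : V \x W -> X \x Y) U.
Proof.
  intros (U1 & HU1 & HG1) (U2 & HU2 & HG2).
  destruct (group_direct_sum (E := realify ((V \x W) \x (X \x Y))) (E1 := realify (V \x X))
    (E2 := realify (W \x Y)) i1 i2 p1 p2 i1_linear i2_linear p1_linear p2_linear) with (U1 := U1) (U2 := U2)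
    as (U & HU & HG).
  - now intros [v x].
  - now intros [w y].
  - now intros [w y].
  - now intros [v x].
  - intros [[v w] [x y]].
    apply injective_projections; apply injective_projections; simpl.
    + exact (plus_zero_r v).
    + exact (plus_zero_l w).
    + exact (plus_zero_r x).
    + exact (plus_zero_l y).
  - exact HU1.
  - exact HU2.
  - exists U. split; [exact HU|]. intros [v w] [x y] [v' w'] [x' y'].
    rewrite HG. unfold p1, p2. simpl fst. simpl snd. rewrite HG1, HG2. simpl. split.
    + intros ((H1 & H2 & H3) & (H4 & H5 & H6)). subst. repeat split; assumption.
    + intros ((H1 & H4) & H2 & H3). injection H2. injection H3. intros. now repeat split.
Qed.

Hypothesis HA : linear_operator A.
Hypothesis HD : linear_operator D.
Hypothesis HV : continuous_embedding jV.
Hypothesis HW : continuous_embedding jW.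

Lemma phase_diagonal_components :
  (exists U, phase_group (diagonal_operator A D) (prod_map jV jW : V \x W -> X \x Y) U) ->
  (exists U, phase_group A jV U) /\ (exists U, phase_group D jW U).
Proof.
  intros (U & HU & HG).
  assert (HA0 := operator_zero A HA).
  assert (HD0 := operator_zero D HD).
  assert (HV0 : jV zero = zero) by exact (linear_zero _ (proj1 HV)).
  assert (HW0 : jW zero = zero) by exact (linear_zero _ (proj1 HW)).
  (* The generator relation is a conjunction of independent relations on the two blocks, so setting
     one block to zero preserves it. *)
  assert (Hdec : forall p q, generates U p q <->
    (dom A (jV (fst (p1 p))) /\ jV (fst (p1 q)) = snd (p1 p) /\ A (jV (fst (p1 p))) = snd (p1 q)) /\
    (dom D (jW (fst (p2 p))) /\ jW (fst (p2 q)) = snd (p2 p) /\ D (jW (fst (p2 p))) = snd (p2 q))).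
  { intros [[v w] [x y]] [[v' w'] [x' y']]. rewrite HG. simpl. split.
    - intros ((H1 & H4) & H2 & H3). injection H2. injection H3. intros. now repeat split.
    - intros ((H1 & H2 & H3) & (H4 & H5 & H6)). subst. repeat split; assumption. }
  split.
  - destruct (group_summand (E := realify ((V \x W) \x (X \x Y))) (E1 := realify (V \x X))
      i1 p1 U HU i1_linear p1_linear) as (U1 & HU1 & HG1).
    + now intros [v x].
    + intros p q H. apply Hdec in H. apply Hdec. destruct H as [H _]. split; [exact H|]. simpl.
      rewrite HW0, HD0. split; [apply (dom_zero D HD)|]. now split.
    + exists U1. split; [exact HU1|]. intros v e v' e'. rewrite HG1, Hdec. simpl. split.
      * now intros [H _].
      * intros H. split; [exact H|]. rewrite HW0, HD0. split; [apply (dom_zero D HD)|]. now split.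
  - destruct (group_summand (E := realify ((V \x W) \x (X \x Y))) (E1 := realify (W \x Y))
      i2 p2 U HU i2_linear p2_linear) as (U2 & HU2 & HG2).
    + now intros [w y].
    + intros p q H. apply Hdec in H. apply Hdec. destruct H as [_ H]. split; [|exact H]. simpl.
      rewrite HV0, HA0. split; [apply (dom_zero A HA)|]. now split.
    + exists U2. split; [exact HU2|]. intros w e w' e'. rewrite HG2, Hdec. simpl. split.
      * now intros [_ H].
      * intros H. split; [|exact H]. rewrite HV0, HA0. split; [apply (dom_zero A HA)|]. now split.
Qed.

End Matrix.

(** Makes the two alternatives uniform: [H1] carries the bound from the domain, [H2] the bound from
    the subspace, and the one not provided is zero. *)
Lemma off_diagonal_splitting {k : scalar_field} {X Y V W : banach k}
  (D : operator Y Y) (H : operator Y X) (jV : V -> X) (jW : W -> Y) :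
  linear_operator H -> is_linear jV -> is_linear jW ->
  bounded_from_domain D H jV \/ bounded_from_subspace jW H ->
  exists H1 H2 : Y -> X,
    (forall y, H y = plus (H1 y) (H2 y)) /\
    (forall y y', dom D y -> dom D y' -> H1 (plus y y') = plus (H1 y) (H1 y')) /\
    (forall (a : k) y, dom D y -> H1 (scal a y) = scal a (H1 y)) /\
    (exists M, 0 <= M /\ forall y, dom D y ->
      exists v, jV v = H1 y /\ norm v <= M * graph_norm D y) /\
    is_linear (fun w => H2 (jW w)).
Proof.
  intros HH HV HW [[M HM]|[M HM]].
  - exists H, (fun _ => zero). split; [|split; [|split; [|split]]].
    + intros y. symmetry. exact (plus_zero_r (H y)).
    + intros y y' Hy Hy'. apply (app_plus H HH); now apply HM.
    + intros a y Hy. apply (app_scal H HH). now apply HM.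
    + exists (Rabs M). split; [apply Rabs_pos|]. intros y Hy.
      destruct (HM y Hy) as (_ & v & Hv & Hn). exists v. split; [exact Hv|].
      eapply Rle_trans; [exact Hn|].
      apply Rmult_le_compat_r; [apply graph_norm_pos|apply Rle_abs].
    + apply (is_linear_zero (U := nm W) (V := nm X)).
  - exists (fun _ => zero), H. split; [|split; [|split; [|split]]].
    + intros y. symmetry. exact (plus_zero_l (H y)).
    + intros y y' _ _. symmetry. exact (plus_zero_l (zero : X)).
    + intros a y _. symmetry. exact (scal_zero_r a (V := X)).
    + exists 0. split; [lra|]. intros y _. exists zero. split; [exact (linear_zero _ HV)|].
      rewrite Rmult_0_l. apply Req_le. exact (norm_zero (V := nm V)).
    + apply Build_is_linear.
      * intros w w'. rewrite (linear_plus _ HW). apply (app_plus H HH); apply HM.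
      * intros a w. rewrite (linear_scal _ HW). apply (app_scal H HH). apply HM.
      * exists (Rabs M + 1). split; [generalize (Rabs_pos M); lra|]. intros w.
        eapply Rle_trans; [apply HM|]. apply Rmult_le_compat_r; [apply (norm_ge_0 (V := nm W))|].
        generalize (Rle_abs M). lra.
Qed.

Theorem proposition3p2 :
  forall (k : scalar_field) (X Y V W : banach k)
    (A : operator X X) (D : operator Y Y)
    (H : operator Y X) (K : operator X Y)
    (jV : V -> X) (jW : W -> Y),
  closed_operator A -> closed_operator D ->
  continuous_embedding jV -> domain_embeds A jV ->
  continuous_embedding jW -> domain_embeds D jW ->
  linear_operator H ->
  (bounded_from_domain D H jV \/ bounded_from_subspace jW H) ->
  linear_operator K ->
  (bounded_from_domain A K jW \/ bounded_from_subspace jV K) ->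
  (generates_cof_with_phase_space (operator_matrix A H K D) (prod_map jV jW)
   <->
   (generates_cof_with_phase_space A jV /\
    generates_cof_with_phase_space D jW)) /\
  (generates_cof_with_phase_space (operator_matrix A H K D) (prod_map jV jW) ->
   forall C : R -> X \x Y -> X \x Y,
   cof_generated_by (operator_matrix A H K D) C ->
   ((forall t : R, compact_operator (sine C t)) <->
    (compact_domain_embedding A /\ compact_domain_embedding D))).
Proof.
  intros k X Y V W A D H K jV jW HA HD HV HAV HW HDW HH HHb HK HKb.
  assert (HAl := proj1 HA). assert (HDl := proj1 HD).
  destruct (off_diagonal_splitting D H jV jW HH (proj1 HV) (proj1 HW) HHb)
    as (H1 & H2 & HH12 & H1p & H1s & (MH & HMH & H1b) & H2l).
  destruct (off_diagonal_splitting A K jW jV HK (proj1 HW) (proj1 HV) HKb)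
    as (K1 & K2 & HK12 & K1p & K1s & (MK & HMK & K1b) & K2l).
  set (T := diagonal_operator A D).
  set (j := prod_map jV jW : V \x W -> X \x Y).
  (* [B1] collects the parts of H and K bounded from the domains, [B2] those bounded from the
     intermediate spaces. *)
  set (B1 := (fun p => (H1 (snd p), K1 (fst p))) : X \x Y -> X \x Y).
  set (B2 := (fun p => (H2 (snd p), K2 (fst p))) : X \x Y -> X \x Y).
  set (T2 := perturbed (perturbed T B1) B2).
  assert (HT : linear_operator T) by now apply diagonal_linear.
  assert (HTc : sequentially_closed T)
    by now apply diagonal_sequentially_closed; apply closed_sequentially_closed.
  assert (Hj : continuous_embedding j) by now apply prod_map_embedding.
  assert (Hd : domain_embeds T j) by now apply diagonal_domain_embeds.
  assert (B1p : forall p q, dom T p -> dom T q -> B1 (plus p q) = plus (B1 p) (B1 q)).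
  { intros p q [Hp1 Hp2] [Hq1 Hq2]. apply injective_projections; [now apply H1p|now apply K1p]. }
  assert (B1s : forall (a : k) p, dom T p -> B1 (scal a p) = scal a (B1 p)).
  { intros a p [Hp1 Hp2]. apply injective_projections; [now apply H1s|now apply K1s]. }
  assert (B1b : forall p, dom T p -> exists v, j v = B1 p /\ norm v <= (MH + MK) * graph_norm T p).
  { intros p [Hp1 Hp2]. destruct (H1b _ Hp2) as (v & Hv & Hvn). destruct (K1b _ Hp1) as (w & Hw & Hwn).
    exists (v, w). split; [apply injective_projections; assumption|].
    eapply Rle_trans; [apply norm_pair_le|]. rewrite Rmult_plus_distr_r.
    apply Rplus_le_compat.
    - eapply Rle_trans; [exact Hvn|]. apply Rmult_le_compat_l; [exact HMH|].
      apply graph_norm_diagonal_snd.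
    - eapply Rle_trans; [exact Hwn|]. apply Rmult_le_compat_l; [exact HMK|].
      apply graph_norm_diagonal_fst. }
  assert (B2l : is_linear (fun v => B2 (j v))).
  { apply (pair_linear (fun p : V \x W => H2 (jW (snd p))) (fun p => K2 (jV (fst p)))).
    - apply (is_linear_comp (snd : V \x W -> W) (fun w => H2 (jW w))); [apply snd_linear|exact H2l].
    - apply (is_linear_comp (fst : V \x W -> V) (fun v => K2 (jV v))); [apply fst_linear|exact K2l]. }
  assert (HT2 : linear_operator T2) by now apply (perturbed2_linear T j B1 B2).
  set (M := operator_matrix A H K D).
  assert (HMT : forall p, M p = T2 p).
  { intros [x y]. apply injective_projections; simpl.
    - rewrite HH12. exact (plus_assoc (A x) (H1 y) (H2 y)).
    - rewrite HK12.
      change (plus (plus (K1 x : re Y) (K2 x)) (D y) = plus (plus (D y : re Y) (K1 x)) (K2 x)).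
      vec (re Y). }
  assert (HM : linear_operator M).
  { apply (linear_operator_ext T2); [reflexivity| |exact HT2]. intros p _. symmetry. apply HMT. }
  assert (HMphase : (exists U, phase_group M j U) <-> exists U, phase_group T2 j U).
  { split; intros [U HU]; exists U.
    - apply (phase_group_ext M T2 j U); [reflexivity|intros p _; apply HMT|exact HU].
    - apply (phase_group_ext T2 M j U); [reflexivity|intros p _; symmetry; apply HMT|exact HU]. }
  assert (Hrange : forall p, dom M p -> exists v, j v = p).
  { intros p Hp. now apply (domain_in_range T j Hd). }
  split; [split|].
  - intros [_ _ _ HS]. apply (phase_group_iff M j HM Hj) in HS.
    apply HMphase in HS.
    apply (phase_perturbation_inverse T j B1 B2 (MH + MK) HT HTc Hj Hd B1p B1s B1b B2l) in HS.
    apply (phase_diagonal_components A D jV jW HAl HDl HV HW) in HS.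
    destruct HS as [[UA HUA] [UD HUD]]. split.
    + split; auto.
      * now apply (phase_generates_cof A jV UA).
      * apply (phase_group_iff A jV HAl HV). now exists UA.
    + split; auto.
      * now apply (phase_generates_cof D jW UD).
      * apply (phase_group_iff D jW HDl HW). now exists UD.
  - intros [[_ _ _ HSA] [_ _ _ HSD]].
    apply (phase_group_iff A jV HAl HV) in HSA. apply (phase_group_iff D jW HDl HW) in HSD.
    assert (HS : exists U, phase_group M j U).
    { apply HMphase.
      apply (phase_perturbation T j B1 B2 (MH + MK) HT Hj B1p B1s B1b B2l).
      now apply phase_diagonal. }
    destruct HS as [U HU].
    (* The bound is deduced from the group of the matrix rather than from the bounds for [A] and
       [D]. *)
    assert (HMd : domain_embeds M j) by now apply (phase_domain_embeds M j HM Hj U HU).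
    split; auto.
    + now apply (phase_generates_cof M j U).
    + apply (phase_group_iff M j HM Hj). now exists U.
  - intros [_ _ HMd HS] C HC. apply (phase_group_iff M j HM Hj) in HS. destruct HS as [U HU].
    (* The matrix and its diagonal part have the same domain; this bound and the next make their
       graph norms equivalent, so their embeddings are compact simultaneously. *)
    destruct (closed_operator_bounded_by_graph_norm M j U Hj HU T HMd HT HTc (fun p Hp => Hp))
      as [m Hm].
    destruct (perturbed_graph_norm_le T j B1 B2 (MH + MK) Hj Hd B1b B2l) as (m' & _ & Hm').
    rewrite <- (diagonal_compact_embedding A D HAl HDl). fold T. split.
    + intros Hs. apply (compact_embedding_compare M T m').
      * intros p Hp. split; [exact Hp|].
        eapply Rle_trans; [|now apply Hm']. unfold graph_norm. rewrite HMT. apply Rle_refl.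
      * now apply (embedding_compact_of_sine_compact M C).
    + intros Hs. apply (sine_compact_of_embedding_compact M C HM HC).
      apply (compact_embedding_compare T M (1 + Rabs m)); [|exact Hs].
      intros p Hp. split; [exact Hp|]. specialize (Hm p Hp).
      assert (Hg := graph_norm_pos M p).
      assert (Hmm : m * graph_norm M p <= Rabs m * graph_norm M p)
        by (apply Rmult_le_compat_r; [exact Hg|apply Rle_abs]).
      assert (Hpp : norm p <= graph_norm M p).
      { unfold graph_norm. generalize (norm_ge_0 (M p)). lra. }
      unfold graph_norm at 1. lra.
Qed.
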